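(* Let $\lambda<1$, and consider the fluid-limit equations, for $t\ge0$, $i\ge1$, $j\in[M]$, $$x_{i,j}(t)=x_{i,j}(0)+\frac{\lambda}{\gamma_j}\int_0^t p_{i-1,j}(\mathbf{x}(u))\,du-\int_0^t\mu_j\big(x_{i,j}(u)-x_{i+1,j}(u)\big)\,du. \qquad(\ast)$$ (i) There exists a unique fixed point $\mathbf{x}^*=(x^*_{i,j},i\ge1,j\in[M])\in S$ of the fluid limit $\mathbf{x}$ described by $(\ast)$, i.e., if $\mathbf{x}(0)=\mathbf{x}^*$ then $\mathbf{x}(t)=\mathbf{x}^*$ for all $t\ge0$. Furthermore, $$x^*_{1,j}=\min\Big(1,\frac{(\lambda-\sum_{k=1}^{j-1}\mu_k\gamma_k)_+}{\mu_j\gamma_j}\Big)\ \ \forall j\in[M],\qquad x^*_{i,j}=0\ \ \forall i\ge2,\ j\in[M].$$ (ii) (Global stability) Any solution $\mathbf{x}$ of $(\ast)$ with $\mathbf{x}(0)\in S$ converges to $\mathbf{x}^*$ component-wise: $x_{i,j}(t)\to x^*_{i,j}$ as $t\to\infty$ for all $i\ge1$ and $j\in[M]$. (iii) (Interchange of limits) The sequence $(\mathbf{x}^{(N)}(\infty))_N$ converges weakly to $\mathbf{x}^*$: $\mathbf{x}^{(N)}(\infty)\Rightarrow\mathbf{x}^*$ as $N\to\infty$.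
   Context: Parameters: $M\in\{1,2,\dots\}$; service rates $\mu_1>\dots>\mu_M>0$; proportions $\gamma_j\in(0,1]$ with $\sum_j\gamma_j=1$ and $\sum_j\gamma_j\mu_j=1$; $\lambda>0$; $N$ ranges over positive integers with $N\gamma_j\in\{1,2,\dots\}$ for all $j\in[M]=\{1,\dots,M\}$; $(x)_+=\max(x,0)$. System: $N$ servers, $N\gamma_j$ of type $j$ with service rate $\mu_j$, each with its own infinite-buffer FCFS queue; Poisson arrivals of rate $N\lambda$; i.i.d. exponential job sizes of mean $1$. Speed-Aware JSQ (SA-JSQ): each arriving job joins a server with the minimum queue length (number of jobs including the one in service) among all servers; ties between types are broken in favour of the fastest type (smallest $j$), ties within a type uniformly at random. $\mathbf{x}^{(N)}(t)=(x^{(N)}_{i,j}(t),i\ge1,j\in[M])$ with $x^{(N)}_{i,j}(t)$ the fraction of type $j$ servers with at least $i$ jobs. For $\lambda<1$ this Markov chain is positive recurrent, and $\mathbf{x}^{(N)}(\infty)$ is distributed according to its unique stationary distribution. Weak convergence is in the space $S=\{\mathbf{s}=(s_{i,j})_{i\ge1,j\in[M]}:1\ge s_{i,j}\ge s_{i+1,j}\ge0,\ \|\mathbf{s}\|_1<\infty\}$, $\|\mathbf{s}\|_1=\max_{j}\sum_{i\ge1}|s_{i,j}|$. Solutions of $(\ast)$ are $S$-valued functions on $[0,\infty)$. The functions $p_{i-1,j}:S\to[0,1]$ (limiting probability that an arrival joins a type $j$ server with $i-1$ jobs) are defined as follows. Let $\bar{\mathbb{Z}}_+=\{0,1,2,\dots\}\cup\{\infty\}$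 and let $\mathbf{E}$ be the set of arrays $\mathbf{v}=(v_{i,j})_{i\ge1,j\in[M]}$ in $\bar{\mathbb{Z}}_+$ with $v_{i,j}\le v_{i+1,j}$; put $v_{0,j}=0$. Let $$R_{i,j}=\{\mathbf{v}\in\mathbf{E}: v_{i,k}=0\ \forall k<j,\ v_{i-1,l}=0\ \forall l>j,\ 0=v_{i-1,j}<v_{i,j}\}.$$ For $\mathbf{s}\in S$ let $\mathbf{V}_{\mathbf{s}}$ be the Markov process on $\mathbf{E}$ with transitions $\mathbf{v}\to\mathbf{v}+\mathbf{e}_{i,j}$ at rate $\gamma_j\mu_j(s_{i,j}-s_{i+1,j})$ and $\mathbf{v}\to\mathbf{v}-\mathbf{e}_{i,j}$ at rate $\lambda\mathbf{1}(\mathbf{v}\in R_{i,j})$ (with $\infty\pm1=\infty$). Let $\pi_{\mathbf{s}}$ be a stationary probability measure of $\mathbf{V}_{\mathbf{s}}$ with $\pi_{\mathbf{s}}(v_{i,j}=\infty)=1$ whenever $s_{i,j}<1$, and $\lambda\pi_{\mathbf{s}}(R_{i,j})\le\mu_j\gamma_j(s_{i,j}-s_{i+1,j})$ whenever $s_{i,j}=1$. Then $p_{i-1,j}(\mathbf{s})=\pi_{\mathbf{s}}(R_{i,j})$, which is uniquely determined by $\mathbf{s}$. *)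

(* Defs.v *)
From HB Require Import structures.
From mathcomp Require Import all_boot all_order all_algebra.
From mathcomp Require Import all_classical all_reals all_analysis.
Import Order.TTheory GRing.Theory Num.Theory.
Import numFieldNormedType.Exports.

Set Implicit Arguments.
Unset Strict Implicit.
Unset Printing Implicit Defensive.

Local Open Scope classical_set_scope.
Local Open Scope ring_scope.

(* Indexing: levels i >= 1 are shifted to start at 0, and server types
   j = 1, ..., M are the elements of 'I_M.  Thus [s i j] is s_{i+1,j} and
   [v i j] is v_{i+1,j}; [join_region i j] is R_{i+1,j} and [join_prob s i j],
   the limiting probability of joining a type j server with i jobs, is
   p_{i,j}(s). *)

(* A Markov jump process whose total jump rate is bounded is given by its
   generator L, a bounded operator on bounded functions; its transition
   semigroup is P_t = exp(t L). *)
Section stationary.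
Context {R : realType}.

Definition semigroup (T : Type) (L : (T -> R) -> T -> R) (t : R)
    (f : T -> R) (v : T) : R :=
  limn (series (fun n => t ^+ n / n`!%:R * iter n L f v)).

Definition is_stationary (d : measure_display) (T : measurableType d)
    (L : (T -> R) -> T -> R) (pi : probability T R) : Prop :=
  forall t : R, 0 <= t -> forall A : set T, measurable A ->
    (\int[pi]_v (semigroup L t \1_A v)%:E = pi A)%E.

End stationary.

Section states.
Context {R : realType} {M : nat}.

Definition state := nat -> 'I_M -> R.

Definition norm1 (s : state) : \bar R :=
  (\big[maxe/0]_(j < M) \sum_(0 <= i <oo) `|s i j|%:E)%E.

Definition state_space : set state :=
  [set s | (forall i j, 0 <= s i.+1 j <= s i j /\ s i j <= 1) /\
           (norm1 s < +oo)%E].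

Definition state_continuous (f : state -> R) : Prop :=
  forall s, state_space s -> forall e : R, 0 < e ->
    exists2 d : R, 0 < d & forall s', state_space s' ->
      (norm1 (fun i j => s' i j - s i j)%R < d%:E)%E -> `|f s' - f s| < e.

Definition state_bounded (f : state -> R) : Prop :=
  exists C : R, forall s, state_space s -> `|f s| <= C.

End states.
Arguments state R M : clear implicits.

(* [Some n] is the integer n and [None] is infinity. *)
Definition enat := option nat.

Definition ele (a b : enat) : Prop :=
  match a, b with
  | _, None => True
  | None, Some _ => False
  | Some m, Some n => (m <= n)%N
  end.

Section join_probabilities.
Context {M : nat}.

Definition raw_blank := nat -> 'I_M -> enat.

HB.instance Definition _ := Pointed.on raw_blank.

Definition cylinders : set (set raw_blank) :=
  [set A | exists i j a, A = [set v | v i j = a]].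

(* All extended-integer arrays, with the product sigma-algebra.  The space E is
   the subset [blankE]: if s_{i+1,j} < 1 the jump v -> v + e_{i,j} may leave E
   from a state with v_{i,j} = v_{i+1,j} finite, so the generator is defined on
   all arrays, and the measures considered are carried by E (and by
   v_{i,j} = oo when s_{i,j} < 1), a set which the process does not leave. *)
Definition blank := g_sigma_algebraType cylinders.

Definition blankE : set blank := [set v | forall i j, ele (v i j) (v i.+1 j)].

Definition below (v : blank) (i : nat) (j : 'I_M) : enat :=
  if i is i'.+1 then v i' j else Some 0%N.

Definition join_region (i : nat) (j : 'I_M) : set blank :=
  [set v | [/\ blankE v,
               forall k : 'I_M, (k < j)%N -> v i k = Some 0%N,
               forall l : 'I_M, (j < l)%N -> below v i l = Some 0%N,
               below v i j = Some 0%N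
             & v i j <> Some 0%N]].

Definition update (g : nat -> nat) (v : blank) (i : nat) (j : 'I_M) : blank :=
  fun i' j' => if (i' == i) && (j' == j) then omap g (v i' j') else v i' j'.

Context {R : realType}.
Variables (mu gamma : 'I_M -> R) (lambda : R).

Definition blank_generator (s : state R M) (f : blank -> R) (v : blank) : R :=
  \sum_(j < M) limn (series (fun i =>
    gamma j * mu j * (s i j - s i.+1 j) * (f (update succn v i j) - f v) +
    lambda * \1_(join_region i j) v * (f (update predn v i j) - f v))).

Definition is_blank_measure (s : state R M) (pi : probability blank R) : Prop :=
  [/\ is_stationary (blank_generator s) pi,
      pi blankE = 1%E,
      forall i j, s i j < 1 -> pi [set v : blank | v i j = None] = 1%E
    & forall i j, s i j = 1 ->
        (lambda%:E * pi (join_region i j) <=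
         (mu j * gamma j * (s i j - s i.+1 j))%:E)%E].

(* Choice operator: for s in the state space the array so described exists and
   is unique. *)
Definition join_prob (s : state R M) : nat -> 'I_M -> R :=
  get [set p : nat -> 'I_M -> R | exists2 pi, is_blank_measure s pi &
                     forall i j, p i j = fine (pi (join_region i j))].

(* Only the values x t with t >= 0 are relevant.  Integrability of the
   integrands is part of the meaning of the equation. *)
Definition fluid_solution (x : R -> state R M) : Prop :=
  (forall t, 0 <= t -> state_space (x t)) /\
  forall t, 0 <= t -> forall i j,
    [/\ lebesgue_measure.-integrable `[0, t]
          (fun u => (join_prob (x u) i j)%:E),
        lebesgue_measure.-integrable `[0, t]
          (fun u => (mu j * (x u i j - x u i.+1 j))%:E)
      & x t i j = x 0 i j
          + lambda / gamma j *
            (\int[lebesgue_measure]_(u in `[0, t]) join_prob (x u) i j)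
          - \int[lebesgue_measure]_(u in `[0, t])
              (mu j * (x u i j - x u i.+1 j))].

Definition is_fixed_point (s : state R M) : Prop :=
  state_space s /\ fluid_solution (fun=> s).

End join_probabilities.
Arguments raw_blank M : clear implicits.
Arguments blank M : clear implicits.

Section sajsq.
Context {R : realType} {M : nat}.
Variables (mu gamma : 'I_M -> R) (lambda : R).

Definition admissible (N : nat) : Prop :=
  (0 < N)%N /\ forall j, exists2 n : nat, (0 < n)%N & N%:R * gamma j = n%:R.

(* For admissible N the truncation is exact. *)
Definition server (N : nat) : finType :=
  {j : 'I_M & 'I_(Num.truncn (N%:R * gamma j))}.

Definition config (N : nat) := {ffun server N -> nat}.

HB.instance Definition _ (N : nat) := Choice.on (config N).
HB.instance Definition _ (N : nat) :=
  isPointed.Build (config N) [ffun=> 0%N].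
HB.instance Definition _ (N : nat) :=
  @isMeasurable.Build default_measure_display (config N)
    discrete_measurable discrete_measurable0
    discrete_measurableC discrete_measurableU.

Definition targets (N : nat) (q : config N) : {set server N} :=
  [set r | [forall r', (q r <= q r')%N &&
                       ((q r' == q r) ==> (tag r <= tag r')%N)]].

Definition set_queue (N : nat) (q : config N) (r : server N) (n : nat) :
    config N :=
  [ffun r' => if r' == r then n else q r'].

(* Exponential job sizes of mean 1: a busy server of type j completes jobs at
   rate mu j.  Arrivals of rate N lambda are split uniformly over [targets]. *)
Definition sajsq_generator (N : nat) (f : config N -> R) (q : config N) : R :=
  \sum_(r in targets q)
     N%:R * lambda / #|targets q|%:R * (f (set_queue q r (q r).+1) - f q) +
  \sum_(r | (0 < q r)%N) mu (tag r) * (f (set_queue q r (q r).-1) - f q).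

Definition occupancy (N : nat) (q : config N) : state R M :=
  fun i j => #|[set r : server N | (tag r == j) && (i < q r)%N]|%:R
             / (N%:R * gamma j).

(* Weak convergence along admissible N of the laws of [occupancy], under the
   distributions Pi N of the configurations, to the point mass at s. *)
Definition occupancy_cvg_weakly
    (Pi : forall N, probability (config N) R) (s : state R M) : Prop :=
  forall f : state R M -> R, state_continuous f -> state_bounded f ->
    (\int[Pi N]_q f (occupancy q)) @[N --> within admissible \oo] --> f s.

End sajsq.

(* Main.v *)
(**
Let J be the type with sum_{k < J} mu_k gamma_k <= lambda < sum_{k <= J} mu_k gamma_k.
For a state x write z for the proportion of servers that are busy and of type k <= J, u for the
deviation of z from its value at xs, whose largest possible value is u_max, b for the
proportion of servers that are idle and of type k < J, and w for the number of jobs per server.  Then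
  V(x) = u^2 / (2 u_max) + (w - z) + K b^2
is a Lyapunov function.  As long as a server of type at most J idles every arrival joins
such a server, and if none idles then u = u_max; in both cases the drift of the first two
terms is at most (u / u_max) (lambda - B) - E, where B and E are the service rates in use
at the types k <= J and k > J, and u (lambda - B) <= - c u^2 + c' b^2.
For (ii), V(x(t)) - V(x(s)) <= - W(x(s)) (t - s) + C (t - s)^2 with a
nonnegative W that controls u, b and the remaining queues, so W(x(t)) tends to 0.
Uniqueness in (i) follows by applying (ii) to constant solutions.

That xs is a fixed point requires p(xs).  A blank measure exists because the queues of
idle servers form a priority queue whose excursions from the empty state have finite mean
length.  Rate conservation gives lambda p_{0,k} = mu_k gamma_k for k < J under every blank
measure, and type J receives the other arrivals.

For (iii), the same V plus a small multiple of sum_r q_r (q_r - 1) / (2 N) has drift at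
most C / N - G under the generator of the N-th system, with G >= 0 bounding the distance
to xs.  In stationarity the mean drift of bounded functions vanishes, so truncating and
Markov's inequality give P(G >= eta) <= C / (N eta).
*)
Require Import Defs.
From HB Require Import structures.
From mathcomp Require Import all_boot all_order all_algebra.
From mathcomp Require Import all_classical all_reals all_analysis.
From mathcomp Require Import measurable_realfun.
From mathcomp Require Import ring lra zify.
Import Order.TTheory GRing.Theory Num.Theory.
Import numFieldNormedType.Exports.

Set Implicit Arguments.
Unset Strict Implicit.
Unset Printing Implicit Defensive.

Local Open Scope classical_set_scope.
Local Open Scope ring_scope.

(** * Stationary distributions of bounded generators *)

(** The array p(x) jumps when a type becomes saturated, so V is not differentiated along solutions:
    its drift is stated over finite intervals with a quadratic error. Two facts about p serve there:
    its entries sum to at most 1, and those at level 0 of types below n sum to 1 while some type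
    below n has idle servers. The second fact needs a blank measure, whereas [join_prob] is a choice
    that defaults to 0 when none exists. While a type is saturated its first coordinate is maximal,
    so at almost every such time its inflow equals its outflow; were p the default, this balance
    would make a point mass a blank measure.

    On the shape of V: if a server of type at most J idles, then u' = lambda - B + D, with D the
    service rate at servers of these types that have jobs waiting, and the first two terms of V
    drift by (u / u_max - 1) u' + lambda - B - E. If none idles, the factor of the unknown u'
    vanishes.

    When lambda equals the capacity of the types below J, the total of their idle counts has drift 0
    and the excursion argument would fail; it is run with a second index I instead. *)

Section bounded_measurable.
Context d (T : measurableType d) (R : realType).
Implicit Types f g : T -> R.

Definition bmeas f : Prop :=
  measurable_fun setT f /\ exists c : R, forall x, `|f x| <= c.

Lemma bmeas_cst c : bmeas (fun=> c).
Proof. by split=> //; exists `|c|. Qed.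

Lemma bmeas_indic (A : set T) : measurable A -> bmeas \1_A.
Proof.
move=> mA; split; first exact: measurable_indic.
by exists 1 => x; rewrite indicE; case: (_ \in _); rewrite ?normr0 ?normr1.
Qed.

Lemma bmeasD f g : bmeas f -> bmeas g -> bmeas (f \+ g).
Proof.
move=> [mf [c cP]] [mg [e eP]]; split; first exact: measurable_funD.
by exists (c + e) => x; apply: le_trans (ler_normD _ _) (lerD _ _).
Qed.

Lemma bmeasB f g : bmeas f -> bmeas g -> bmeas (f \- g).
Proof.
move=> [mf [c cP]] [mg [e eP]]; split; first exact: measurable_funB.
by exists (c + e) => x; apply: le_trans (ler_normB _ _) (lerD _ _).
Qed.

Lemma bmeasM f g : bmeas f -> bmeas g -> bmeas (f \* g).
Proof.
move=> [mf [c cP]] [mg [e eP]]; split; first exact: measurable_funM.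
by exists (c * e) => x; rewrite normrM; apply: ler_pM.
Qed.

Lemma bmeas_integrable (P : probability T R) f :
  bmeas f -> P.-integrable setT (EFin \o f).
Proof.
move=> [mf [c cP]]; apply: measurable_bounded_integrable => //.
  exact: le_lt_trans (probability_le1 P measurableT) (ltry 1).
by exists c; split=> [|M cM x _]; [exact: num_real|exact: le_trans (cP x) (ltW cM)].
Qed.

Lemma bmeas_RintegralD (P : probability T R) f g : bmeas f -> bmeas g ->
  (\int[P]_x (f x + g x) = \int[P]_x f x + \int[P]_x g x)%R.
Proof. by move=> mf mg; rewrite RintegralD //; exact: bmeas_integrable. Qed.

Lemma bmeas_RintegralZ (P : probability T R) f a : bmeas f ->
  (\int[P]_x (a * f x) = a * \int[P]_x f x)%R.
Proof. by move=> mf; rewrite RintegralZl //; exact: bmeas_integrable. Qed.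

Lemma bmeas_RintegralB (P : probability T R) f g : bmeas f -> bmeas g ->
  (\int[P]_x (f x - g x) = \int[P]_x f x - \int[P]_x g x)%R.
Proof. by move=> mf mg; rewrite RintegralB //; exact: bmeas_integrable. Qed.

Lemma prob_Rintegral_cst (P : probability T R) (c : R) :
  (\int[P]_x c = c)%R.
Proof. by rewrite Rintegral_cst //= probability_setT mulr1. Qed.

Lemma prob_Rintegral_indic (P : probability T R) (A : set T) : measurable A ->
  (\int[P]_x \1_A x)%R = fine (P A).
Proof. by move=> mA; rewrite /Rintegral integral_indic// setIT. Qed.

Lemma bmeas_le_Rintegral (P : probability T R) f g : bmeas f -> bmeas g ->
  (forall x, f x <= g x) -> (\int[P]_x f x <= \int[P]_x g x)%R.
Proof. by move=> mf mg fg; apply: le_Rintegral => //; exact: bmeas_integrable. Qed.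

Lemma bmeas_norm_Rintegral (P : probability T R) f c : measurable_fun setT f ->
  (forall x, `|f x| <= c) -> `|\int[P]_x f x|%R <= c.
Proof.
move=> mf fc; have bf : bmeas f by split=> //; exists c.
apply: le_trans (le_normr_Rintegral _ (bmeas_integrable P bf)) _ => //.
rewrite -[leRHS](prob_Rintegral_cst P); apply: bmeas_le_Rintegral => //.
  by split; [exact: measurableT_comp|exists c => x; rewrite normr_id].
exact: bmeas_cst.
Qed.

End bounded_measurable.

Lemma series_tail (R : realType) (u e : R^nat) (N : nat) :
  (forall n, `|u n| <= e n) -> cvgn (series e) ->
  cvgn (series u) /\ `|limn (series u) - series u N| <= limn (series e) - series e N.
Proof.
move=> ue ce.
have e0 n : 0 <= e n by apply: le_trans (ue n).
have cu : cvgn (series u).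
  apply: normed_cvg; apply: series_le_cvg ce => // n.
  by rewrite /= normr_ge0.
split=> //.
have cl : (fun m => `|series u m - series u N|) @ \oo --> `|limn (series u) - series u N|.
  by apply: cvg_norm; apply: cvgB => //; exact: cvg_cst.
have cr : (fun m => series e m - series e N) @ \oo --> limn (series e) - series e N.
  by apply: cvgB => //; exact: cvg_cst.
apply: (ler_cvg_to cl cr); near=> m.
have Nm : (N <= m)%N by near: m; exists N.
rewrite !sub_series_geq//.
by apply: le_trans (ler_norm_sum _ _ _) _; exact: ler_sum.
Unshelve. all: by end_near.
Qed.

(** * Bounded operators and their exponential semigroups *)

Section bounded_operator.
Context d (T : measurableType d) (R : realType).
Implicit Types (f g : T -> R) (L : (T -> R) -> T -> R).

(** Operator norm at most [C] in the supremum norm. Both generators are of this kind because their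
    total jump rates are bounded. *)
Record bounded_operator (C : R) L : Prop := BoundedOperator {
  bop_measurable : forall f, bmeas f -> measurable_fun setT (L f);
  bop_le : forall f c, measurable_fun setT f -> (forall x, `|f x| <= c) ->
    forall x, `|L f x| <= C * c;
  bop_linear : forall a f g, bmeas f -> bmeas g ->
    forall x, L (fun y => a * f y + g y) x = a * L f x + L g x }.

Variables (C : R) (L : (T -> R) -> T -> R).
Hypotheses (C0 : 0 <= C) (bL : bounded_operator C L).

Lemma bop_bmeas f : bmeas f -> bmeas (L f).
Proof.
move=> bf; split; first exact: (bop_measurable bL).
by case: bf => mf [c cP]; exists (C * c); exact: (bop_le bL).
Qed.

Lemma bop_iter_bmeas f n : bmeas f -> bmeas (iter n L f).
Proof. by move=> bf; elim: n => //= n; exact: bop_bmeas. Qed.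

Lemma bop_iter_le f c n x : measurable_fun setT f -> (forall x, `|f x| <= c) ->
  `|iter n L f x| <= C ^+ n * c.
Proof.
move=> mf cP; have bf : bmeas f by split=> //; exists c.
elim: n x => [|n IH] x; first by rewrite expr0 mul1r.
rewrite /= exprS -mulrA; apply: (bop_le bL) => //.
by case: (bop_iter_bmeas n bf).
Qed.

(** Iterates of [L] grow at most like [C ^+ n], so the series is dominated termwise by that of
    [expR (t * C)]. The error is uniform in [x], which allows partial sums to be integrated against
    any probability. *)
Lemma semigroup_tail f t N : measurable_fun setT f -> (forall x, `|f x| <= 1) ->
  0 <= t -> forall x,
  cvgn (series (fun n => t ^+ n / n`!%:R * iter n L f x)) /\
  `|semigroup L t f x - series (fun n => t ^+ n / n`!%:R * iter n L f x) N| <=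
    expR (t * C) - series (exp_coeff (t * C)) N.
Proof.
move=> mf f1 t0 x; apply: series_tail; last exact: is_cvg_series_exp_coeff.
move=> n; rewrite normrM ger0_norm ?divr_ge0 ?exprn_ge0//.
have -> : exp_coeff (t * C) n = t ^+ n / n`!%:R * C ^+ n.
  by rewrite /exp_coeff /= exprMn mulrAC.
rewrite ler_wpM2l ?divr_ge0 ?exprn_ge0//.
by rewrite -[leRHS]mulr1; exact: bop_iter_le.
Qed.

Lemma semigroup_partial_bmeas f t N : bmeas f ->
  bmeas (fun x => series (fun n => t ^+ n / n`!%:R * iter n L f x) N).
Proof.
move=> bf; elim: N => [|N IH].
  by under eq_fun do rewrite /series /= big_geq//; exact: bmeas_cst.
under eq_fun do rewrite seriesSr.
by apply: bmeasD => //; apply: bmeasM; [exact: bmeas_cst|exact: bop_iter_bmeas].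
Qed.

Lemma semigroup_measurable f t : measurable_fun setT f -> (forall x, `|f x| <= 1) ->
  0 <= t -> measurable_fun setT (semigroup L t f).
Proof.
move=> mf f1 t0.
apply: (@measurable_fun_cvg _ _ _ _
  (fun N x => series (fun n => t ^+ n / n`!%:R * iter n L f x) N)).
  by move=> N; case: (@semigroup_partial_bmeas f t N) => //; split=> //; exists 1.
by move=> x _; case: (semigroup_tail 0 mf f1 t0 x).
Qed.

Lemma semigroup_bmeas f t : measurable_fun setT f -> (forall x, `|f x| <= 1) ->
  0 <= t -> bmeas (semigroup L t f).
Proof.
move=> mf f1 t0; split; first exact: semigroup_measurable.
exists (expR (t * C)) => x; have [_] := semigroup_tail 0 mf f1 t0 x.
by rewrite /series /= !big_geq// !subr0.
Qed.

Variable P : probability T R.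

(** Every term of the exponential series after the first is [L] of a bounded measurable function and
    integrates to 0; uniform convergence carries this over to the semigroup. *)
Lemma drift0_stationary :
  (forall f, bmeas f -> \int[P]_x L f x = 0) -> is_stationary L P.
Proof.
move=> L0 t t0 A mA.
have bA := @bmeas_indic _ T R A mA.
have A1 x : `|\1_A x : R| <= 1.
  by rewrite indicE; case: (_ \in _); rewrite ?normr0 ?normr1.
have bS := semigroup_bmeas bA.1 A1 t0.
suff E : \int[P]_x semigroup L t \1_A x = fine (P A).
  rewrite -[RHS]fineK ?fin_num_measure// -E /Rintegral fineK//.
  by apply: integrable_fin_num => //; exact: bmeas_integrable.
have partE N : \int[P]_x series (fun n => t ^+ n / n`!%:R * iter n L \1_A x) N.+1
    = fine (P A).
  elim: N => [|N IH].
    under eq_Rintegral do rewrite /series /= big_nat1 expr0 fact0 divr1 mul1r.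
    exact: prob_Rintegral_indic.
  under eq_Rintegral do rewrite seriesSr.
  rewrite bmeas_RintegralD; last 2 first.
    exact: semigroup_partial_bmeas.
    by apply: bmeasM; [exact: bmeas_cst|exact: bop_iter_bmeas].
  rewrite IH bmeas_RintegralZ; last exact: bop_iter_bmeas.
  by rewrite /= L0 ?mulr0 ?addr0//; exact: bop_iter_bmeas.
have dE N : `|\int[P]_x semigroup L t \1_A x - fine (P A)| <=
    expR (t * C) - series (exp_coeff (t * C)) N.+1.
  have bp := semigroup_partial_bmeas t N.+1 bA.
  rewrite -(partE N) -bmeas_RintegralB//.
  apply: bmeas_norm_Rintegral => [|x]; last first.
    by case: (semigroup_tail N.+1 bA.1 A1 t0 x).
  exact: (bmeasB _ _).1.
apply/eqP; rewrite -subr_eq0 -normr_le0.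
have cc : (fun N => expR (t * C) - series (exp_coeff (t * C)) N.+1) @ \oo -->
    expR (t * C) - expR (t * C).
  apply: cvgB; first exact: cvg_cst.
  by rewrite cvg_shiftS; exact: is_cvg_series_exp_coeff.
rewrite subrr in cc.
by apply: (cvgr_to_ge cc); apply: nearW.
Qed.

(** This is the derivative of stationarity at t = 0. The first-order remainder of the semigroup is
    at most expR (t C) - 1 - t C, hence of order t^2, and dividing by t leaves a bound that tends to
    0. *)
Lemma stationary_drift_indic (A : set T) : is_stationary L P -> measurable A ->
  \int[P]_x L \1_A x = 0.
Proof.
move=> st mA.
have bA := @bmeas_indic _ T R A mA.
have A1 x : `|\1_A x : R| <= 1.
  by rewrite indicE; case: (_ \in _); rewrite ?normr0 ?normr1.
have bLA := bop_bmeas bA.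
pose I := \int[P]_x L \1_A x.
have key t : 0 < t -> t * C <= 2^-1 -> `|I| <= t * (2 * C ^+ 2).
  move=> t0 tC; have t0' := ltW t0.
  have bS := semigroup_bmeas bA.1 A1 t0'.
  have ES : \int[P]_x semigroup L t \1_A x = fine (P A).
    by rewrite /Rintegral (st t t0' A mA).
  have tI : t * I = - \int[P]_x (semigroup L t \1_A x - (\1_A x + t * L \1_A x)).
    have b1 : bmeas (fun x => t * L \1_A x) by apply: bmeasM => //; exact: bmeas_cst.
    rewrite bmeas_RintegralB//; last exact: bmeasD.
    rewrite bmeas_RintegralD// bmeas_RintegralZ// ES prob_Rintegral_indic// -/I; ring.
  have tI2 : `|t * I| <= expR (t * C) - 1 - t * C.
    rewrite tI normrN; apply: bmeas_norm_Rintegral => [|x].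
      apply: (bmeasB _ _).1 => //.
      by apply: bmeasD => //; apply: bmeasM => //; exact: bmeas_cst.
    have [_] := semigroup_tail 2 bA.1 A1 t0' x.
    rewrite /series /= !big_nat_recr//= !big_geq// /exp_coeff /= !expr0 !expr1.
    rewrite fact0 factS fact0 muln1 !divr1 !mul1r !add0r => h.
    by rewrite -addrA -opprD.
  have e2 : expR (t * C) <= (1 - t * C)^-1.
    rewrite -[expR _]invrK -expRN lef_pV2 ?posrE ?expR_gt0//; last lra.
    exact: expR_ge1Dx.
  have tC0 : 0 <= t * C by apply: mulr_ge0.
  have e3 : (1 - t * C)^-1 <= 1 + t * C + 2 * (t * C) ^+ 2.
    rewrite invf_ple ?posrE; [|lra|by have := sqr_ge0 (t * C); lra].
    rewrite -[leLHS]mul1r ler_pdivrMr; last by have := sqr_ge0 (t * C); lra.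
    rewrite -subr_ge0.
    have -> : (1 - t * C) * (1 + t * C + 2 * (t * C) ^+ 2) - 1 =
      (t * C) ^+ 2 * (1 - 2 * (t * C)) by ring.
    by rewrite mulr_ge0 ?sqr_ge0//; lra.
  have : `|t * I| <= 2 * (t * C) ^+ 2 by apply: le_trans tI2 _; lra.
  rewrite normrM gtr0_norm// => h.
  rewrite -(ler_pM2l t0); apply: le_trans h _.
  by rewrite le_eqVlt; apply/orP; left; apply/eqP; ring.
apply/eqP; rewrite -normr_le0; apply/ler_addgt0Pr => e e0; rewrite add0r -/I.
(* The two bounds give [t * (2 * C ^+ 2) <= e] and [t * C <= 2^-1]; the added 1 covers [C = 0]. *)
pose t := Num.min (e / (2 * C ^+ 2 + 1)) (2^-1 / (C + 1)).
have h1 : 0 < 2 * C ^+ 2 + 1 by have := sqr_ge0 C; lra.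
have h2 : 0 < C + 1 by rewrite ltr_wpDl.
have t0 : 0 < t by rewrite lt_min !divr_gt0.
apply: le_trans (key t t0 _) _.
  apply: (@le_trans _ _ (2^-1 / (C + 1) * C)).
    by rewrite ler_wpM2r// ge_min lexx orbT.
  have : C / (C + 1) <= 1 by rewrite ler_pdivrMr// mul1r lerDl.
  by rewrite -mulrA [_ * C]mulrC => h; exact: ler_piMr.
apply: (@le_trans _ _ (e / (2 * C ^+ 2 + 1) * (2 * C ^+ 2))).
  by rewrite ler_wpM2r ?mulr_ge0 ?sqr_ge0// ge_min lexx.
rewrite -mulrA ler_piMr ?(ltW e0)// mulrC ler_pdivrMr// mul1r; lra.
Qed.

End bounded_operator.

(** The sum is the integer part of [y]. Written through indicators of superlevel sets, it turns a
    bounded function into a simple one. *)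
Lemma floor_sum_approx (R : realType) (K : nat) (y : R) : 0 <= y <= K%:R ->
  y - 1 <= \sum_(k < K) (k.+1%:R <= y :> R)%R%:R <= y.
Proof.
elim: K y => [|K IH] y /andP[y0 yK].
  by rewrite big_ord0; apply/andP; split; lra.
rewrite big_ord_recr /=.
have [yK'|Ky] := leP y K%:R.
  have -> : K.+1%:R <= y = false by apply/negbTE; rewrite -ltNge -natr1; lra.
  by rewrite addr0; apply: IH; rewrite y0.
rewrite (eq_bigr (fun=> 1)); last first.
  move=> k _; rewrite (_ : (k.+1%:R <= y) = true)//.
  by apply/idP; apply: le_trans (ltW Ky); rewrite ler_nat.
rewrite sumr_const card_ord -natr1; rewrite -natr1 in yK.
by have [h|h] := leP (K%:R + 1) y; rewrite /= ?addr0; apply/andP; split; lra.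
Qed.

Section stationary_drift.
Context d (T : measurableType d) (R : realType).
Variables (C : R) (L : (T -> R) -> T -> R).
Hypotheses (C0 : 0 <= C) (bL : bounded_operator C L).
Variable P : probability T R.
Hypothesis st : is_stationary L P.

Lemma stationary_drift_sum (A : nat -> set T) (c : R) (K : nat) :
  (forall k, measurable (A k)) ->
  \int[P]_x L (fun y => c * \sum_(k < K) \1_(A k) y) x = 0.
Proof.
move=> mA; elim: K => [|K IH].
  have -> : (fun y => c * \sum_(k < 0) \1_(A k) y) = \1_(set0 : set T) :> (T -> R).
    by apply/funext => y; rewrite big_ord0 mulr0 indic0.
  exact: (stationary_drift_indic C0 bL).
have bs K' : bmeas (fun y => c * \sum_(k < K') \1_(A k) y : R).
  apply: bmeasM; first exact: bmeas_cst.
  elim: K' => [|K' IH']; first by under eq_fun do rewrite big_ord0; exact: bmeas_cst.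
  under eq_fun do rewrite big_ord_recr /=.
  by apply: bmeasD => //; exact: bmeas_indic.
have bA : bmeas (\1_(A K) : T -> R) by exact: bmeas_indic.
have -> : (fun y => c * \sum_(k < K.+1) \1_(A k) y) =
    (fun y => c * \1_(A K) y + c * \sum_(k < K) \1_(A k) y).
  by apply/funext => y; rewrite big_ord_recr /= mulrDr addrC.
under eq_Rintegral do rewrite (bop_linear bL)//.
rewrite bmeas_RintegralD; last 2 first.
- by apply: bmeasM; [exact: bmeas_cst|exact: (bop_bmeas bL)].
- exact: (bop_bmeas bL).
rewrite IH addr0 bmeas_RintegralZ; last exact: (bop_bmeas bL).
by rewrite (stationary_drift_indic C0 bL)// mulr0.
Qed.

(** Stationarity speaks of indicators only. A simple function within 1 / (n + 1) of [f] has drift of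
    mean 0, and the difference costs at most C / (n + 1) because [L] is bounded. *)
Lemma stationary_drift (f : T -> R) : bmeas f -> \int[P]_x L f x = 0.
Proof.
move=> bf; have [mf [c cP]] := bf.
have bLf := bop_bmeas bL bf.
have key n : `|\int[P]_x L f x| <= C / n.+1%:R.
  have n0 : 0 < n.+1%:R :> R by rewrite ltr0n.
  pose g := fun y => n.+1%:R * (f y + c).
  have [K KP] : exists K : nat, n.+1%:R * (c + c) <= K%:R.
    by exists (Num.truncn (n.+1%:R * (c + c))).+1; apply/ltW; exact: truncnS_gt.
  pose A := fun k => [set y | k.+1%:R <= g y].
  have mg : measurable_fun setT g.
    by apply: measurable_funM => //; apply: measurable_funD.
  have mA k : measurable (A k).
    by rewrite -[A k]setTI; exact: (measurable_fun_le (f := cst k.+1%:R)).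
  pose s := fun y => n.+1%:R^-1 * \sum_(k < K) \1_(A k) y - c.
  have sle y : `|f y - s y| <= n.+1%:R^-1.
    have /andP[fl fu] : - c <= f y <= c by rewrite -ler_norml.
    have gK : 0 <= g y <= K%:R.
      rewrite /g mulr_ge0//=; last lra.
      by apply: le_trans KP; rewrite ler_wpM2l//; lra.
    have /andP[s1 s2] := floor_sum_approx gK.
    have -> : f y - s y = n.+1%:R^-1 * (g y - \sum_(k < K) (k.+1%:R <= g y :> R)%R%:R).
      rewrite /s /g mulrBr mulKf ?gt_eqF//.
      have -> : \sum_(k < K) \1_(A k) y = \sum_(k < K) (k.+1%:R <= g y :> R)%R%:R :> R.
        apply: eq_bigr => k _; rewrite indicE; congr (_%:R); congr nat_of_bool.
        by apply/idP/idP; rewrite inE.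
      by rewrite opprB addrA /g.
    rewrite normrM gtr0_norm ?invr_gt0// ler_piMr ?invr_ge0//.
    by rewrite ler_norml; apply/andP; split; lra.
  have bs0 : bmeas (fun y => n.+1%:R^-1 * \sum_(k < K) \1_(A k) y : R).
    apply: bmeasM; first exact: bmeas_cst.
    elim: (K) => [|K' IH']; first by under eq_fun do rewrite big_ord0; exact: bmeas_cst.
    under eq_fun do rewrite big_ord_recr /=.
    by apply: bmeasD => //; exact: bmeas_indic.
  have bT : bmeas (\1_(setT : set T) : T -> R) by exact: bmeas_indic.
  have sE : s = fun y => - c * \1_(setT : set T) y + n.+1%:R^-1 * \sum_(k < K) \1_(A k) y.
    by apply/funext => y; rewrite indicT mulr1 /s addrC.
  have bs : bmeas s.
    rewrite sE; apply: bmeasD => //; apply: bmeasM => //; exact: bmeas_cst.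
  have Ls : \int[P]_x L s x = 0.
    under eq_Rintegral do rewrite sE (bop_linear bL)//.
    rewrite bmeas_RintegralD; last 2 first.
    - by apply: bmeasM; [exact: bmeas_cst|exact: (bop_bmeas bL)].
    - exact: (bop_bmeas bL).
    rewrite stationary_drift_sum// addr0 bmeas_RintegralZ; last exact: (bop_bmeas bL).
    by rewrite (stationary_drift_indic C0 bL)// mulr0.
  have -> : \int[P]_x L f x = \int[P]_x L (fun y => (-1) * s y + f y) x.
    under [in RHS]eq_Rintegral do rewrite (bop_linear bL)//.
    rewrite bmeas_RintegralD//; last first.
      by apply: bmeasM; [exact: bmeas_cst|exact: (bop_bmeas bL)].
    by rewrite bmeas_RintegralZ ?Ls ?mulr0 ?add0r//; exact: (bop_bmeas bL).
  have bd : bmeas (fun y => (-1) * s y + f y).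
    by apply: bmeasD => //; apply: bmeasM => //; exact: bmeas_cst.
  apply: bmeas_norm_Rintegral; first exact: (bop_measurable bL).
  by apply: (bop_le bL); [exact: bd.1|move=> y; rewrite mulN1r addrC; exact: sle].
apply/eqP; rewrite -normr_le0.
have cc : (fun n => C * harmonic n) @ \oo --> C * 0.
  by apply: cvgM; [exact: cvg_cst|exact: cvg_harmonic].
rewrite mulr0 in cc.
by apply: (cvgr_to_ge cc); apply: nearW => n; exact: key.
Qed.

End stationary_drift.

(** * Join probabilities *)

Lemma measurable_exists_count d (T : measurableType d) (I : countType)
    (P : I -> T -> Prop) :
  (forall i, measurable [set x | P i x]) -> measurable [set x | exists i, P i x].
Proof.
move=> mP; rewrite [X in measurable X](_ : _ = \bigcup_i [set x | P i x]).
  by apply: countable_bigcupT_measurable => //; exact: countableP.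
by apply/seteqP; split=> x /= [i]; [exists i|move=> _; exists i].
Qed.

Lemma measurable_forall_count d (T : measurableType d) (I : countType)
    (P : I -> T -> Prop) :
  (forall i, measurable [set x | P i x]) -> measurable [set x | forall i, P i x].
Proof.
move=> mP; rewrite -[X in measurable X]setCK; apply: measurableC.
rewrite [X in measurable X](_ : _ = [set x | exists i, ~ P i x]); last first.
  by apply/seteqP; split=> x /=; [move/existsNP|move=> [i h] /(_ i)].
apply: measurable_exists_count => i; rewrite [X in measurable X](_ : _ = ~` [set x | P i x]); [exact: measurableC|by []].
Qed.

Lemma measurable_implies d (T : measurableType d) (b : bool) (P : T -> Prop) :
  measurable [set x | P x] -> measurable [set x | b -> P x].
Proof.
case: b => mP; last by rewrite [X in measurable X](_ : _ = setT)//; apply/seteqP; split.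
by rewrite [X in measurable X](_ : _ = [set x | P x])//; apply/seteqP; split=> x //= /(_ isT).
Qed.

(** * Measurability and disjointness of the join regions *)

Section blanks.
Context {M : nat}.
Implicit Types (v : blank M) (i : nat) (j : 'I_M).

Lemma measurable_coord_eq i j (a : enat) : measurable [set v : blank M | v i j = a].
Proof. by apply: sub_sigma_algebra; exists i, j, a. Qed.

Lemma measurable_coord i j (Q : enat -> Prop) : measurable [set v : blank M | Q (v i j)].
Proof.
rewrite [X in measurable X](_ : _ = [set v | exists a, (v i j = a) /\ Q a]); last first.
  by apply/seteqP; split=> v /=; [exists (v i j)|case=> a [->]].
apply: measurable_exists_count => a; have [Qa|Qa] := pselect (Q a).
  rewrite [X in measurable X](_ : _ = [set v | v i j = a]); first exact: measurable_coord_eq.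
  by apply/seteqP; split=> v //= [].
by rewrite [X in measurable X](_ : _ = set0)//; apply/seteqP; split=> v //= [].
Qed.

Lemma measurable_coord2 i j i' j' (Q : enat -> enat -> Prop) :
  measurable [set v : blank M | Q (v i j) (v i' j')].
Proof.
rewrite [X in measurable X](_ : _ = [set v | exists a, (v i j = a) /\ Q a (v i' j')]).
  apply: measurable_exists_count => a; apply: measurableI.
    exact: measurable_coord_eq.
  exact: (measurable_coord i' j' (Q a)).
by apply/seteqP; split=> v /=; [exists (v i j)|case=> a [->]].
Qed.

Lemma measurable_blankE : measurable (blankE : set (blank M)).
Proof.
by apply: measurable_forall_count => i; apply: measurable_forall_count => j;
  exact: measurable_coord2.
Qed.

Lemma measurable_below i j (Q : enat -> Prop) :
  measurable [set v : blank M | Q (below v i j)].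
Proof.
case: i => [|i]; last exact: (measurable_coord i j).
by rewrite /below; have [h|h] := pselect (Q (Some 0%N));
  [rewrite (_ : [set _ | _] = setT)|rewrite (_ : [set _ | _] = set0)] => //;
  apply/seteqP; split.
Qed.

Lemma measurable_join_region i j : measurable (join_region i j : set (blank M)).
Proof.
rewrite (_ : join_region i j = blankE `&`
  ([set v | forall k : 'I_M, (k < j)%N -> v i k = Some 0%N] `&`
  ([set v | forall l : 'I_M, (j < l)%N -> below v i l = Some 0%N] `&`
  ([set v | below v i j = Some 0%N] `&` [set v | v i j <> Some 0%N])))); last first.
  by apply/seteqP; split=> v /= []; [split|move=> ? [? [? []]]; split].
apply: measurableI; first exact: measurable_blankE.
apply: measurableI.
  by apply: measurable_forall_count => k; apply: measurable_implies;
    exact: measurable_coord_eq.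
apply: measurableI.
  by apply: measurable_forall_count => k; apply: measurable_implies;
    exact: (measurable_below i k (fun a => a = Some 0%N)).
apply: measurableI; first exact: (measurable_below i j (fun a => a = Some 0%N)).
exact: (measurable_coord i j (fun a => a <> Some 0%N)).
Qed.

Lemma measurable_update g i j :
  measurable_fun setT (fun v : blank M => update g v i j).
Proof.
apply: (@measurability _ _ (blank M) (blank M) setT _ (@cylinders M)) => //.
move=> _ [_ [i' [j' [a ->]]] <-]; rewrite setTI.
have [/andP[/eqP -> /eqP ->]|ne] := boolP ((i' == i) && (j' == j)).
  rewrite [X in measurable X](_ : _ = [set v | omap g (v i j) = a]).
    exact: (measurable_coord i j (fun x => omap g x = a)).
  by apply/seteqP; split=> v; rewrite /preimage /= /update !eqxx.
rewrite [X in measurable X](_ : _ = [set v | v i' j' = a]).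
  exact: measurable_coord_eq.
by apply/seteqP; split=> v; rewrite /preimage /= /update (negbTE ne).
Qed.

Lemma blankE_eq0 v i i' j : blankE v -> (i' <= i)%N -> v i j = Some 0%N ->
  v i' j = Some 0%N.
Proof.
move=> Ev; elim: i => [|i IH]; first by rewrite leqn0 => /eqP ->.
rewrite leq_eqVlt => /orP[/eqP -> //|]; rewrite ltnS => ii vi; apply: IH => //.
by have := Ev i j; rewrite vi; case: (v i j) => [[|n]|].
Qed.

(** Types after [j] vanish one level down by definition, types before [j] even at level [i];
    monotonicity in E carries the zeros to all lower levels. *)
Lemma join_region_below v i j i' j' : join_region i j v -> (i' < i)%N ->
  v i' j' = Some 0%N.
Proof.
move=> [Ev lt gt eq ne] ii.
have vi : below v i j' = Some 0%N.
  have [jj|jj|/val_inj <- //] := ltngtP (val j) (val j'); first exact: gt.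
  case: i {gt eq ne} ii lt => // i ii lt.
  by apply: (@blankE_eq0 v i.+1) => //; exact: lt.
by case: i vi ii {lt gt eq ne} => // i vi ii; exact: (@blankE_eq0 v i).
Qed.

(** Both pairs name the first nonzero coordinate of [v], ordered by level and then by type. *)
Lemma join_region_inj v i j i' j' : join_region i j v -> join_region i' j' v ->
  i = i' /\ j = j'.
Proof.
move=> h h'; have [_ lt _ _ ne] := h; have [_ lt' _ _ ne'] := h'.
have [ii|ii|ii] := ltngtP i i'.
- by case: ne; exact: (join_region_below j h' ii).
- by case: ne'; exact: (join_region_below j' h ii).
split=> //; subst i'; apply/val_inj.
have [jj|jj|//] := ltngtP (val j) (val j').
- by case: ne; exact: lt'.
- by case: ne'; exact: lt.
Qed.

Lemma join_region_series_le1 (R : realType) v j n :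
  series (fun i => \1_(join_region i j) v) n <= 1 :> R.
Proof.
rewrite /series /= big_mkord.
have [[i0 h]|h] := pselect (exists i : 'I_n, join_region i j v).
  rewrite (bigD1 i0)//= indicE mem_set// big1 ?addr0// => i ii0.
  rewrite indicE memNset// => hi; case/eqP: ii0; apply/val_inj.
  by case: (join_region_inj hi h).
rewrite big1// => i _; rewrite indicE memNset// => hi.
by apply: h; exists i.
Qed.

End blanks.

Section blank_generator.
Context {R : realType} {M : nat}.
Variables (mu gamma : 'I_M -> R) (lambda : R).
Hypotheses (mu_ge0 : forall j, 0 <= mu j) (gamma_ge0 : forall j, 0 <= gamma j).
Hypothesis lambda_ge0 : 0 <= lambda.
Variable s : state R M.
Hypothesis s_state : state_space s.
Implicit Types (f : blank M -> R) (v : blank M).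

Lemma state_ge0 i j : 0 <= s i j.
Proof. by case: i => [|i]; [have [] := s_state.1 0%N j; lra|have [/andP[]] := s_state.1 i j]. Qed.

Lemma state_le1 i j : s i j <= 1.
Proof. by have [] := s_state.1 i j. Qed.

Lemma state_dec i j : s i.+1 j <= s i j.
Proof. by have [/andP[]] := s_state.1 i j. Qed.

Let term f v j i := gamma j * mu j * (s i j - s i.+1 j) * (f (update succn v i j) - f v) +
    lambda * \1_(join_region i j) v * (f (update predn v i j) - f v).
Let env v j i : R := gamma j * mu j * (s i j - s i.+1 j) + lambda * \1_(join_region i j) v.

(** There are infinitely many levels, but the service rates telescope over them and the join regions
    are disjoint, so each type contributes a finite total jump rate. *)
Let env_le v j n : series (env v j) n <= gamma j * mu j + lambda.
Proof.
rewrite /series /= big_split /= -!mulr_sumr; apply: lerD.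
  rewrite ler_piMr ?mulr_ge0// (eq_bigr (fun i => - (s i.+1 j - s i j))); last first.
    by move=> i _; rewrite opprB.
  rewrite sumrN telescope_sumr// opprB.
  by have := state_ge0 n j; have := state_le1 0 j; lra.
by rewrite ler_piMr//; exact: join_region_series_le1.
Qed.

Let env_ge0 v j i : 0 <= env v j i.
Proof.
by rewrite addr_ge0// ?mulr_ge0// ?subr_ge0 ?state_dec// indicE ler0n.
Qed.

Let env_cvg v j : cvgn (series (env v j)).
Proof.
apply: nondecreasing_is_cvgn.
  by apply: nondecreasing_series => i _ _; exact: env_ge0.
by exists (gamma j * mu j + lambda) => _ [n _ <-]; exact: env_le.
Qed.

Let term_le f c v j i : (forall x, `|f x| <= c) -> `|term f v j i| <= 2 * c * env v j i.
Proof.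
move=> fc; have df x y : `|f x - f y| <= 2 * c.
  by rewrite mulr_natl mulr2n; exact: le_trans (ler_normB _ _) (lerD (fc _) (fc _)).
apply: le_trans (ler_normD _ _) _; rewrite /env [leRHS]mulrDr; apply: lerD.
  rewrite normrM ger0_norm ?mulr_ge0 ?subr_ge0 ?state_dec//.
  by rewrite mulrC ler_wpM2r// !mulr_ge0// ?subr_ge0 ?state_dec.
have i0 : 0 <= lambda * \1_(join_region i j) v :> R by rewrite mulr_ge0// indicE ler0n.
by rewrite normrM ger0_norm// mulrC ler_wpM2r.
Qed.

Let term_cvg f c v j : (forall x, `|f x| <= c) ->
  cvgn (series (term f v j)) /\
  `|limn (series (term f v j))| <= 2 * c * (gamma j * mu j + lambda).
Proof.
move=> fc.
have ce : cvgn (series (fun i => 2 * c * env v j i)).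
  by apply: is_cvg_seriesZ; exact: env_cvg.
have [ct] := series_tail 0 (fun i => term_le v j i fc) ce.
rewrite /series /= !big_geq// !subr0 => h; split=> //.
apply: le_trans h _; apply: limr_le => //; apply: nearW => n.
rewrite -mulr_sumr ler_wpM2l//; last exact: env_le.
by rewrite mulr_ge0//; apply: le_trans (fc point).
Qed.

Lemma blank_generator_bounded :
  bounded_operator (2 * \sum_(j < M) (gamma j * mu j + lambda))
    (blank_generator mu gamma lambda s).
Proof.
split.
- move=> f [mf [c fc]].
  rewrite /blank_generator; apply: measurable_sum => j.
  apply: (measurable_fun_cvg (h := fun n v => series (term f v j) n)); last first.
    by move=> v _; exact: (term_cvg v j fc).1.
  move=> n; rewrite /series /=; apply: measurable_sum => i.
  apply: measurable_funD; apply: measurable_funM => //.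
  + apply: measurable_funB => //; apply: measurableT_comp => //.
    exact: measurable_update.
  + by apply: measurable_funM => //; apply: measurable_indic; exact: measurable_join_region.
  + apply: measurable_funB => //; apply: measurableT_comp => //.
    exact: measurable_update.
- move=> f c mf fc v; rewrite mulrAC mulr_sumr.
  apply: le_trans (ler_norm_sum _ _ _) _; apply: ler_sum => j _.
  exact: (term_cvg v j fc).2.
- move=> a f g [_ [c fc]] [_ [e ge]] v.
  rewrite /blank_generator mulr_sumr -big_split /=; apply: eq_bigr => j _.
  apply/cvg_lim => //.
  have -> : series (fun i => gamma j * mu j * (s i j - s i.+1 j) *
      (a * f (update succn v i j) + g (update succn v i j) - (a * f v + g v)) +
      lambda * \1_(join_region i j) v *
      (a * f (update predn v i j) + g (update predn v i j) - (a * f v + g v))) =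
    (fun n => a * series (term f v j) n + series (term g v j) n).
    apply/funext => n; rewrite /series /= mulr_sumr -big_split /=.
    by apply: eq_bigr => i _; rewrite /term; ring.
  apply: cvgD; last exact: (term_cvg v j ge).1.
  by apply: cvgMr; exact: (term_cvg v j fc).1.
Qed.

End blank_generator.

Lemma sum_indic_disjoint_le1 (R : realType) T (I : finType) (Q : pred I)
    (A : I -> set T) (x : T) :
  (forall i i', A i x -> A i' x -> i = i') -> \sum_(i | Q i) \1_(A i) x <= 1 :> R.
Proof.
move=> dA; have [[i0 Q0 h]|h] := pselect (exists2 i, Q i & A i x).
  rewrite (bigD1 i0)//= indicE mem_set// big1 ?addr0// => i /andP[_ ii0].
  by rewrite indicE memNset// => hi; case/eqP: ii0; exact: dA.
by rewrite big1// => i Qi; rewrite indicE memNset// => hi; apply: h; exists i.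
Qed.

Lemma probI1 d (T : measurableType d) (R : realType) (P : probability T R)
    (A B : set T) : measurable A -> measurable B -> P A = 1%E -> P B = 1%E ->
  P (A `&` B) = 1%E.
Proof.
move=> mA mB PA PB; have mAB := measurableI _ _ mA mB.
have A0 : P (~` A) = 0%E by rewrite probability_setC// PA subee.
have B0 : P (~` B) = 0%E by rewrite probability_setC// PB subee.
have AB0 : P (~` (A `&` B)) = 0%E.
  rewrite setCI; apply/eqP; rewrite eq_le measure_ge0 andbT.
  have := measureU2 P (measurableC mA) (measurableC mB).
  by move/le_trans; apply; rewrite [X in (X + _)%E]A0 [X in (_ + X)%E]B0 adde0.
have := probability_setC P (measurableC mAB).
by rewrite AB0 setCK sube0.
Qed.

Section probability_sums.
Context d (T : measurableType d) (R : realType) (P : probability T R).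
Context (I : finType) (Q : pred I) (A : I -> set T).
Hypothesis mA : forall i, measurable (A i).

Lemma bmeas_sum_indic : bmeas (fun x => \sum_(i | Q i) \1_(A i) x : R).
Proof.
elim: (index_enum I) => [|i l IH].
  by under eq_fun do rewrite big_nil; exact: bmeas_cst.
under eq_fun do rewrite big_cons.
by case: (Q i) => //; apply: bmeasD => //; exact: bmeas_indic.
Qed.

Lemma Rintegral_sum_indic :
  \int[P]_x (\sum_(i | Q i) \1_(A i) x) = \sum_(i | Q i) fine (P (A i)).
Proof.
have bs : forall l : seq I, bmeas (fun x => \sum_(i <- l | Q i) \1_(A i) x : R).
  elim=> [|i l IH]; first by under eq_fun do rewrite big_nil; exact: bmeas_cst.
  under eq_fun do rewrite big_cons.
  by case: (Q i) => //; apply: bmeasD => //; exact: bmeas_indic.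
elim: (index_enum I) => [|i l IH].
  by under eq_Rintegral do rewrite big_nil; rewrite big_nil prob_Rintegral_cst.
under eq_Rintegral do rewrite big_cons.
rewrite big_cons; case: (Q i) => //.
by rewrite bmeas_RintegralD ?IH ?prob_Rintegral_indic//; exact: bmeas_indic.
Qed.

Lemma prob_sum_disjoint_le1 : (forall x i i', A i x -> A i' x -> i = i') ->
  \sum_(i | Q i) fine (P (A i)) <= 1.
Proof.
move=> dA; rewrite -Rintegral_sum_indic -[leRHS](prob_Rintegral_cst P).
apply: bmeas_le_Rintegral => [||x]; [exact: bmeas_sum_indic|exact: bmeas_cst|].
by apply: sum_indic_disjoint_le1 => i i'; exact: dA.
Qed.

Lemma prob_sum_cover_ge1 (B : set T) : measurable B -> P B = 1%E ->
  (forall x, B x -> exists2 i, Q i & A i x) -> 1 <= \sum_(i | Q i) fine (P (A i)).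
Proof.
move=> mB PB BA; rewrite -Rintegral_sum_indic.
have -> : 1 = \int[P]_x (\1_B x : R) by rewrite prob_Rintegral_indic// PB.
apply: bmeas_le_Rintegral => [||x]; [exact: bmeas_indic|exact: bmeas_sum_indic|].
have [Bx|Bx] := pselect (B x); last by rewrite indicE memNset// sumr_ge0// => i _; rewrite indicE ler0n.
have [i Qi Ai] := BA x Bx.
rewrite indicE mem_set// (bigD1 i)//= [X in X + _]indicE mem_set//.
by rewrite lerDl sumr_ge0// => i' _; rewrite indicE ler0n.
Qed.

End probability_sums.

Section join_probabilities.
Context {R : realType} {M : nat}.
Variables (mu gamma : 'I_M -> R) (lambda : R).
Hypotheses (mu_ge0 : forall j, 0 <= mu j) (gamma_ge0 : forall j, 0 <= gamma j).
Hypothesis lambda_ge0 : 0 <= lambda.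
Variable s : state R M.
Local Notation p := (join_prob mu gamma lambda s).

(** The second alternative is the default value of [get]. The elementary bounds on [join_prob] hold
    in both cases, so they can be used at any state without an existence theorem. *)
Lemma join_probP :
  (exists2 pi, is_blank_measure mu gamma lambda s pi &
     forall i j, p i j = fine (pi (join_region i j))) \/
  (~ (exists pi, is_blank_measure mu gamma lambda s pi) /\ forall i j, p i j = 0).
Proof.
have [[pi hpi]|h] := pselect (exists pi, is_blank_measure mu gamma lambda s pi).
  left; apply: (@getPex _ [set p : nat -> 'I_M -> R |
    exists2 pi, is_blank_measure mu gamma lambda s pi &
    forall i j, p i j = fine (pi (join_region i j))]).
  by exists (fun i j => fine (pi (join_region i j))), pi.
right; split=> // i j; rewrite /join_prob.
rewrite getPN// => q /= [pi hpi _].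
by apply: h; exists pi.
Qed.

Lemma join_prob_ge0 i j : 0 <= p i j.
Proof. by case: join_probP => [[pi _ ->]|[_ ->]]//; exact: fine_ge0. Qed.

Lemma join_prob_sum_le1 n : \sum_(i < n) \sum_(j < M) p i j <= 1.
Proof.
case: join_probP => [[pi _ pE]|[_ p0]]; last first.
  by rewrite big1// => i _; rewrite big1.
rewrite pair_big /=.
under eq_bigr do rewrite pE.
apply: (@prob_sum_disjoint_le1 _ _ _ pi _ xpredT (fun x : 'I_n * 'I_M => join_region x.1 x.2)).
  by move=> ?; exact: measurable_join_region.
move=> v [i j] [i' j'] /= h h'; have [ii ->] := join_region_inj h h'.
by congr pair; exact/val_inj.
Qed.

Lemma join_prob_sum0_le1 (Q : pred 'I_M) : \sum_(j < M | Q j) p 0%N j <= 1.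
Proof.
apply: le_trans (join_prob_sum_le1 1); rewrite big_ord1 [leRHS](bigID Q)/=.
by rewrite lerDl sumr_ge0// => j _; exact: join_prob_ge0.
Qed.

Lemma join_prob_le1 i j : p i j <= 1.
Proof.
apply: le_trans (join_prob_sum_le1 i.+1); rewrite big_ord_recr /= (bigD1 j)//=.
rewrite addrCA lerDl addr_ge0// ?sumr_ge0// => *; rewrite ?sumr_ge0// => *; exact: join_prob_ge0.
Qed.

(** [s 0 k < 1] means infinitely many idle servers of type [k]: almost surely [v 0 k] is infinite,
    so the first nonzero coordinate lies at level 0 and at a type no later than [k]. *)
Lemma blank_measure_join_ge1 pi (k : 'I_M) (n : nat) : is_blank_measure mu gamma lambda s pi ->
  (k < n)%N -> s 0%N k < 1 ->
  1 <= \sum_(j < M | (j < n)%N) fine (pi (join_region 0 j)).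
Proof.
move=> [_ piE pioo _] km sk.
apply: (@prob_sum_cover_ge1 _ _ _ pi _ _ (join_region 0) _ (blankE `&` [set v | v 0%N k = None])).
- by move=> j; exact: measurable_join_region.
- by apply: measurableI; [exact: measurable_blankE|exact: measurable_coord_eq].
- by apply: probI1 => //; [exact: measurable_blankE|exact: measurable_coord_eq|exact: pioo].
- move=> v [Ev vk].
  have kP : v 0%N k != Some 0%N by rewrite vk.
  pose j := [arg min_(j < k | v 0%N j != Some 0%N) val j].
  rewrite -/j; case: (@arg_minnP _ k (fun j => v 0%N j != Some 0%N) val kP) => {}j vj jmin.
  exists j; first by apply: leq_ltn_trans (jmin k kP) km.
  split=> //; last exact/eqP.
  move=> l lj; apply/eqP; apply: contraTT lj => vl.
  by rewrite -leqNgt; exact: jmin.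
Qed.

End join_probabilities.

(** * Blank measures forced by the balance equations *)

Section dirac_blank_measure.
Context {R : realType} {M : nat}.
Variables (mu gamma : 'I_M -> R) (lambda : R).
Hypotheses (mu_gt0 : forall j, 0 < mu j) (gamma_gt0 : forall j, 0 < gamma j).
Hypothesis lambda_ge0 : 0 <= lambda.
Variable s : state R M.
Hypothesis s_state : state_space s.

Let mu_ge0 j : 0 <= mu j. Proof. exact: ltW. Qed.
Let gamma_ge0 j : 0 <= gamma j. Proof. exact: ltW. Qed.

Lemma dirac_stationary (v0 : blank M) :
  (forall f, blank_generator mu gamma lambda s f v0 = 0) ->
  is_stationary (blank_generator mu gamma lambda s) (\d_v0 : probability (blank M) R).
Proof.
move=> L0.
have bL := blank_generator_bounded mu_ge0 gamma_ge0 lambda_ge0 s_state.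
apply: (drift0_stationary bL) => f bf.
rewrite /Rintegral integral_dirac//; last first.
  by apply/measurable_EFinP; exact: (bop_measurable bL).
by rewrite L0 mule0.
Qed.

(** If [s 1 j = 1] for every saturated type [j], no server of such a type ever falls idle. The array
    that is 0 at these types on level 0 and infinite elsewhere is then absorbing; its infinite entry
    at [k0] keeps it out of all join regions above level 0. *)
Lemma dirac_blank_measure (k0 : 'I_M) : s 0%N k0 < 1 ->
  (forall j, s 0%N j = 1 -> s 1%N j = 1) ->
  exists pi, is_blank_measure mu gamma lambda s pi.
Proof.
move=> sk0 s1.
pose v0 : blank M := fun i j =>
  if (i == 0%N) && (s 0%N j == 1) then Some 0%N else None.
have nR i j : s i j = 1 -> ~ join_region i j v0.
  case: i => [|i] sij; first by case=> _ _ _ _; rewrite /v0 eqxx sij eqxx.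
  move/join_region_below => /(_ 0%N k0 isT); rewrite /v0 eqxx /=.
  by rewrite lt_eqF.
have E0 : blankE v0 by move=> i j; have -> : v0 i.+1 j = None by []; case: (v0 i j).
exists (\d_v0 : probability (blank M) R); split.
- apply: dirac_stationary => f; rewrite /blank_generator big1// => j _.
  apply/cvg_lim => //; rewrite [X in X @ _ --> _](_ : _ = cst 0); first exact: cvg_cst.
  apply/funext => n; rewrite /series /= big1// => i _.
  have upd g : s i j < 1 \/ i != 0%N -> update g v0 i j = v0.
    move=> h; apply/funext => i'; apply/funext => j'; rewrite /update.
    case: ifP => // /andP[/eqP -> /eqP ->]; rewrite /v0.
    case: eqP => //= i0; case: h; last by rewrite i0.
    by rewrite i0 => /lt_eqF ->.
  have [sij|sij] := eqVneq (s i j) 1; last first.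
    have sl : s i j < 1 by rewrite lt_neqAle sij (state_le1 s_state).
    by rewrite !upd; [rewrite !subrr !mulr0 addr0|left|left].
  rewrite [\1_ _ _]indicE memNset ?mulr0 ?mul0r ?addr0; last exact: nR.
  have [i0|i0] := eqVneq i 0%N; last by rewrite upd ?subrr ?mulr0//; right.
  by rewrite i0 in sij *; rewrite sij s1// subrr mulr0 mul0r.
- by have := @diracE _ _ R v0 blankE; rewrite mem_set.
- move=> i j sij; have := @diracE _ _ R v0 [set v | v i j = None].
  by rewrite mem_set//= /v0; case: i sij => //= sij; rewrite lt_eqF.
- move=> i j sij; have := @diracE _ _ R v0 (join_region i j).
  rewrite memNset => [h|]; last exact: nR.
  rewrite [X in (_ * X)%E]h.
  by rewrite mule0 lee_fin !mulr_ge0// subr_ge0 (state_dec s_state).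
Qed.

(* Without a blank measure at [s], [join_prob] is the default value 0; the
   hypothesis then gives [s 1 j = 1] whenever [s 0 j = 1], and a point mass is a
   blank measure after all. *)
Lemma join_prob_blank_measure (k0 : 'I_M) : s 0%N k0 < 1 ->
  (forall j, s 0%N j = 1 ->
     lambda * join_prob mu gamma lambda s 0%N j = mu j * gamma j * (1 - s 1%N j)) ->
  exists2 pi, is_blank_measure mu gamma lambda s pi &
     forall i j, join_prob mu gamma lambda s i j = fine (pi (join_region i j)).
Proof.
move=> sk0 bal; case: (join_probP mu gamma lambda s) => // -[npi p0]; exfalso.
apply/npi/(dirac_blank_measure sk0) => j sj.
have := bal j sj; rewrite p0 mulr0 => /esym/eqP.
by rewrite !mulf_eq0 (gt_eqF (mu_gt0 j)) (gt_eqF (gamma_gt0 j)) /= subr_eq0 => /eqP.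
Qed.

Lemma join_prob_cover (k : 'I_M) (n : nat) :
  (forall j, s 0%N j = 1 ->
     lambda * join_prob mu gamma lambda s 0%N j = mu j * gamma j * (1 - s 1%N j)) ->
  (k < n)%N -> s 0%N k < 1 ->
  \sum_(j < M | (j < n)%N) join_prob mu gamma lambda s 0%N j = 1.
Proof.
move=> bal km sk; apply/eqP; rewrite eq_le join_prob_sum0_le1//=.
have [pi hpi pE] := join_prob_blank_measure sk bal.
under eq_bigr do rewrite pE.
exact: (blank_measure_join_ge1 hpi km sk).
Qed.

End dirac_blank_measure.

(** * Increments of fluid solutions *)

(** Derivability is asked at [c] alone because the primitive to which this applies is differentiable
    only almost everywhere. *)
Lemma derive1_local_max (R : realType) (f : R -> R) (a b c : R) : a < c < b ->
  (forall t, a < t < b -> f t <= f c) -> derivable f c 1 -> derive1 f c = 0.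
Proof.
move=> /andP[ac cb] cmax df; have := df; rewrite /derivable => /cvg_ex[l hl].
have -> : derive1 f c = l by rewrite derive1E; exact/cvg_lim.
apply/eqP; rewrite eq_le; apply/andP; split.
  apply: (cvgr_to_le (cvg_dnbhs_at_right hl)); near=> h.
  have h0 : 0 < h by near: h; exact: nbhs_right_gt.
  rewrite /= pmulr_rle0 ?invr_gt0// subr_le0; apply: cmax.
  have hb : h < b - c by near: h; apply: nbhs_right_lt; rewrite subr_gt0.
  by rewrite [_%:A]mulr1; apply/andP; split; lra.
apply: (cvgr_to_ge (cvg_dnbhs_at_left hl)); near=> h.
have h0 : h < 0 by near: h; exact: nbhs_left_lt.
rewrite /= nmulr_rge0 ?invr_lt0// subr_le0; apply: cmax.
have hb : a - c < h by near: h; apply: nbhs_left_gt; rewrite subr_lt0.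
by rewrite [_%:A]mulr1; apply/andP; split; lra.
Unshelve. all: by end_near. Qed.

(** By Lebesgue differentiation the primitive has derivative [g t] at almost every [t], and at an
    interior maximum that derivative is 0. *)
Lemma ae_eq0_at_max (R : realType) (g : R -> R) (c m T : R) :
  lebesgue_measure.-integrable `[0, T] (EFin \o g) ->
  (forall t, 0 <= t <= T -> c + \int[lebesgue_measure]_(u in `[0, t]) g u <= m) ->
  {ae lebesgue_measure, forall t, 0 < t < T ->
    c + \int[lebesgue_measure]_(u in `[0, t]) g u = m -> g t = 0}.
Proof.
move=> ig cg.
(* The cut-off is integrable on the whole line and has the same primitive up to [T]. *)
pose f := g \_ `[0, T].
have fi : lebesgue_measure.-integrable setT (EFin \o f).
  by rewrite -restrict_EFin; apply/(integrable_mkcond _ _).1.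
have fiS (A : set R) : measurable A -> lebesgue_measure.-integrable A (EFin \o f).
  by move=> mA; exact: integrableS fi.
have lf : locally_integrable setT f by exact: integrable_locally.
have := @FTC1 R f (BLeft 0) (fun y => fiS _ (measurable_itv _)) lf.
apply: filterS; first exact: (ae_filter_ringOfSetsType lebesgue_measure).
move=> t ht /andP[t0 tT] ct.
have FE y : 0 <= y <= T -> \int[lebesgue_measure]_(u in `[0, y]) f u =
    \int[lebesgue_measure]_(u in `[0, y]) g u.
  move=> /andP[y0 yT]; apply: eq_Rintegral => u; rewrite inE /= in_itv /= => /andP[u0 uy].
  by rewrite /f patchE mem_set//= in_itv /= u0 (le_trans uy).
case: ht => [|df].
  by rewrite /= lte_fin.
 rewrite /f patchE mem_set/=; last by rewrite in_itv /= !ltW.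
move=> <-; apply: (@derive1_local_max _ _ 0 T) => //; first by rewrite t0.
move=> s /andP[s0 sT]; rewrite !FE ?(ltW s0) ?(ltW sT) ?(ltW t0) ?(ltW tT)//.
by rewrite -(lerD2l c) ct; apply: cg; rewrite !ltW.
Qed.

Section integral_on_interval.
Context {R : realType}.
Implicit Types (f g : R -> R) (s t c e : R).
Local Notation leb := (@lebesgue_measure R).

Lemma Rintegral_oc_cst s t c : s <= t ->
  \int[leb]_(u in `]s, t]) c = c * (t - s).
Proof.
move=> st; rewrite Rintegral_cst//= lebesgue_measure_itv/= lte_fin.
by move: st; rewrite le_eqVlt => /predU1P[->|->//]; rewrite ltxx subrr.
Qed.

Lemma integrable_oc_cst s t c : leb.-integrable `]s, t] (EFin \o cst c).
Proof.
apply: measurable_bounded_integrable => //.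
  by rewrite /= lebesgue_measure_itv/=; case: ifP => //; rewrite -EFinB ltry.
by exists `|c|; split=> // M /ltW cM u _ /=.
Qed.

Lemma Rintegral_oc_le f c s t : s <= t -> leb.-integrable `]s, t] (EFin \o f) ->
  (forall u, s < u <= t -> f u <= c) -> \int[leb]_(u in `]s, t]) f u <= c * (t - s).
Proof.
move=> st fi fc; rewrite -Rintegral_oc_cst//.
apply: le_Rintegral => //; first exact: integrable_oc_cst.
Qed.

Lemma Rintegral_oc_ge f c s t : s <= t -> leb.-integrable `]s, t] (EFin \o f) ->
  (forall u, s < u <= t -> c <= f u) -> c * (t - s) <= \int[leb]_(u in `]s, t]) f u.
Proof.
move=> st fi fc; rewrite -Rintegral_oc_cst//.
apply: le_Rintegral => //; first exact: integrable_oc_cst.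
Qed.

Lemma Rintegral_oc_approx f c e s t : s <= t -> leb.-integrable `]s, t] (EFin \o f) ->
  (forall u, s < u <= t -> `|f u - c| <= e) ->
  `|\int[leb]_(u in `]s, t]) f u - c * (t - s)| <= e * (t - s).
Proof.
move=> st fi fc; rewrite ler_norml.
have h1 := @Rintegral_oc_le f (c + e) s t st fi.
have h2 := @Rintegral_oc_ge f (c - e) s t st fi.
have {}h1 : \int[leb]_(u in `]s, t]) f u <= c * (t - s) + e * (t - s).
  by rewrite -mulrDl; apply: h1 => u /fc; rewrite ler_norml => /andP[_]; lra.
have {}h2 : c * (t - s) - e * (t - s) <= \int[leb]_(u in `]s, t]) f u.
  by rewrite -mulrBl; apply: h2 => u /fc; rewrite ler_norml => /andP[]; lra.
by apply/andP; split; lra.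
Qed.

Lemma Rintegral_0t_split g s t : 0 <= s <= t -> leb.-integrable `[0, t] (EFin \o g) ->
  \int[leb]_(u in `[0, t]) g u - \int[leb]_(u in `[0, s]) g u =
  \int[leb]_(u in `]s, t]) g u.
Proof. by move=> /andP[s0 st] gi; rewrite Rintegral_itvB. Qed.

Lemma integrable_oc_sub g s t : 0 <= s -> leb.-integrable `[0, t] (EFin \o g) ->
  leb.-integrable `]s, t] (EFin \o g).
Proof.
move=> s0; apply: integrableS => // u /=; rewrite !in_itv/= => /andP[su ->].
by rewrite (le_trans s0)// ltW.
Qed.

End integral_on_interval.

Lemma integrable_sum_real d (T : measurableType d) (R : realType)
    (m : {measure set T -> \bar R}) (D : set T) (I : Type) (r : seq I) (Q : pred I)
    (f : I -> T -> R) : measurable D ->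
  (forall i, m.-integrable D (EFin \o f i)) ->
  m.-integrable D (EFin \o (fun x => \sum_(i <- r | Q i) f i x)).
Proof.
move=> mD fi; rewrite (_ : EFin \o _ = fun x => (\sum_(i <- r | Q i) (f i x)%:E)%E).
  by apply: integrable_sum => // i _; exact: fi.
by apply/funext => x /=; rewrite sumEFin.
Qed.

Lemma Rintegral_sum d (T : measurableType d) (R : realType)
    (m : {measure set T -> \bar R}) (D : set T) (I : Type) (r : seq I) (Q : pred I)
    (f : I -> T -> R) : measurable D ->
  (forall i, m.-integrable D (EFin \o f i)) ->
  \int[m]_(x in D) (\sum_(i <- r | Q i) f i x) = \sum_(i <- r | Q i) \int[m]_(x in D) f i x.
Proof.
move=> mD fi; elim: r => [|i r IH].
  under eq_Rintegral do rewrite big_nil.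
  by rewrite big_nil /Rintegral; under eq_integral do rewrite -[0%:E]/0%E; rewrite integral0.
under eq_Rintegral do rewrite big_cons.
rewrite big_cons; case: (Q i) => //.
by rewrite RintegralD ?IH//; exact: integrable_sum_real.
Qed.

Lemma ae_lebesgueS (R : realType) (P Q : R -> Prop) : (forall u, P u -> Q u) ->
  {ae (@lebesgue_measure R), forall u, P u} -> {ae (@lebesgue_measure R), forall u, Q u}.
Proof.
by move=> PQ [A [mA A0 PA]]; exists A; split=> // u /= nQ; apply: PA => /PQ.
Qed.

Section fluid.
Context {R : realType} {M : nat}.
Variables (mu gamma : 'I_M -> R) (lambda : R).
Hypotheses (mu_gt0 : forall j, 0 < mu j) (gamma_gt0 : forall j, 0 < gamma j).
Hypothesis lambda_gt0 : 0 < lambda.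
Variable x : R -> state R M.
Hypothesis xsol : fluid_solution mu gamma lambda x.
Local Notation leb := (@lebesgue_measure R).
Local Notation p u i j := (join_prob mu gamma lambda (x u) i j).

Definition joined i j (s t : R) : R := \int[leb]_(u in `]s, t]) p u i j.

Definition rate_bound : R := \sum_(j < M) (lambda / gamma j + mu j).

Let x_state t : 0 <= t -> state_space (x t). Proof. exact: xsol.1. Qed.

Let p_int s t i j : 0 <= s <= t -> leb.-integrable `]s, t] (EFin \o (fun u => p u i j)).
Proof.
move=> /andP[s0 st]; apply: integrable_oc_sub => //.
by have [+ _ _] := xsol.2 t (le_trans s0 st) i j.
Qed.

Let d_int s t i j : 0 <= s <= t ->
  leb.-integrable `]s, t] (EFin \o (fun u => mu j * (x u i j - x u i.+1 j))).
Proof.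
move=> /andP[s0 st]; apply: integrable_oc_sub => //.
by have [_ + _] := xsol.2 t (le_trans s0 st) i j.
Qed.

Lemma fluid_increment s t i j : 0 <= s <= t ->
  x t i j - x s i j = lambda / gamma j * joined i j s t -
    \int[leb]_(u in `]s, t]) (mu j * (x u i j - x u i.+1 j)).
Proof.
move=> s0t; have /andP[s0 st] := s0t.
have [p1 d1 ->] := xsol.2 t (le_trans s0 st) i j.
have [p2 d2 ->] := xsol.2 s s0 i j.
by rewrite /joined -!Rintegral_0t_split//; ring.
Qed.

Lemma joined_ge0 s t i j : 0 <= joined i j s t.
Proof. by apply: Rintegral_ge0 => u _; exact: join_prob_ge0. Qed.

Lemma joined_sum_le s t n : 0 <= s <= t ->
  \sum_(i < n) \sum_(j < M) joined i j s t <= t - s.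
Proof.
move=> s0t; have /andP[s0 st] := s0t.
have -> : \sum_(i < n) \sum_(j < M) joined i j s t =
    \int[leb]_(u in `]s, t]) (\sum_(i < n) \sum_(j < M) p u i j).
  rewrite Rintegral_sum//=; last by move=> i; apply: integrable_sum_real => // j; exact: p_int.
  by apply: eq_bigr => i _; rewrite Rintegral_sum// => j; exact: p_int.
rewrite -[leRHS]mul1r; apply: Rintegral_oc_le => //.
  apply: integrable_sum_real => // i; apply: integrable_sum_real => // j; exact: p_int.
by move=> u _; exact: join_prob_sum_le1.
Qed.

Lemma joined_le s t i j : 0 <= s <= t -> joined i j s t <= t - s.
Proof.
move=> s0t; have /andP[s0 st] := s0t; rewrite -[leRHS]mul1r.
apply: Rintegral_oc_le => //; first exact: p_int.
by move=> u _; exact: join_prob_le1.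
Qed.

Lemma rate_bound_ge j : lambda / gamma j + mu j <= rate_bound.
Proof.
rewrite /rate_bound (bigD1 j)//= lerDl sumr_ge0// => k _.
by rewrite addr_ge0// ?divr_ge0// ltW.
Qed.

Lemma fluid_lipschitz s t i j : 0 <= s <= t ->
  `|x t i j - x s i j| <= rate_bound * (t - s).
Proof.
move=> s0t; have /andP[s0 st] := s0t; rewrite fluid_increment//.
have d0 : 0 <= \int[leb]_(u in `]s, t]) (mu j * (x u i j - x u i.+1 j)) <= mu j * (t - s).
  have xu u : s < u <= t -> 0 <= x u i j - x u i.+1 j <= 1.
    move=> /andP[su _]; have xu := x_state (le_trans s0 (ltW su)).
    by have := state_ge0 xu i.+1 j; have := state_dec xu i j; have := state_le1 xu i j; lra.
  apply/andP; split.
    rewrite -[leLHS](mul0r (t - s)); apply: Rintegral_oc_ge => //; first exact: d_int.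
    by move=> u /xu/andP[? _]; rewrite mulr_ge0// ltW.
  apply: Rintegral_oc_le => //; first exact: d_int.
  by move=> u /xu/andP[_ ?]; rewrite ler_piMr// ltW.
have lg : 0 <= lambda / gamma j by rewrite divr_ge0// ltW.
have := ler_wpM2l lg (joined_le i j s0t).
have := mulr_ge0 lg (joined_ge0 s t i j).
have := rate_bound_ge j; rewrite -subr_ge0 => h.
have : 0 <= (rate_bound - (lambda / gamma j + mu j)) * (t - s).
  by rewrite mulr_ge0// subr_ge0.
have : 0 <= lambda / gamma j * (t - s) by rewrite mulr_ge0// subr_ge0.
have : 0 <= mu j * (t - s) by rewrite mulr_ge0// ?subr_ge0// ltW.
rewrite mulrBl mulrDl ler_norml => *; apply/andP; split; lra.
Qed.

(** Freezing the departure rate at time [s] costs the Lipschitz constant times t - s, hence a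
    quadratic error. The arrivals stay an exact integral, since [join_prob] has no continuity in the
    state. *)
Lemma fluid_step s t i j : 0 <= s <= t ->
  `|x t i j - x s i j -
    (lambda / gamma j * joined i j s t - mu j * (x s i j - x s i.+1 j) * (t - s))| <=
  2 * mu j * rate_bound * (t - s) ^+ 2.
Proof.
move=> s0t; have /andP[s0 st] := s0t; rewrite fluid_increment//.
set D := \int[_]_(_ in _) _; set c := mu j * _.
have -> : lambda / gamma j * joined i j s t - D - (lambda / gamma j * joined i j s t - c * (t - s))
   = - (D - c * (t - s)) by ring.
rewrite normrN.
have -> : 2 * mu j * rate_bound * (t - s) ^+ 2 = 2 * mu j * rate_bound * (t - s) * (t - s) by ring.
apply: Rintegral_oc_approx => //; first exact: d_int.
move=> u /andP[su ut]; rewrite /c -mulrBr normrM gtr0_norm//.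
have su' : 0 <= s <= u by rewrite s0 ltW.
have -> : x u i j - x u i.+1 j - (x s i j - x s i.+1 j) =
  (x u i j - x s i j) - (x u i.+1 j - x s i.+1 j) by ring.
have -> : 2 * mu j * rate_bound * (t - s) = mu j * (rate_bound * (t - s) + rate_bound * (t - s)) by ring.
rewrite ler_wpM2l ?(ltW (mu_gt0 j))//; apply: le_trans (ler_normB _ _) _.
have rb : 0 <= rate_bound by apply: sumr_ge0 => k _; rewrite addr_ge0 ?divr_ge0// ltW.
have le_u : rate_bound * (u - s) <= rate_bound * (t - s).
  by rewrite ler_wpM2l// lerB.
by apply: lerD; apply: le_trans le_u; exact: fluid_lipschitz.
Qed.

(** [x u 0 j = 1] is the maximal value of the coordinate, so [ae_eq0_at_max] makes inflow and
    outflow cancel. This is the hypothesis that [join_prob_cover] asks for. *)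
Lemma fluid_balance T : {ae leb, forall u : R, 0 < u < T -> forall j, x u 0%N j = 1 ->
  lambda * p u 0%N j = mu j * gamma j * (1 - x u 1%N j)}.
Proof.
have [T0|T0] := leP T 0.
  by apply: aeW => u /andP[u0 uT]; exfalso; lra.
have h j : {ae leb, forall u : R, 0 < u < T -> x u 0%N j = 1 ->
    lambda * p u 0%N j = mu j * gamma j * (1 - x u 1%N j)}.
  pose g u := lambda / gamma j * p u 0%N j - mu j * (x u 0%N j - x u 1%N j).
  have pi t : 0 <= t -> leb.-integrable `[0, t] (EFin \o (fun u => lambda / gamma j * p u 0%N j)).
    move=> t0; have [+ _ _] := xsol.2 t t0 0%N j.
    by move/(integrableZl _ (lambda / gamma j)); apply.
  have gi t : 0 <= t -> leb.-integrable `[0, t] (EFin \o g).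
    move=> t0; have [_ di _] := xsol.2 t t0 0%N j.
    by have := integrableB _ (pi t t0) di; apply.
  have gE t : 0 <= t -> x 0 0%N j + \int[leb]_(u in `[0, t]) g u = x t 0%N j.
    move=> t0; have [pi' di ->] := xsol.2 t t0 0%N j.
    rewrite /g RintegralB//; last exact: pi.
    by rewrite RintegralZl// addrA.
  have := @ae_eq0_at_max R g (x 0 0%N j) 1 T (gi _ (ltW T0)).
  have gle t : 0 <= t <= T -> x 0 0%N j + \int[leb]_(u in `[0, t]) g u <= 1.
    by move=> /andP[t0 _]; rewrite gE//; exact: state_le1 (x_state t0) _ _.
  move=> /(_ gle); apply: ae_lebesgueS.
  move=> u hu uT xu; have /andP[u0 _] := uT.
  have := hu uT; rewrite gE ?ltW// => /(_ xu); rewrite /g xu => /eqP.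
  rewrite subr_eq0 => /eqP e.
  rewrite -mulrA [gamma j * _]mulrC mulrA -e.
  by field; rewrite gt_eqF.
(* Indexing the types by natural numbers turns the statement for all types into a countable
   intersection. *)
have hn n : {ae leb, forall u : R, forall j, val j = n -> 0 < u < T -> x u 0%N j = 1 ->
    lambda * p u 0%N j = mu j * gamma j * (1 - x u 1%N j)}.
  have [nM|Mn] := ltnP n M; last first.
    by apply: aeW => u j jn; have := ltn_ord j; rewrite jn ltnNge Mn.
  have := h (Ordinal nM); apply: ae_lebesgueS.
  by move=> u hu j jn; rewrite (_ : j = Ordinal nM)//; exact: val_inj.
have := ae_foralln hn; apply: ae_lebesgueS.
by move=> u hu uT j; exact: hu.
Qed.

(** The join probabilities of the covered types sum to 1 off a null set only, namely where the
    balance equations of the saturated types hold; this is enough for the integral. *)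
Lemma joined_cover s t (n : nat) : 0 <= s <= t ->
  (forall u, s < u <= t -> exists2 k : 'I_M, (k < n)%N & x u 0%N k < 1) ->
  \sum_(j < M | (j < n)%N) joined 0 j s t = t - s.
Proof.
move=> s0t cov; have /andP[s0 st] := s0t.
rewrite -Rintegral_sum//; last by move=> j; exact: p_int.
rewrite -[RHS]mul1r -Rintegral_oc_cst//; congr fine.
have si : leb.-integrable `]s, t] (EFin \o fun u => \sum_(j < M | (j < n)%N) p u 0%N j).
  by apply: integrable_sum_real => // j; exact: p_int.
apply: ae_eq_integral => //.
  exact: (measurable_int leb si).
(* The horizon [t + 1] makes the endpoint [t] an interior time. *)
have := fluid_balance (t + 1); apply: ae_lebesgueS.
move=> u hu /=; rewrite in_itv /= => /andP[su ut]; congr EFin.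
have [|k km xk] := cov u; first by rewrite su.
have u0 : 0 < u by lra.
apply: (join_prob_cover mu_gt0 gamma_gt0 (ltW lambda_gt0) (x_state (ltW u0)) _ km xk).
by move=> j; apply: hu; lra.
Qed.

End fluid.

(** * The fixed state and convergence to it *)

Definition prefix_sum {R : realType} {M : nat} (f : 'I_M -> R) (n : nat) : R :=
  \sum_(k < M | (k < n)%N) f k.

Lemma prefix_sumS (R : realType) (M : nat) (f : 'I_M -> R) (J : 'I_M) :
  prefix_sum f J.+1 = prefix_sum f J + f J.
Proof.
rewrite /prefix_sum (bigD1 J)//= addrC; congr (_ + _); apply: eq_bigl => k.
by rewrite ltnS ltn_neqAle andbC.
Qed.

Lemma prefix_sum_split (R : realType) (M : nat) (f : 'I_M -> R) (n : nat) :
  \sum_(k < M) f k = prefix_sum f n + \sum_(k < M | (n <= k)%N) f k.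
Proof.
rewrite (bigID (fun k : 'I_M => (k < n)%N))/=; congr (_ + _).
by apply: eq_bigl => k; rewrite -leqNgt.
Qed.

Section fixed_state.
Context {R : realType} {M : nat}.
Variables (mu gamma : 'I_M -> R) (lambda : R).
Hypotheses (mu_gt0 : forall j, 0 < mu j) (gamma_gt0 : forall j, 0 < gamma j).
Hypothesis gamma_sum : \sum_(j < M) gamma j = 1.
Hypothesis capacity : \sum_(j < M) gamma j * mu j = 1.
Hypotheses (lambda_gt0 : 0 < lambda) (lambda_lt1 : lambda < 1).
Local Notation a := (fun k => mu k * gamma k).

Lemma critical_type : exists J : 'I_M,
  prefix_sum a J <= lambda < prefix_sum a J.+1.
Proof.
have aM : lambda < prefix_sum a M.
  rewrite (_ : prefix_sum a M = 1)// -capacity; apply: eq_big => k.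
    by rewrite ltn_ord.
  by rewrite mulrC.
case: (ex_minnP (ex_intro (fun n => lambda < prefix_sum a n) M aM)) => -[|n] hn nmin.
  by have := lambda_gt0; move: hn; rewrite /prefix_sum big_pred0//; lra.
have nM : (n < M)%N by exact: nmin.
exists (Ordinal nM); rewrite /= hn andbT leNgt; apply/negP => /nmin.
by rewrite ltnn.
Qed.

Definition fixed_state : state R M := fun i j =>
  if i is 0%N then Num.min 1 (Num.max (lambda - \sum_(k < M | (k < j)%N) mu k * gamma k) 0
                       / (mu j * gamma j)) else 0.

Lemma a_gt0 j : 0 < mu j * gamma j. Proof. exact: mulr_gt0. Qed.

Lemma fixed_state_itv j : 0 <= fixed_state 0 j <= 1.
Proof.
rewrite /= ge_min lexx le_min ler01/= divr_ge0 ?(ltW (a_gt0 j))//.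
by rewrite le_max lexx orbT.
Qed.

Lemma prefix_sum_le (f : 'I_M -> R) m n : (forall k, 0 <= f k) -> (m <= n)%N ->
  prefix_sum f m <= prefix_sum f n.
Proof.
move=> f0 mn; rewrite /prefix_sum [leRHS](bigID (fun k : 'I_M => (k < m)%N))/=.
rewrite (eq_bigl (fun k : 'I_M => (k < n)%N && (k < m)%N)); last first.
  by move=> k; rewrite andbC; case: ltnP => //= km; rewrite (leq_trans km).
by rewrite lerDl sumr_ge0.
Qed.

Variable J : 'I_M.
Hypothesis J_critical : prefix_sum a J <= lambda < prefix_sum a J.+1.

Lemma fixed_state_lt (k : 'I_M) : (k < J)%N -> fixed_state 0 k = 1.
Proof.
move=> kJ; have /andP[JL _] := J_critical; apply/min_idPl.
rewrite ler_pdivlMr ?a_gt0// mul1r le_max; apply/orP; left.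
have := @prefix_sum_le a k.+1 J (fun k => ltW (a_gt0 k)) kJ.
by rewrite prefix_sumS -/(prefix_sum a k); lra.
Qed.

Lemma fixed_state_crit : mu J * gamma J * fixed_state 0 J = lambda - prefix_sum a J.
Proof.
have /andP[JL JU] := J_critical; rewrite prefix_sumS in JU.
rewrite /= -/(prefix_sum a J) (max_idPl _) ?subr_ge0//.
rewrite (min_idPr _); first by rewrite mulrC divfK// gt_eqF// a_gt0.
by rewrite ler_pdivrMr ?a_gt0// mul1r; lra.
Qed.

Lemma fixed_state_crit_lt1 : fixed_state 0 J < 1.
Proof.
rewrite -(ltr_pM2l (a_gt0 J)) fixed_state_crit mulr1.
by have /andP[_] := J_critical; rewrite prefix_sumS; lra.
Qed.

Lemma fixed_state_gt (k : 'I_M) : (J < k)%N -> fixed_state 0 k = 0.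
Proof.
move=> Jk; have /andP[_ JU] := J_critical.
have := @prefix_sum_le a J.+1 k (fun k => ltW (a_gt0 k)) Jk => h.
rewrite /= -/(prefix_sum a k) (max_idPr _); last lra.
by rewrite mul0r; apply/min_idPr.
Qed.

(* [y k] stands for the fraction of busy type k servers. *)
Implicit Type y : 'I_M -> R.

Definition busy_dev y : R :=
  prefix_sum (fun k => gamma k * y k) J.+1 -
  prefix_sum (fun k => gamma k * fixed_state 0 k) J.+1.
Definition busy_dev_max : R := gamma J * (1 - fixed_state 0 J).
Definition idle_below y : R := prefix_sum (fun k => gamma k * (1 - y k)) J.
Definition busy_capacity y : R := prefix_sum (fun k => mu k * gamma k * y k) J.+1.
Definition busy_above y : R := \sum_(k < M | (J.+1 <= k)%N) mu k * gamma k * y k.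

Lemma busy_dev_max_gt0 : 0 < busy_dev_max.
Proof. by rewrite mulr_gt0// subr_gt0 fixed_state_crit_lt1. Qed.

Lemma busy_devE y : busy_dev y = gamma J * (y J - fixed_state 0 J) - idle_below y.
Proof.
rewrite /busy_dev !prefix_sumS /idle_below /prefix_sum.
rewrite [X in _ - (X + _)](eq_bigr (fun k => gamma k)); last first.
  by move=> k kJ; rewrite fixed_state_lt// mulr1.
rewrite [in RHS](eq_bigr (fun k => gamma k - gamma k * y k)); last first.
  by move=> k _; rewrite mulrBr mulr1.
by rewrite sumrB; ring.
Qed.

(** The gap to the maximum is the idle proportion of types up to [J]. Hence the weight 1 - u / umax
    vanishes exactly when no server of these types idles. *)
Lemma busy_dev_maxE y :
  busy_dev_max - busy_dev y = prefix_sum (fun k => gamma k * (1 - y k)) J.+1.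
Proof. by rewrite prefix_sumS busy_devE /busy_dev_max /idle_below; ring. Qed.

Lemma gamma_sum_cond_le1 (P : pred 'I_M) : \sum_(k < M | P k) gamma k <= 1.
Proof.
rewrite -gamma_sum [leRHS](bigID P)/= lerDl sumr_ge0// => k _; exact: ltW.
Qed.

Lemma a_sum_cond_le1 (P : pred 'I_M) : \sum_(k < M | P k) mu k * gamma k <= 1.
Proof.
rewrite -capacity [leRHS](bigID P)/= (eq_bigr (fun k => gamma k * mu k)).
  by rewrite lerDl sumr_ge0// => k _; rewrite mulr_ge0// ltW.
by move=> k _; rewrite mulrC.
Qed.

Lemma wsum_itv (c y : 'I_M -> R) (P : pred 'I_M) :
  (forall k, 0 <= c k) -> \sum_(k < M | P k) c k <= 1 -> (forall k, 0 <= y k <= 1) ->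
  0 <= \sum_(k < M | P k) c k * y k <= 1.
Proof.
move=> c0 c1 y01; rewrite sumr_ge0/=; last first.
  by move=> k _; rewrite mulr_ge0//; have /andP[] := y01 k.
apply: le_trans c1; apply: ler_sum => k _.
by rewrite ler_piMr//; have /andP[] := y01 k.
Qed.

Section bounds.
Variable y : 'I_M -> R.
Hypothesis y01 : forall k, 0 <= y k <= 1.

Let y01' k : 0 <= 1 - y k <= 1. Proof. by have := y01 k; lra. Qed.

Lemma idle_below_itv : 0 <= idle_below y <= 1.
Proof. by apply: wsum_itv => //; [move=> k; exact: ltW|exact: gamma_sum_cond_le1]. Qed.

Lemma busy_capacity_itv : 0 <= busy_capacity y <= 1.
Proof.
apply: wsum_itv => //; [move=> k; exact/ltW/a_gt0|exact: a_sum_cond_le1].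
Qed.

Lemma busy_above_itv : 0 <= busy_above y <= 1.
Proof.
apply: wsum_itv => //; [move=> k; exact/ltW/a_gt0|exact: a_sum_cond_le1].
Qed.

Lemma busy_dev_le_max : busy_dev y <= busy_dev_max.
Proof.
rewrite -subr_ge0 busy_dev_maxE; apply: sumr_ge0 => k _.
by rewrite mulr_ge0 ?(ltW (gamma_gt0 k))//; have /andP[] := y01' k.
Qed.

Lemma busy_dev_norm_le1 : `|busy_dev y| <= 1.
Proof.
have h z : (forall k, 0 <= z k <= 1) ->
    0 <= prefix_sum (fun k => gamma k * z k) J.+1 <= 1.
  by move=> z01; apply: wsum_itv => //; [move=> k; exact: ltW|exact: gamma_sum_cond_le1].
have := h _ y01; have := h _ fixed_state_itv.
by rewrite /busy_dev ler_norml => /andP[? ?] /andP[? ?]; apply/andP; split; lra.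
Qed.

(** From Young's inequality in [capacity_drift], where idle servers below [J] perturb the capacity
    by at most [\sum_k mu k] times their proportion. *)
Definition idle_cost : R := (\sum_(k < M) mu k) ^+ 2 / (2 * mu J).

(** If no server of type below [J] idles, lambda - B is exactly - mu_J u, because the capacity in
    use at the fixed state is lambda. In general an error of order b is added, and Young's
    inequality splits it off. *)
Lemma capacity_drift : busy_dev y * (lambda - busy_capacity y) <=
  - (mu J / 2) * busy_dev y ^+ 2 + idle_cost * idle_below y ^+ 2.
Proof.
pose beta := prefix_sum (fun k => mu k * gamma k * (1 - y k)) J.
have e1 : lambda - busy_capacity y = - mu J * busy_dev y + (beta - mu J * idle_below y).
  have lE := fixed_state_crit.
  rewrite busy_devE /busy_capacity prefix_sumS.
  have -> : prefix_sum (fun k => mu k * gamma k * y k) J = prefix_sum a J - beta.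
    by rewrite /beta /prefix_sum -sumrB; apply: eq_bigr => k _; ring.
  have -> : lambda = mu J * gamma J * fixed_state 0 J + prefix_sum a J by rewrite lE; ring.
  ring.
set kappa := \sum_(k < M) mu k.
have kappa_ge k : mu k <= kappa.
  by rewrite /kappa (bigD1 k)//= lerDl sumr_ge0// => l _; exact: ltW.
have b0 : 0 <= idle_below y by have /andP[] := idle_below_itv.
have betab : 0 <= beta <= kappa * idle_below y.
  apply/andP; split; first by apply: sumr_ge0 => k _; rewrite mulr_ge0 ?(ltW (a_gt0 k))//; have /andP[] := y01' k.
  rewrite /beta /idle_below /prefix_sum mulr_sumr; apply: ler_sum => k _.
  rewrite -mulrA ler_wpM2r//; rewrite mulr_ge0 ?(ltW (gamma_gt0 k))//.
  by have /andP[] := y01' k.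
set e := beta - _ in e1.
have eb : `|e| <= kappa * idle_below y.
  have := ler_wpM2r b0 (kappa_ge J).
  have : 0 <= mu J * idle_below y by rewrite mulr_ge0// ltW.
  by rewrite /e ler_norml; move: betab => /andP[? ?] ? ?; apply/andP; split; lra.
rewrite e1 /idle_cost -/kappa.
set u := busy_dev y.
have muJ := mu_gt0 J.
have e2 : e ^+ 2 <= (kappa * idle_below y) ^+ 2.
  by rewrite -[leLHS]real_normK ?num_real// ler_sqr ?nnegrE// (le_trans _ eb).
(* AM-GM: u e <= (mu J / 2) u^2 + e^2 / (2 mu J) *)
have amgm : u * e <= mu J / 2 * u ^+ 2 + e ^+ 2 / (2 * mu J).
  rewrite -subr_ge0.
  have -> : mu J / 2 * u ^+ 2 + e ^+ 2 / (2 * mu J) - u * e =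
     (mu J * u - e) ^+ 2 / (2 * mu J) by field; rewrite gt_eqF.
  by rewrite divr_ge0 ?sqr_ge0// mulr_ge0// ltW.
have e3 : e ^+ 2 / (2 * mu J) <= kappa ^+ 2 / (2 * mu J) * idle_below y ^+ 2.
  by rewrite [leRHS]mulrAC -exprMn ler_wpM2r// invr_ge0 mulr_ge0// ltW.
have -> : u * (- mu J * u + e) = - mu J * u ^+ 2 + u * e by ring.
lra.
Qed.

Definition dist_cst : R := \sum_(k < M) ((gamma k)^-1 + (mu k * gamma k)^-1).

Lemma dist_cst_ge0 : 0 <= dist_cst.
Proof.
apply: sumr_ge0 => k _.
by rewrite addr_ge0 ?invr_ge0 ?mulr_ge0 ?(ltW (mu_gt0 k)) ?(ltW (gamma_gt0 k)).
Qed.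

(** Types below [J] are controlled by the idleness b, types above by the capacity in use there, and
    [J] itself by u + b. *)
Lemma dist_fixed_state k :
  `|y k - fixed_state 0 k| <= dist_cst * (`|busy_dev y| + idle_below y + busy_above y).
Proof.
have b0 : 0 <= idle_below y by have /andP[] := idle_below_itv.
have E0 : 0 <= busy_above y by have /andP[] := busy_above_itv.
have g0 j : 0 <= (gamma j)^-1 by rewrite invr_ge0 ltW.
have ag0 j : 0 <= (mu j * gamma j)^-1 by rewrite invr_ge0 ltW ?a_gt0.
set S := _ + _ + _.
have S0 : 0 <= S by rewrite !addr_ge0.
have d0 : (gamma k)^-1 + (mu k * gamma k)^-1 <= dist_cst.
  rewrite /dist_cst (bigD1 k)//= lerDl sumr_ge0// => j _; exact: addr_ge0.
apply: (@le_trans _ _ (((gamma k)^-1 + (mu k * gamma k)^-1) * S)); last exact: ler_wpM2r.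
rewrite mulrDl.
have h1 : 0 <= (gamma k)^-1 * S by exact: mulr_ge0.
have h2 : 0 <= (mu k * gamma k)^-1 * S by exact: mulr_ge0.
have [kJ|Jk|/val_inj kJ] := ltngtP (val k) (val J).
- rewrite fixed_state_lt// distrC ger0_norm; last by have /andP[] := y01' k.
  suff : 1 - y k <= (gamma k)^-1 * S by lra.
  rewrite -(ler_pM2l (gamma_gt0 k)) mulrA divff ?gt_eqF// mul1r.
  apply: (@le_trans _ _ (idle_below y)); last by rewrite /S; have := normr_ge0 (busy_dev y); lra.
  rewrite /idle_below /prefix_sum (bigD1 k)//= lerDl sumr_ge0// => j _.
  by rewrite mulr_ge0 ?(ltW (gamma_gt0 j))//; have /andP[] := y01' j.
- rewrite fixed_state_gt// subr0 ger0_norm; last by have /andP[] := y01 k.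
  suff : y k <= (mu k * gamma k)^-1 * S by lra.
  rewrite -(ler_pM2l (a_gt0 k)) mulrA divff ?gt_eqF ?a_gt0// mul1r.
  apply: (@le_trans _ _ (busy_above y)); last by rewrite /S; have := normr_ge0 (busy_dev y); lra.
  rewrite /busy_above (bigD1 k)//= lerDl sumr_ge0// => j _.
  by rewrite mulr_ge0 ?(ltW (a_gt0 j))//; have /andP[] := y01 j.
- suff : `|y k - fixed_state 0 k| <= (gamma k)^-1 * S by lra.
  rewrite -(ler_pM2l (gamma_gt0 k)) mulrA divff ?gt_eqF// mul1r.
  rewrite -[X in X * `|_|]gtr0_norm// -normrM kJ.
  have -> : gamma J * (y J - fixed_state 0 J) = busy_dev y + idle_below y.
    by rewrite busy_devE; ring.
  by apply: le_trans (ler_normD _ _) _; rewrite (ger0_norm b0) /S; lra.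
Qed.

End bounds.
End fixed_state.

(** * Number of jobs per server and its drift *)

Section mass.
Context {R : realType} {M : nat}.
Variable gamma : 'I_M -> R.

Lemma state_series_cvg (s : state R M) j : state_space s -> cvgn (series (fun i => s i j)).
Proof.
move=> ss; have s0 i : 0 <= s i j by exact: state_ge0.
have := ss.2; rewrite /norm1 => /(le_lt_trans (le_bigmax _ _ j)).
set N := (\sum_(0 <= i <oo) _)%E => Noo.
have N0 : (0 <= N)%E by apply: nneseries_ge0.
apply: nondecreasing_is_cvgn; first by apply: nondecreasing_series => i _ _.
exists (fine N) => _ [n _ <-]; rewrite -lee_fin fineK ?ge0_fin_numE//.
apply: le_trans (nneseries_lim_ge n _) => //.
rewrite /series /= -sumEFin le_eqVlt; apply/orP; left; apply/eqP.
by apply: eq_bigr => i _; rewrite ger0_norm.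
Qed.

Definition mass (s : state R M) : R :=
  \sum_(j < M) gamma j * limn (series (fun i => s i j)).

Lemma mass_cvg (s : state R M) : state_space s ->
  (fun n => \sum_(j < M) gamma j * series (fun i => s i j) n) @ \oo --> mass s.
Proof.
move=> ss; have h : forall r : seq 'I_M,
    (fun n => \sum_(j <- r) gamma j * series (fun i => s i j) n) @ \oo -->
    \sum_(j <- r) gamma j * limn (series (fun i => s i j)).
  elim=> [|j r IH].
    by under eq_fun do rewrite big_nil; rewrite big_nil; exact: cvg_cst.
  under eq_fun do rewrite big_cons; rewrite big_cons.
  by apply: cvgD => //; apply: cvgMr; exact: state_series_cvg.
exact: h.
Qed.

Lemma mass_ge_level0 (s : state R M) (P : pred 'I_M) : (forall j, 0 <= gamma j) ->
  state_space s -> \sum_(j < M | P j) gamma j * s 0%N j <= mass s.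
Proof.
move=> g0 ss; apply: (@le_trans _ _ (\sum_(j < M) gamma j * s 0%N j)).
  rewrite [leRHS](bigID P)/= lerDl sumr_ge0// => j _.
  by rewrite mulr_ge0// state_ge0.
apply: ler_sum => j _; rewrite ler_wpM2l//.
have := @nondecreasing_cvgn_le R (series (fun i => s i j)) _ (state_series_cvg ss) 1%N.
rewrite /series /= big_nat1; apply.
by apply: nondecreasing_series => i _ _; exact: state_ge0.
Qed.

End mass.

Section fluid_drift.
Context {R : realType} {M : nat}.
Variables (mu gamma : 'I_M -> R) (lambda : R).
Hypotheses (mu_gt0 : forall j, 0 < mu j) (gamma_gt0 : forall j, 0 < gamma j).
Hypothesis gamma_sum : \sum_(j < M) gamma j = 1.
Hypothesis capacity : \sum_(j < M) gamma j * mu j = 1.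
Hypotheses (lambda_gt0 : 0 < lambda) (lambda_lt1 : lambda < 1).
Variable x : R -> state R M.
Hypothesis xsol : fluid_solution mu gamma lambda x.
Local Notation rb := (rate_bound mu gamma lambda).
Local Notation leb := (@lebesgue_measure R).
Local Notation joined := (joined mu gamma lambda x).

Let x_state t : 0 <= t -> state_space (x t). Proof. exact: xsol.1. Qed.

Lemma rate_bound_ge0 : 0 <= rb.
Proof. by apply: sumr_ge0 => k _; rewrite addr_ge0 ?divr_ge0// ltW. Qed.

Lemma prefix_lipschitz n s t : 0 <= s <= t ->
  `|prefix_sum (fun k => gamma k * x t 0%N k) n -
    prefix_sum (fun k => gamma k * x s 0%N k) n| <= rb * (t - s).
Proof.
move=> s0t; rewrite /prefix_sum -sumrB.
apply: le_trans (ler_norm_sum _ _ _) _.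
apply: (@le_trans _ _ (\sum_(k < M | (k < n)%N) gamma k * (rb * (t - s)))).
  apply: ler_sum => k _; rewrite -mulrBr normrM gtr0_norm// ler_wpM2l ?(ltW (gamma_gt0 k))//.
  exact: fluid_lipschitz.
rewrite -mulr_suml ler_piMl//; last exact: gamma_sum_cond_le1.
by rewrite mulr_ge0 ?rate_bound_ge0// subr_ge0; have /andP[] := s0t.
Qed.

Lemma prefix_step n s t : 0 <= s <= t ->
  `|prefix_sum (fun k => gamma k * x t 0%N k) n -
    prefix_sum (fun k => gamma k * x s 0%N k) n -
    (lambda * \sum_(k < M | (k < n)%N) joined 0 k s t -
     prefix_sum (fun k => mu k * gamma k * (x s 0%N k - x s 1%N k)) n * (t - s))| <=
  2 * rb * (t - s) ^+ 2.
Proof.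
move=> s0t; rewrite /prefix_sum mulr_sumr mulr_suml -!sumrB.
apply: le_trans (ler_norm_sum _ _ _) _.
apply: (@le_trans _ _ (\sum_(k < M | (k < n)%N) mu k * gamma k * (2 * rb * (t - s) ^+ 2))).
  apply: ler_sum => k _.
  have -> : gamma k * x t 0%N k - gamma k * x s 0%N k -
     (lambda * joined 0 k s t - mu k * gamma k * (x s 0%N k - x s 1%N k) * (t - s)) =
    gamma k * (x t 0%N k - x s 0%N k -
    (lambda / gamma k * joined 0 k s t - mu k * (x s 0%N k - x s 1%N k) * (t - s))).
    by field; rewrite gt_eqF.
  rewrite normrM gtr0_norm//.
  have -> : mu k * gamma k * (2 * rb * (t - s) ^+ 2) =
    gamma k * (2 * mu k * rb * (t - s) ^+ 2) by ring.
  by rewrite ler_wpM2l ?(ltW (gamma_gt0 k))//; exact: fluid_step.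
rewrite -mulr_suml ler_piMl//; last exact: a_sum_cond_le1.
by apply: mulr_ge0; [apply: mulr_ge0 => //; exact: rate_bound_ge0|exact: sqr_ge0].
Qed.

(** Departures telescope over the levels before the rate is frozen, so the quadratic error does not
    depend on [n] and survives the limit in [mass_step]. Summing [fluid_step] over levels would give
    an error growing with [n]. *)
Lemma level_sum_step (j : 'I_M) n s t : 0 <= s <= t ->
  gamma j * (series (fun i => x t i j) n - series (fun i => x s i j) n) <=
  lambda * \sum_(i < n) joined i j s t -
  mu j * gamma j * (x s 0%N j - x s n j) * (t - s) +
  mu j * gamma j * (2 * rb * (t - s) ^+ 2).
Proof.
move=> s0t; have /andP[s0 st] := s0t.
have gj := gamma_gt0 j.
rewrite /series /= !big_mkord -sumrB.
rewrite (eq_bigr (fun i : 'I_n => lambda / gamma j * joined i j s t -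
    \int[leb]_(u in `]s, t]) (mu j * (x u i j - x u i.+1 j)))); last first.
  by move=> i _; rewrite (fluid_increment xsol).
have d_int i : leb.-integrable `]s, t] (EFin \o (fun u => mu j * (x u i j - x u i.+1 j))).
  apply: integrable_oc_sub => //.
  by have [_ + _] := xsol.2 t (le_trans s0 st) i j.
rewrite sumrB -mulr_sumr.
have dE : \sum_(i < n) \int[leb]_(u in `]s, t]) (mu j * (x u i j - x u i.+1 j)) =
    \int[leb]_(u in `]s, t]) (mu j * (x u 0%N j - x u n j)).
  transitivity (\int[leb]_(u in `]s, t]) (\sum_(i < n) mu j * (x u i j - x u i.+1 j))).
    by rewrite Rintegral_sum.
  apply: eq_Rintegral => u _; rewrite -mulr_sumr; congr (_ * _).
  rewrite (eq_bigr (fun i : 'I_n => - (x u i.+1 j - x u i j))); last first.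
    by move=> i _; rewrite opprB.
  by rewrite sumrN -(big_mkord xpredT (fun i => x u i.+1 j - x u i j)) telescope_sumr// opprB.
have di : leb.-integrable `]s, t] (EFin \o (fun u => mu j * (x u 0%N j - x u n j))).
  rewrite (_ : EFin \o _ = EFin \o (fun u => \sum_(i < n) mu j * (x u i j - x u i.+1 j))).
    by apply: integrable_sum_real.
  apply/funext => u /=; congr EFin; rewrite -mulr_sumr; congr (_ * _).
  rewrite [RHS](eq_bigr (fun i : 'I_n => - (x u i.+1 j - x u i j))); last first.
    by move=> i _; rewrite opprB.
  by rewrite sumrN -(big_mkord xpredT (fun i => x u i.+1 j - x u i j)) telescope_sumr// opprB.
rewrite dE.
have := @Rintegral_oc_approx R (fun u => mu j * (x u 0%N j - x u n j))
  (mu j * (x s 0%N j - x s n j)) (2 * mu j * rb * (t - s)) s t st di.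
set I := \int[_]_(_ in _) _.
move=> H; have {}H : `|I - mu j * (x s 0%N j - x s n j) * (t - s)| <= 2 * mu j * rb * (t - s) * (t - s).
  apply: H => u /andP[su ut]; rewrite -mulrBr normrM gtr0_norm//.
  have su' : 0 <= s <= u by rewrite s0 ltW.
  have -> : x u 0%N j - x u n j - (x s 0%N j - x s n j) =
    (x u 0%N j - x s 0%N j) - (x u n j - x s n j) by ring.
  have -> : 2 * mu j * rb * (t - s) = mu j * (rb * (t - s) + rb * (t - s)) by ring.
  rewrite ler_wpM2l ?(ltW (mu_gt0 j))//; apply: le_trans (ler_normB _ _) _.
  have le_u : rb * (u - s) <= rb * (t - s) by rewrite ler_wpM2l ?rate_bound_ge0// lerB.
  by apply: lerD; apply: le_trans le_u; exact: fluid_lipschitz.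
rewrite mulrBr mulrA (_ : gamma j * (lambda / gamma j) = lambda); last by field; rewrite gt_eqF.
set S := lambda * _.
have : 0 <= gamma j * (I - mu j * (x s 0%N j - x s n j) * (t - s) + 2 * mu j * rb * (t - s) * (t - s)).
  by rewrite mulr_ge0 ?(ltW gj)//; move: H; rewrite ler_norml => /andP[]; lra.
have -> : gamma j * (I - mu j * (x s 0%N j - x s n j) * (t - s) + 2 * mu j * rb * (t - s) * (t - s))
 = gamma j * I - mu j * gamma j * (x s 0%N j - x s n j) * (t - s) + mu j * gamma j * (2 * rb * (t - s) ^+ 2).
  ring.
lra.
Qed.

(** Only an upper bound is available: arrivals at all levels together have probability at most 1. *)
Lemma mass_step s t : 0 <= s <= t ->
  mass gamma (x t) - mass gamma (x s) <=
  (lambda - \sum_(k < M) mu k * gamma k * x s 0%N k) * (t - s) + 2 * rb * (t - s) ^+ 2.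
Proof.
move=> s0t; have /andP[s0 st] := s0t.
have t0 := le_trans s0 st.
set A := \sum_(k < M) _.
have cl : (fun n => \sum_(j < M) gamma j * series (fun i => x t i j) n -
    \sum_(j < M) gamma j * series (fun i => x s i j) n) @ \oo -->
    mass gamma (x t) - mass gamma (x s).
  by apply: cvgB; apply: mass_cvg; exact: x_state.
(* This is the boundary term of the telescoped departures; it vanishes because the state is summable
   over levels. *)
have cn : (fun n => \sum_(j < M) mu j * gamma j * x s n j) @ \oo --> (0 : R).
  have h : forall r : seq 'I_M,
      (fun n => \sum_(j <- r) mu j * gamma j * x s n j) @ \oo --> (0 : R).
    elim=> [|j r IH]; first by under eq_fun do rewrite big_nil; exact: cvg_cst.
    under eq_fun do rewrite big_cons.
    have : (fun n => mu j * gamma j * x s n j + \sum_(j <- r) mu j * gamma j * x s n j)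
        @ \oo --> mu j * gamma j * 0 + 0.
      apply: cvgD => //; apply: cvgMr.
      by apply: cvg_series_cvg_0; exact: state_series_cvg (x_state s0).
    by rewrite mulr0 addr0.
  exact: h.
have cr : (fun n => (lambda - A) * (t - s) +
     (\sum_(j < M) mu j * gamma j * x s n j) * (t - s) + 2 * rb * (t - s) ^+ 2) @ \oo -->
    (lambda - A) * (t - s) + 0 * (t - s) + 2 * rb * (t - s) ^+ 2.
  apply: cvgD; last exact: cvg_cst.
  apply: cvgD; first exact: cvg_cst.
  by apply: cvgMl.
rewrite mul0r addr0 in cr.
apply: (ler_cvg_to cl cr); apply: nearW => n.
rewrite -sumrB.
apply: (@le_trans _ _ (\sum_(j < M) (lambda * \sum_(i < n) joined i j s t -
  mu j * gamma j * (x s 0%N j - x s n j) * (t - s) +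
  mu j * gamma j * (2 * rb * (t - s) ^+ 2)))).
  by apply: ler_sum => j _; rewrite -mulrBr; exact: level_sum_step.
rewrite big_split sumrB /= -mulr_sumr -!mulr_suml exchange_big /=.
have e1 : \sum_(j < M) mu j * gamma j * (x s 0%N j - x s n j) =
   A - \sum_(j < M) mu j * gamma j * x s n j.
  by rewrite /A -sumrB; apply: eq_bigr => j _; ring.
have e2 : \sum_(j < M) mu j * gamma j = 1.
  by rewrite -capacity; apply: eq_bigr => j _; rewrite mulrC.
rewrite e1 e2 mul1r.
have := ler_wpM2l (ltW lambda_gt0) (joined_sum_le xsol n s0t).
rewrite mulrBl [X in _ <= X + _ + _]mulrBl; lra.
Qed.

End fluid_drift.

(** * A Lyapunov principle for finite increments *)

Section dissipation.
Context {R : realType}.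
Variables (V W : R -> R) (K : R).
Hypothesis K_gt0 : 0 < K.
Hypothesis V_ge0 : forall t, 0 <= t -> 0 <= V t.
Hypothesis W_ge0 : forall t, 0 <= t -> 0 <= W t.
Hypothesis V_step : forall s t, 0 <= s <= t ->
  V t - V s <= - W s * (t - s) + K * (t - s) ^+ 2.

(** Cutting [s, t] into n equal steps makes the quadratic errors add up to K (t - s)^2 / n. *)
Lemma dissipation_nonincreasing s t : 0 <= s <= t -> V t <= V s.
Proof.
move=> /andP[s0 st]; have K0 := K_gt0.
have step n h : 0 <= h -> V (s + n%:R * h) - V s <= n%:R * (K * h ^+ 2).
  move=> h0; elim: n => [|n IH]; first by rewrite !mul0r addr0 subrr.
  have nE (c : R) : n.+1%:R * c = n%:R * c + c by rewrite -natr1 mulrDl mul1r.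
  have nh : 0 <= n%:R * h by rewrite mulr_ge0.
  have sn : 0 <= s + n%:R * h by rewrite addr_ge0.
  have := @V_step (s + n%:R * h) (s + n%:R * h + h).
  rewrite sn lerDl h0 [s + n%:R * h + h - (s + n%:R * h)]addrAC subrr add0r => /(_ isT) H.
  have : 0 <= W (s + n%:R * h) * h by rewrite mulr_ge0// W_ge0.
  by rewrite !nE addrA; move: IH H; lra.
have cc : (fun n => K * (t - s) ^+ 2 * harmonic n) @ \oo --> K * (t - s) ^+ 2 * 0.
  by apply: cvgMr; exact: cvg_harmonic.
rewrite mulr0 in cc; rewrite -subr_le0.
apply: (cvgr_to_ge cc); apply: nearW => n.
have n0 : n.+1%:R != 0 :> R by rewrite pnatr_eq0.
have h0 : 0 <= (t - s) / n.+1%:R by rewrite divr_ge0// subr_ge0.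
have := step n.+1 _ h0.
have -> : s + n.+1%:R * ((t - s) / n.+1%:R) = t by field.
by congr (_ <= _); rewrite /harmonic /=; field.
Qed.

(** If W t exceeded e, a step of length e / K would make V negative. *)
Lemma dissipation_eq0 t : 0 <= t -> V t = 0 -> W t <= 0.
Proof.
move=> t0 Vt; apply/ler_addgt0Pr => e e0; rewrite add0r; have K0 := K_gt0.
have h0 : 0 < e / K by rewrite divr_gt0.
have t1 : 0 <= t + e / K by lra.
rewrite -(ler_pM2r h0).
have := @V_step t (t + e / K); rewrite Vt [t + _ - t]addrAC subrr add0r subr0 t0 lerDl (ltW h0) => /(_ isT) H'.
have := V_ge0 t1.
have e1 : K * (e / K) ^+ 2 = e * (e / K) by field; rewrite gt_eqF.
rewrite e1 in H'; lra.
Qed.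

(** Whenever W is at least e, a step of length e / (2 K) lowers V by at least e^2 / (4 K), which is
    impossible once V is within that distance of its infimum. *)
Lemma dissipation_cvg0 e : 0 < e -> exists2 T, 0 <= T & forall t, T <= t -> W t < e.
Proof.
move=> e0; have K0 := K_gt0.
pose VS := [set V t | t in [set t | 0 <= t]].
have hi : has_inf VS.
  split; first by exists (V 0), 0 => /=.
  by exists 0 => _ [t t0 <-]; exact: V_ge0.
have d0 : 0 < e ^+ 2 / (4 * K) by rewrite divr_gt0 ?exprn_gt0 ?mulr_gt0.
have [_ [T /= T0 <-] VT] := @inf_adherent _ VS _ d0 hi.
exists T => // t Tt; rewrite ltNge; apply/negP => We.
have t0 := le_trans T0 Tt.
have h0 : 0 < e / (2 * K) by rewrite divr_gt0 ?mulr_gt0.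
have t1 : 0 <= t + e / (2 * K) by lra.
have : inf VS <= V (t + e / (2 * K)).
  by apply: ge_inf; [case: hi|exists (t + e / (2 * K))].
have VtT : V t <= V T by apply: dissipation_nonincreasing; rewrite T0.
have := @V_step t (t + e / (2 * K)).
rewrite t0 lerDl (ltW h0) [t + _ - t]addrAC subrr add0r => /(_ isT) H'.
have h1 : e * (e / (2 * K)) <= W t * (e / (2 * K)) by rewrite ler_wpM2r// ltW.
have e1 : K * (e / (2 * K)) ^+ 2 = e * (e / (2 * K)) - e ^+ 2 / (4 * K).
  by field; rewrite gt_eqF.
rewrite e1 in H'; lra.
Qed.

End dissipation.

(** * The Lyapunov function of the fluid limit *)

Section fluid_stability.
Context {R : realType} {M : nat}.
Variables (mu gamma : 'I_M -> R) (lambda : R).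
Hypotheses (mu_gt0 : forall j, 0 < mu j) (gamma_gt0 : forall j, 0 < gamma j).
Hypothesis gamma_sum : \sum_(j < M) gamma j = 1.
Hypothesis capacity : \sum_(j < M) gamma j * mu j = 1.
Variable J : 'I_M.
Hypothesis J_critical : prefix_sum (fun k => mu k * gamma k) J <= lambda <
  prefix_sum (fun k => mu k * gamma k) J.+1.
Local Notation xs := (fixed_state mu gamma lambda).
Local Notation udev := (busy_dev mu gamma lambda J).
Local Notation umax := (busy_dev_max mu gamma lambda J).
Local Notation bdev := (idle_below gamma J).
Local Notation Ecap := (busy_above mu gamma J).
Implicit Type s : state R M.

(** Level 1 stands for at least two jobs. Subtracted from B, this gives the rate at which servers of
    type at most [J] fall idle. *)
Definition queue_capacity s : R := prefix_sum (fun k => mu k * gamma k * s 1%N k) J.+1.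

(* The weight of the squared idleness is chosen so that its decay, at rate
   [2 * mu J], absorbs the error term of [capacity_drift]. *)
Definition idle_weight : R := (idle_cost mu J / umax + 1) / (2 * mu J).

Definition lyapunov s : R :=
  udev (s 0%N) ^+ 2 / (2 * umax) +
  (mass gamma s - prefix_sum (fun k => gamma k * s 0%N k) J.+1) +
  idle_weight * bdev (s 0%N) ^+ 2.

(** The factor of the last term vanishes when u = umax, but the first term is then positive;
    together the terms vanish only at the fixed state. *)
Definition dissipation s : R :=
  mu J / (2 * umax) * udev (s 0%N) ^+ 2 + bdev (s 0%N) ^+ 2 + Ecap (s 0%N) +
  (1 - udev (s 0%N) / umax) * queue_capacity s.

Let umax_gt0 : 0 < umax. Proof. exact: busy_dev_max_gt0. Qed.

Lemma idle_weight_gt0 : 0 < idle_weight.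
Proof.
rewrite divr_gt0 ?mulr_gt0// ltr_wpDl// divr_ge0 ?(ltW umax_gt0)//.
by rewrite divr_ge0 ?sqr_ge0// mulr_ge0// ltW.
Qed.

Lemma state_level_itv s i k : state_space s -> 0 <= s i k <= 1.
Proof. by move=> ss; rewrite (state_ge0 ss) (state_le1 ss). Qed.

Lemma queue_capacity_itv s : state_space s -> 0 <= queue_capacity s <= 1.
Proof.
move=> ss; apply: wsum_itv => [k||k]; first exact/ltW/mulr_gt0.
  exact: a_sum_cond_le1.
exact: state_level_itv.
Qed.

Lemma udev_ratio_itv s : state_space s ->
  0 <= 1 - udev (s 0%N) / umax <= 1 + umax^-1.
Proof.
move=> ss; have y01 k := state_level_itv 0 k ss.
have h1 := busy_dev_le_max mu_gt0 gamma_gt0 J_critical y01.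
have h2 := busy_dev_norm_le1 lambda mu_gt0 gamma_gt0 gamma_sum J y01.
rewrite subr_ge0 ler_pdivrMr// mul1r h1 /= lerD2l -[leRHS]mul1r -mulNr.
by rewrite ler_wpM2r ?invr_ge0 ?(ltW umax_gt0)//; move: h2; rewrite ler_norml; lra.
Qed.

Lemma lyapunov_ge0 s : state_space s -> 0 <= lyapunov s.
Proof.
move=> ss; apply: addr_ge0; first apply: addr_ge0.
- by rewrite divr_ge0 ?sqr_ge0// mulr_ge0// ltW.
- by rewrite subr_ge0; apply: mass_ge_level0 => // k; exact: ltW.
- by rewrite mulr_ge0 ?sqr_ge0// ltW// idle_weight_gt0.
Qed.

Lemma dissipation_terms_ge0 s : state_space s ->
  [/\ 0 <= mu J / (2 * umax) * udev (s 0%N) ^+ 2, 0 <= bdev (s 0%N) ^+ 2,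
      0 <= Ecap (s 0%N) & 0 <= (1 - udev (s 0%N) / umax) * queue_capacity s].
Proof.
move=> ss; split.
- by apply: mulr_ge0; [apply: divr_ge0; [exact: ltW|apply: mulr_ge0 => //; exact: ltW]|exact: sqr_ge0].
- exact: sqr_ge0.
- have /andP[] // := busy_above_itv mu_gt0 gamma_gt0 capacity J (fun k => state_level_itv 0 k ss).
- apply: mulr_ge0; first by have /andP[] := udev_ratio_itv ss.
  by have /andP[] := queue_capacity_itv ss.
Qed.

Lemma dissipation_ge0 s : state_space s -> 0 <= dissipation s.
Proof. by move=> /dissipation_terms_ge0[? ? ? ?]; rewrite /dissipation !addr_ge0. Qed.

Lemma dissipation_small (e : R) : 0 < e -> exists2 d, 0 < d &
  forall s, state_space s -> dissipation s < d ->
  forall i j, `|s i j - xs i j| <= e.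
Proof.
move=> e0; have muJ := mu_gt0 J; have um := umax_gt0.
pose C := dist_cst mu gamma.
have C0 : 0 <= C := dist_cst_ge0 mu_gt0 gamma_gt0.
(* The first bound serves the three terms of [dist_fixed_state]. The second keeps 1 - u / umax at
   least 1 / 2, so that the last term of [dissipation] controls [queue_capacity]. *)
pose d1 := Num.min (e / (3 * (C + 1))) (umax / 2).
have C1 : 0 < C + 1 by rewrite ltr_wpDl.
have d10 : 0 < d1 by rewrite lt_min !divr_gt0// mulr_gt0.
have d1e : 3 * C * d1 <= e.
  apply: (@le_trans _ _ (3 * (C + 1) * d1)).
    by rewrite ler_wpM2r ?(ltW d10)// ler_wpM2l// lerDl.
  rewrite mulrC -ler_pdivlMr ?mulr_gt0//; by rewrite ge_min lexx.
have c0 : 0 < mu J / (2 * umax) by rewrite divr_gt0// mulr_gt0.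
have d1u : d1 <= umax / 2 by rewrite ge_min lexx orbT.
exists (Num.min (Num.min (mu J / (2 * umax) * d1 ^+ 2) (d1 ^+ 2)) (d1 / 2)).
  by rewrite !lt_min (mulr_gt0 c0 (exprn_gt0 2 d10)) (exprn_gt0 2 d10) divr_gt0.
move=> s ss; rewrite !lt_min => /andP[/andP[W1 W2] W3].
have [t1 t2 t3 t4] := dissipation_terms_ge0 ss.
have y01 k := state_level_itv 0 k ss.
have b0 := idle_below_itv gamma_gt0 gamma_sum J y01.
have u_le : `|udev (s 0%N)| <= d1.
  rewrite -ler_sqr ?nnegrE ?(ltW d10)// real_normK ?num_real//.
  by rewrite -(ler_pM2l c0); move: W1; rewrite /dissipation; lra.
have b_le : bdev (s 0%N) <= d1.
  rewrite -ler_sqr ?nnegrE ?(ltW d10)//; last by have /andP[] := b0.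
  by move: W2; rewrite /dissipation; lra.
have E_le : Ecap (s 0%N) <= d1 by move: W3; rewrite /dissipation; lra.
have lev0 j : `|s 0%N j - xs 0%N j| <= e.
  apply: le_trans (dist_fixed_state mu_gt0 gamma_gt0 gamma_sum capacity J_critical y01 j) _.
  apply: le_trans d1e; rewrite -/C (_ : 3 * C * d1 = C * (3 * d1)); last by ring.
  rewrite ler_wpM2l//; lra.
have D_le : queue_capacity s <= d1.
  have h : 2^-1 <= 1 - udev (s 0%N) / umax.
    rewrite lerBrDl -lerBrDr ler_pdivrMr//.
    by move: u_le; rewrite ler_norml => /andP[_]; lra.
  have /andP[D0 _] := queue_capacity_itv ss.
  have := ler_wpM2r D0 h; move: W3; rewrite /dissipation; lra.
case=> [|i] j; first exact: lev0.
have /andP[si0 _] := state_level_itv i.+1 j ss.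
rewrite /= subr0 ger0_norm//.
have si1 : s i.+1 j <= s 1%N j.
  elim: i {si0} => // i IH; exact: le_trans (state_dec ss i.+1 j) IH.
apply: (le_trans si1).
(* Above [J] a waiting job requires a busy server, already rare at level 0; up to [J], level 1 is
   bounded by [queue_capacity]. *)
have [jJ|Jj] := leqP j J; last first.
  apply: le_trans (lev0 j); rewrite (fixed_state_gt mu_gt0 gamma_gt0 J_critical Jj) subr0.
  by apply: le_trans (ler_norm _); exact: state_dec.
have aj : 0 < mu j * gamma j by rewrite mulr_gt0.
have ag : (mu j * gamma j)^-1 <= C.
  rewrite /C /dist_cst (bigD1 j)//=.
  have g0 k : 0 <= (gamma k)^-1 by rewrite invr_ge0 ltW.
  have ag0 k : 0 <= (mu k * gamma k)^-1 by rewrite invr_ge0 mulr_ge0// ltW.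
  have : 0 <= \sum_(i0 < M | i0 != j) ((gamma i0)^-1 + (mu i0 * gamma i0)^-1).
    by apply: sumr_ge0 => k _; exact: addr_ge0.
  have := g0 j; lra.
apply: (@le_trans _ _ (C * d1)).
  apply: (@le_trans _ _ ((mu j * gamma j)^-1 * d1)); last by rewrite ler_wpM2r// ltW.
  rewrite -(ler_pM2l aj) mulrA divff ?gt_eqF// mul1r.
  apply: le_trans D_le; rewrite /queue_capacity /prefix_sum (bigD1 j)//= lerDl.
  apply: sumr_ge0 => k _; rewrite mulr_ge0 ?mulr_ge0 ?(ltW (mu_gt0 k)) ?(ltW (gamma_gt0 k))//.
  exact: state_ge0.
apply: le_trans d1e; rewrite -mulrA ler_peMl ?mulr_ge0 ?(ltW d10)//.
by rewrite (ler_nat _ 1 3).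
Qed.

End fluid_stability.

(** * Drift of the Lyapunov function along fluid solutions *)

Section fluid_convergence.
Context {R : realType} {M : nat}.
Variables (mu gamma : 'I_M -> R) (lambda : R).
Hypothesis mu_decr : forall j k : 'I_M, (j < k)%N -> mu k < mu j.
Hypotheses (mu_gt0 : forall j, 0 < mu j) (gamma_gt0 : forall j, 0 < gamma j).
Hypothesis gamma_sum : \sum_(j < M) gamma j = 1.
Hypothesis capacity : \sum_(j < M) gamma j * mu j = 1.
Hypotheses (lambda_gt0 : 0 < lambda) (lambda_lt1 : lambda < 1).
Variable J : 'I_M.
Hypothesis J_critical : prefix_sum (fun k => mu k * gamma k) J <= lambda <
  prefix_sum (fun k => mu k * gamma k) J.+1.
Variable x : R -> state R M.
Hypothesis xsol : fluid_solution mu gamma lambda x.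
Local Notation xs := (fixed_state mu gamma lambda).
Local Notation udev := (busy_dev mu gamma lambda J).
Local Notation umax := (busy_dev_max mu gamma lambda J).
Local Notation bdev := (idle_below gamma J).
Local Notation Bcap := (busy_capacity mu gamma J).
Local Notation Ecap := (busy_above mu gamma J).
Local Notation Dcap := (queue_capacity mu gamma J).
Local Notation rb := (rate_bound mu gamma lambda).
Local Notation V := (lyapunov mu gamma lambda J).
Local Notation W := (dissipation mu gamma lambda J).
Local Notation joined := (joined mu gamma lambda x).

Let umax_gt0 : 0 < umax. Proof. exact: busy_dev_max_gt0. Qed.
Let x_state t : 0 <= t -> state_space (x t). Proof. exact: xsol.1. Qed.
Let y01 t k : 0 <= t -> 0 <= x t 0%N k <= 1.
Proof. by move=> t0; apply: state_level_itv; exact: x_state. Qed.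
Let rb_ge0 : 0 <= rb. Proof. exact: rate_bound_ge0. Qed.

Lemma exists_lt1_of_sum (n : nat) t : 0 <= t ->
  0 < prefix_sum (fun k => gamma k * (1 - x t 0%N k)) n ->
  exists2 k : 'I_M, (k < n)%N & x t 0%N k < 1.
Proof.
move=> t0; apply: contraPP => h; apply/negP; rewrite -leNgt.
apply: sumr_le0 => k kn; rewrite mulr_ge0_le0 ?(ltW (gamma_gt0 k))// subr_le0.
by rewrite leNgt; apply/negP => xk; apply: h; exists k.
Qed.

(** The left-hand side comes from u^2 / (2 umax) - u. If u cannot reach umax during the interval, a
    server of type at most [J] idles throughout and these types take all arrivals. Otherwise umax -
    u is at most [rb * h], so the factor 1 - u / umax is of order h and both sides are of order
    h^2. *)
Lemma busy_dev_step s t : 0 <= s <= t ->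
  - (1 - udev (x s 0%N) / umax) * (udev (x t 0%N) - udev (x s 0%N)) <=
  - (1 - udev (x s 0%N) / umax) * (lambda - Bcap (x s 0%N) + Dcap (x s)) * (t - s) +
  ((1 + umax^-1) * (2 * rb) + (rb ^+ 2 + 2 * rb) / umax) * (t - s) ^+ 2.
Proof.
move=> s0t; have /andP[s0 st] := s0t; have h0 : 0 <= t - s by rewrite subr_ge0.
have um := umax_gt0; have r0 := rb_ge0; have l1 := lambda_lt1; have l0 := lambda_gt0.
set h := t - s in h0 *; set u := udev (x s 0%N); set c := 1 - u / umax.
have /andP[c0 c1] : 0 <= c <= 1 + umax^-1 by apply: udev_ratio_itv => //; exact: x_state.
have /andP[B0 B1] := busy_capacity_itv mu_gt0 gamma_gt0 capacity J (fun k => y01 k s0).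
have /andP[D0 D1] := queue_capacity_itv mu_gt0 gamma_gt0 capacity J (x_state s0).
have duE tau : udev (x tau 0%N) - u =
   prefix_sum (fun k => gamma k * x tau 0%N k) J.+1 -
   prefix_sum (fun k => gamma k * x s 0%N k) J.+1 by rewrite /u /busy_dev; ring.
have lip tau : 0 <= s <= tau -> `|udev (x tau 0%N) - u| <= rb * (tau - s).
  by move=> st'; rewrite duE; exact: (prefix_lipschitz mu_gt0).
have iu : 0 <= umax^-1 by rewrite invr_ge0 ltW.
have hh : 0 <= h ^+ 2 by exact: sqr_ge0.
have [caseA|caseB] := ltP (u + rb * h) umax.
- have cov : \sum_(k < M | (k < J.+1)%N) joined 0 k s t = h.
    apply: (joined_cover mu_gt0) => // tau /andP[stau taut].
    have tau0 : 0 <= tau by apply: le_trans s0 (ltW stau).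
    apply: exists_lt1_of_sum => //.
    rewrite -(busy_dev_maxE mu_gt0 gamma_gt0 J_critical) subr_gt0.
    have := lip tau; rewrite s0 (ltW stau) => /(_ isT).
    rewrite ler_norml => /andP[_].
    have : rb * (tau - s) <= rb * h by rewrite ler_wpM2l// lerB.
    lra.
  have := @prefix_step R M mu gamma lambda mu_gt0 gamma_gt0 capacity lambda_gt0 x xsol J.+1 s t s0t.
  rewrite cov -duE.
  have -> : prefix_sum (fun k => mu k * gamma k * (x s 0%N k - x s 1%N k)) J.+1 =
      Bcap (x s 0%N) - Dcap (x s).
    by rewrite /busy_capacity /queue_capacity /prefix_sum -sumrB; apply: eq_bigr => k _; ring.
  rewrite -/h ler_norml => /andP[lo _].
  set du := udev _ - u in lo *.
  have {}lo : (lambda - Bcap (x s 0%N) + Dcap (x s)) * h - 2 * rb * h ^+ 2 <= du by lra.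
  have h1 := ler_wpM2l c0 lo.
  have h2 : c * (2 * rb * h ^+ 2) <= (1 + umax^-1) * (2 * rb * h ^+ 2).
    by rewrite ler_wpM2r// mulr_ge0// mulr_ge0.
  have h3 : 0 <= (rb ^+ 2 + 2 * rb) / umax * h ^+ 2.
    by rewrite !mulr_ge0// addr_ge0 ?sqr_ge0// mulr_ge0.
  have e1 : c * ((lambda - Bcap (x s 0%N) + Dcap (x s)) * h - 2 * rb * h ^+ 2) =
    c * (lambda - Bcap (x s 0%N) + Dcap (x s)) * h - c * (2 * rb * h ^+ 2) by ring.
  rewrite e1 in h1.
  rewrite mulNr !mulNr [_ * h ^+ 2]mulrDl; lra.
- have c_le : c <= rb * h / umax.
    rewrite /c lerBlDr -mulrDl ler_pdivlMr// mul1r; lra.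
  have lt := lip t s0t; rewrite -/h in lt.
  set du := udev _ - u in lt *.
  have rh0 : 0 <= rb * h by rewrite mulr_ge0.
  have h1 : - (c * du) <= rb ^+ 2 / umax * h ^+ 2.
    apply: le_trans (ler_norm _) _; rewrite normrN normrM (ger0_norm c0).
    have -> : rb ^+ 2 / umax * h ^+ 2 = (rb * h / umax) * (rb * h) by ring.
    by apply: ler_pM.
  have h2 : c * ((lambda - Bcap (x s 0%N) + Dcap (x s)) * h) <= 2 * rb / umax * h ^+ 2.
    have -> : 2 * rb / umax * h ^+ 2 = (rb * h / umax) * (2 * h) by ring.
    apply: (@le_trans _ _ (c * (2 * h))).
      by rewrite ler_wpM2l// ler_wpM2r//; lra.
    by rewrite ler_wpM2r// mulr_ge0.
  have h3 : 0 <= (1 + umax^-1) * (2 * rb) * h ^+ 2.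
    by rewrite !mulr_ge0// addr_ge0.
  have e3 : ((1 + umax^-1) * (2 * rb) + (rb ^+ 2 + 2 * rb) / umax) * h ^+ 2 =
     (1 + umax^-1) * (2 * rb) * h ^+ 2 + rb ^+ 2 / umax * h ^+ 2 + 2 * rb / umax * h ^+ 2 by ring.
  rewrite e3 !mulNr -mulrA; lra.
Qed.

(** The same alternative: either b stays positive on the interval and all arrivals go to types below
    [J], or b is at most [rb * h] and every term is of order h^2. *)
Lemma idle_step s t : 0 <= s <= t ->
  bdev (x s 0%N) * (bdev (x t 0%N) - bdev (x s 0%N)) <=
  - (mu J * bdev (x s 0%N) ^+ 2) * (t - s) + (2 * rb + rb ^+ 2 + mu J * rb) * (t - s) ^+ 2.
Proof.
move=> s0t; have /andP[s0 st] := s0t; have h0 : 0 <= t - s by rewrite subr_ge0.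
have r0 := rb_ge0; have muJ := mu_gt0 J.
set h := t - s in h0 *; set b := bdev (x s 0%N).
have /andP[b0 b1] : 0 <= b <= 1 := idle_below_itv gamma_gt0 gamma_sum J (fun k => y01 k s0).
have bE tau : bdev (x tau 0%N) = prefix_sum gamma J - prefix_sum (fun k => gamma k * x tau 0%N k) J.
  by rewrite /idle_below /prefix_sum -sumrB; apply: eq_bigr => k _; ring.
have dbE tau : bdev (x tau 0%N) - b = - (prefix_sum (fun k => gamma k * x tau 0%N k) J -
   prefix_sum (fun k => gamma k * x s 0%N k) J) by rewrite /b !bE; ring.
have lip tau : 0 <= s <= tau -> `|bdev (x tau 0%N) - b| <= rb * (tau - s).
  by move=> st'; rewrite dbE normrN; exact: (prefix_lipschitz mu_gt0).
have hh : 0 <= h ^+ 2 by exact: sqr_ge0.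
have [caseA|caseB] := ltP (rb * h) b.
- have cov : \sum_(k < M | (k < J)%N) joined 0 k s t = h.
    apply: (joined_cover mu_gt0) => // tau /andP[stau taut].
    have tau0 : 0 <= tau by apply: le_trans s0 (ltW stau).
    apply: exists_lt1_of_sum => //; rewrite -/(bdev (x tau 0%N)).
    have := lip tau; rewrite s0 (ltW stau) => /(_ isT).
    rewrite ler_norml => /andP[].
    have : rb * (tau - s) <= rb * h by rewrite ler_wpM2l// lerB.
    lra.
  have := @prefix_step R M mu gamma lambda mu_gt0 gamma_gt0 capacity lambda_gt0 x xsol J s t s0t.
  rewrite cov -/h ler_norml => /andP[lo _].
  (* Types below [J] are faster than [J], so their idleness puts the capacity in use at least mu_J b
     below [prefix_sum a J], hence below lambda. *)
  have drift : mu J * b <= lambda - prefix_sum (fun k => mu k * gamma k * (x s 0%N k - x s 1%N k)) J.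
    have /andP[JL _] := J_critical.
    rewrite lerBrDr; apply: le_trans JL.
    rewrite /b /idle_below /prefix_sum mulr_sumr -big_split /=; apply: ler_sum => k kJ.
    have muk := mu_decr kJ; have gk := gamma_gt0 k.
    have /andP[x0 x1] := y01 k s0; have /andP[z0 z1] := state_level_itv 1 k (x_state s0).
    have h1 : mu J * (gamma k * (1 - x s 0%N k)) <= mu k * (gamma k * (1 - x s 0%N k)).
      by rewrite ler_wpM2r ?(ltW muk)// mulr_ge0 ?(ltW gk)// subr_ge0.
    have h2 : 0 <= mu k * gamma k * x s 1%N k by rewrite !mulr_ge0 ?(ltW gk) ?(ltW (mu_gt0 k)).
    lra.
  have h1 := ler_wpM2r h0 drift.
  rewrite dbE; set dz := prefix_sum _ _ - _ in lo *.
  have {}lo : mu J * b * h - 2 * rb * h ^+ 2 <= dz by lra.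
  have h2 := ler_wpM2l b0 lo.
  have h3 : b * (2 * rb * h ^+ 2) <= 2 * rb * h ^+ 2 by rewrite ler_piMl// mulr_ge0// mulr_ge0.
  have h4 : 0 <= (rb ^+ 2 + mu J * rb) * h ^+ 2.
    by rewrite mulr_ge0// addr_ge0 ?sqr_ge0// mulr_ge0// ltW.
  have e1 : b * (mu J * b * h - 2 * rb * h ^+ 2) = mu J * b ^+ 2 * h - b * (2 * rb * h ^+ 2) by ring.
  rewrite e1 in h2.
  have e2 : (2 * rb + rb ^+ 2 + mu J * rb) * h ^+ 2 = 2 * rb * h ^+ 2 + (rb ^+ 2 + mu J * rb) * h ^+ 2.
    ring.
  rewrite e2 mulrN mulNr; lra.
- have lt := lip t s0t; rewrite -/h in lt.
  set db := bdev _ - b in lt *.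
  have h1 : b * db <= rb ^+ 2 * h ^+ 2.
    apply: le_trans (ler_norm _) _; rewrite normrM (ger0_norm b0) -exprMn expr2.
    exact: ler_pM.
  have h2 : mu J * b ^+ 2 * h <= mu J * rb * h ^+ 2.
    have -> : mu J * b ^+ 2 * h = mu J * (b * b) * h by rewrite expr2.
    have -> : mu J * rb * h ^+ 2 = mu J * (rb * h * 1) * h by ring.
    by rewrite ler_wpM2r// ler_wpM2l ?(ltW muJ)// ler_pM.
  have h3 : 0 <= 2 * rb * h ^+ 2 by rewrite !mulr_ge0.
  have e2 : (2 * rb + rb ^+ 2 + mu J * rb) * h ^+ 2 =
     2 * rb * h ^+ 2 + rb ^+ 2 * h ^+ 2 + mu J * rb * h ^+ 2 by ring.
  rewrite e2 mulNr; lra.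
Qed.

Lemma lyapunov_step : exists2 K, 0 < K & forall s t, 0 <= s <= t ->
  V (x t) - V (x s) <= - W (x s) * (t - s) + K * (t - s) ^+ 2.
Proof.
pose K1 := (1 + umax^-1) * (2 * rb) + (rb ^+ 2 + 2 * rb) / umax.
pose K2 := 2 * rb + rb ^+ 2 + mu J * rb.
pose kw := idle_weight mu gamma lambda J.
have um := umax_gt0; have muJ := mu_gt0 J; have r0 := rb_ge0.
have kw0 : 0 < kw by exact: idle_weight_gt0.
(* In this order: the squared increment of u, the errors of [busy_dev_step] and [mass_step], then
   [idle_step] with the squared increment of b. *)
pose K0 := rb ^+ 2 / (2 * umax) + K1 + 2 * rb + kw * (2 * K2 + rb ^+ 2).
have iu : 0 <= umax^-1 by rewrite invr_ge0 ltW.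
have K1_0 : 0 <= K1.
  apply: addr_ge0; apply: mulr_ge0 => //; [exact: addr_ge0|exact: mulr_ge0|].
  by apply: addr_ge0; [exact: sqr_ge0|exact: mulr_ge0].
have K2_0 : 0 <= K2.
  apply: addr_ge0; [apply: addr_ge0; [exact: mulr_ge0|exact: sqr_ge0]|].
  by apply: mulr_ge0 => //; exact: ltW.
have K0_0 : 0 <= K0.
  apply: addr_ge0; [apply: addr_ge0; [apply: addr_ge0 => //|exact: mulr_ge0]|].
    by apply: mulr_ge0; [exact: sqr_ge0|rewrite invr_ge0 mulr_ge0// ltW].
  apply: mulr_ge0; first exact: ltW.
  by apply: addr_ge0; [exact: mulr_ge0|exact: sqr_ge0].
exists (K0 + 1); first by rewrite ltr_wpDl.
move=> s t s0t; have /andP[s0 st] := s0t; have h0 : 0 <= t - s by rewrite subr_ge0.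
have t0 := le_trans s0 st.
have := mass_step mu_gt0 gamma_gt0 capacity lambda_gt0 xsol s0t.
have := busy_dev_step s0t; have := idle_step s0t.
have lipu : `|udev (x t 0%N) - udev (x s 0%N)| <= rb * (t - s).
  have -> : udev (x t 0%N) - udev (x s 0%N) =
   prefix_sum (fun k => gamma k * x t 0%N k) J.+1 -
   prefix_sum (fun k => gamma k * x s 0%N k) J.+1 by rewrite /busy_dev; ring.
  exact: (prefix_lipschitz mu_gt0).
have lipb : `|bdev (x t 0%N) - bdev (x s 0%N)| <= rb * (t - s).
  have -> : bdev (x t 0%N) - bdev (x s 0%N) =
   - (prefix_sum (fun k => gamma k * x t 0%N k) J -
   prefix_sum (fun k => gamma k * x s 0%N k) J).
    rewrite /idle_below /prefix_sum -!sumrB -sumrN; apply: eq_bigr => k _; ring.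
  rewrite normrN; exact: (prefix_lipschitz mu_gt0).
have AE : \sum_(k < M) mu k * gamma k * x s 0%N k = Bcap (x s 0%N) + Ecap (x s 0%N).
  by rewrite (prefix_sum_split _ J.+1).
have cd := capacity_drift mu_gt0 gamma_gt0 gamma_sum J_critical (fun k => y01 k s0).
have dzE : prefix_sum (fun k => gamma k * x t 0%N k) J.+1 -
   prefix_sum (fun k => gamma k * x s 0%N k) J.+1 = udev (x t 0%N) - udev (x s 0%N).
  by rewrite /busy_dev; ring.
rewrite AE -/K1 -/K2 /lyapunov /dissipation -/kw.
set Zt := prefix_sum _ J.+1 in dzE *.
set Zs := prefix_sum _ J.+1 in dzE *.
move: lipu lipb dzE cd.
set ut := udev (x t 0%N); set us := udev (x s 0%N).
set bt := bdev (x t 0%N); set bs := bdev (x s 0%N).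
set B := Bcap _; set E := Ecap _; set D := Dcap _; set h := t - s in h0 *.
set mt := mass _ _; set ms := mass _ _; set ic := idle_cost mu J.
move=> lipu lipb dzE cd ib iu' im.
have squ : (ut - us) ^+ 2 <= rb ^+ 2 * h ^+ 2.
  rewrite -exprMn -[leLHS]real_normK ?num_real// ler_sqr ?nnegrE//.
  by rewrite mulr_ge0.
have sqb : (bt - bs) ^+ 2 <= rb ^+ 2 * h ^+ 2.
  rewrite -exprMn -[leLHS]real_normK ?num_real// ler_sqr ?nnegrE//.
  by rewrite mulr_ge0.
have i2u : 0 <= (2 * umax)^-1 by rewrite invr_ge0 mulr_ge0// ltW.
have squ' := ler_wpM2r i2u squ.
have sqb' := ler_wpM2l (ltW kw0) sqb.
have ib' := ler_wpM2l (ltW kw0) ib.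
have cd' : us / umax * (lambda - B) <= - (mu J / (2 * umax)) * us ^+ 2 + ic / umax * bs ^+ 2.
  have := ler_wpM2r iu cd.
  have -> : us * (lambda - B) / umax = us / umax * (lambda - B) by ring.
  by have -> : (- (mu J / 2) * us ^+ 2 + ic * bs ^+ 2) / umax =
     - (mu J / (2 * umax)) * us ^+ 2 + ic / umax * bs ^+ 2 by field; rewrite gt_eqF.
have kwE : 2 * mu J * kw = ic / umax + 1.
  by rewrite /kw /idle_weight -/ic; field; rewrite !gt_eqF.
have cdh := ler_wpM2r h0 cd'.
have e1 : ut ^+ 2 / (2 * umax) - us ^+ 2 / (2 * umax) =
   us / umax * (ut - us) + (ut - us) ^+ 2 / (2 * umax) by field; rewrite gt_eqF.
have e2 : kw * bt ^+ 2 - kw * bs ^+ 2 = 2 * (kw * (bs * (bt - bs))) + kw * (bt - bs) ^+ 2 by ring.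
have e3 : - (1 - us / umax) * (ut - us) = us / umax * (ut - us) - (ut - us) by ring.
rewrite e3 in iu'.
have e4 : - (1 - us / umax) * (lambda - B + D) * h =
  us / umax * (lambda - B) * h - (lambda - B) * h - (1 - us / umax) * D * h by ring.
rewrite e4 in iu'.
have e5 : (lambda - (B + E)) * h = (lambda - B) * h - E * h by ring.
rewrite e5 in im.
have e6 : 2 * (kw * (- (mu J * bs ^+ 2) * h + K2 * h ^+ 2)) =
  - (ic / umax * bs ^+ 2 * h) - bs ^+ 2 * h + 2 * kw * K2 * h ^+ 2.
  have -> : 2 * (kw * (- (mu J * bs ^+ 2) * h + K2 * h ^+ 2)) =
     - (2 * mu J * kw) * bs ^+ 2 * h + 2 * kw * K2 * h ^+ 2 by ring.
  by rewrite kwE; ring.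
have e7 : - (mu J / (2 * umax) * us ^+ 2 + bs ^+ 2 + E + (1 - us / umax) * D) * h =
  - (mu J / (2 * umax)) * us ^+ 2 * h - bs ^+ 2 * h - E * h - (1 - us / umax) * D * h by ring.
have e8 : (- (mu J / (2 * umax)) * us ^+ 2 + ic / umax * bs ^+ 2) * h =
  - (mu J / (2 * umax)) * us ^+ 2 * h + ic / umax * bs ^+ 2 * h by ring.
rewrite e8 in cdh.
have e9 : (K0 + 1) * h ^+ 2 = rb ^+ 2 * h ^+ 2 / (2 * umax) + K1 * h ^+ 2 + 2 * rb * h ^+ 2 +
   2 * kw * K2 * h ^+ 2 + kw * (rb ^+ 2 * h ^+ 2) + h ^+ 2 by rewrite /K0; ring.
have hh : 0 <= h ^+ 2 by exact: sqr_ge0.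
rewrite e7 e9.
have -> : ut ^+ 2 / (2 * umax) + (mt - Zt) + kw * bt ^+ 2 -
  (us ^+ 2 / (2 * umax) + (ms - Zs) + kw * bs ^+ 2) =
  (ut ^+ 2 / (2 * umax) - us ^+ 2 / (2 * umax)) + (mt - ms) - (Zt - Zs) +
  (kw * bt ^+ 2 - kw * bs ^+ 2) by ring.
rewrite e1 e2 dzE.
have ib2 : 2 * (kw * (bs * (bt - bs))) <= 2 * (kw * (- (mu J * bs ^+ 2) * h + K2 * h ^+ 2)).
  by rewrite ler_wpM2l.
rewrite e6 in ib2.
lra.
Qed.

Lemma fluid_cvg i j : x t i j @[t --> +oo] --> xs i j.
Proof.
have [K K0 step] := lyapunov_step.
have Vge0 t : 0 <= t -> 0 <= V (x t).
  by move=> t0; apply: lyapunov_ge0 => //; exact: x_state.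
have Wge0 t : 0 <= t -> 0 <= W (x t).
  by move=> t0; apply: dissipation_ge0 => //; exact: x_state.
apply/cvgrPdist_le => e e0.
have [d d0 small] := dissipation_small mu_gt0 gamma_gt0 gamma_sum capacity J_critical e0.
have [T T0 WT] := dissipation_cvg0 K0 Vge0 Wge0 step d0.
near=> t; have Tt : T <= t by near: t; apply: nbhs_pinfty_ge; exact: num_real.
rewrite distrC; apply: small; last exact: WT.
by apply: x_state; exact: le_trans Tt.
Unshelve. all: by end_near. Qed.

(** Convergence does not by itself keep a solution at the fixed state. But V vanishes there and
    cannot increase, so V stays 0 and [dissipation_eq0] makes the dissipation vanish at all
    times. *)
Lemma fluid_from_fixed_state : x 0 = xs -> forall t, 0 <= t -> x t = xs.
Proof.
move=> x0 t t0; have [K K0 step] := lyapunov_step.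
have Vge0 t' : 0 <= t' -> 0 <= V (x t').
  by move=> ?; apply: lyapunov_ge0 => //; exact: x_state.
have Wge0 t' : 0 <= t' -> 0 <= W (x t').
  by move=> ?; apply: dissipation_ge0 => //; exact: x_state.
have V0 : V (x 0) = 0.
  rewrite x0 /lyapunov /busy_dev subrr expr0n /= mul0r add0r.
  have -> : bdev (xs 0%N) = 0.
    rewrite /idle_below /prefix_sum big1// => k kJ.
    by rewrite (fixed_state_lt mu_gt0 gamma_gt0 J_critical kJ) subrr mulr0.
  rewrite expr0n /= mulr0 addr0; apply/eqP; rewrite subr_eq0; apply/eqP.
  rewrite /mass (prefix_sum_split _ J.+1) [X in _ + X]big1 ?addr0; last first.
    move=> k Jk; rewrite (_ : (fun i => xs i k) = fun=> 0).
      rewrite (_ : series _ = fun=> 0) ?lim_cst ?mulr0//.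
      by apply/funext => n; rewrite /series /= big1.
    apply/funext => -[|//].
    by rewrite (fixed_state_gt mu_gt0 gamma_gt0 J_critical Jk).
  rewrite /prefix_sum; apply: eq_bigr => k _; congr (_ * _).
  apply/cvg_lim => //; rewrite -cvg_shiftS /=.
  rewrite (_ : (fun n => _) = fun=> xs 0%N k); first exact: cvg_cst.
  by apply/funext => n; rewrite /series /= big_nat_recl// big1 ?addr0.
have Vt : V (x t) = 0.
  apply/eqP; rewrite eq_le Vge0// andbT -V0.
  by apply: (dissipation_nonincreasing K0 Wge0 step); rewrite lexx.
have Wt := dissipation_eq0 K0 Vge0 step t0 Vt.
apply/funext => i; apply/funext => j; apply/eqP; rewrite -subr_eq0 -normr_le0.
apply/ler_addgt0Pr => e e0; rewrite add0r.
have [d d0 small] := dissipation_small mu_gt0 gamma_gt0 gamma_sum capacity J_critical e0.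
by apply: small; [exact: x_state|exact: le_lt_trans Wt d0].
Qed.

End fluid_convergence.

(** * Join probabilities at the fixed state *)

Lemma limn_series0 (R : realType) (u : R^nat) : (forall i, u i.+1 = 0) ->
  limn (series u) = u 0%N.
Proof.
move=> u0; apply/cvg_lim => //; rewrite -cvg_shiftS /=.
rewrite (_ : (fun n => _) = fun=> u 0%N); first exact: cvg_cst.
by apply/funext => n; rewrite /series /= big_nat_recl// big1 ?addr0.
Qed.

(** * Rate conservation for idle counts *)

Section rate_conservation.
Context {R : realType} {M : nat}.
Variables (mu gamma : 'I_M -> R) (lambda : R).
Hypotheses (mu_gt0 : forall j, 0 < mu j) (gamma_gt0 : forall j, 0 < gamma j).
Hypothesis lambda_ge0 : 0 <= lambda.
Variable s : state R M.
Hypothesis s_state : state_space s.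
Variable pi : probability (blank M) R.
Hypothesis pi_stationary : is_stationary (blank_generator mu gamma lambda s) pi.
Variable G : set (blank M).
Hypothesis mG : measurable G.
Hypothesis G_update : forall g v i j, G (update g v i j) <-> G v.
Variable k : 'I_M.
Local Notation rate := (gamma k * mu k * (s 0%N k - s 1%N k)).

Definition level_gt (m : nat) : set (blank M) :=
  [set v | (if v 0%N k is Some n then (m < n)%N else false) /\ G v].

Definition level_eq (m : nat) : set (blank M) := [set v | v 0%N k = Some m /\ G v].

Lemma measurable_level_gt m : measurable (level_gt m).
Proof.
apply: measurableI => //.
exact: (measurable_coord 0 k (fun a => if a is Some n then (m < n)%N else false)).
Qed.

Lemma measurable_level_eq m : measurable (level_eq m).
Proof. by apply: measurableI => //; exact: measurable_coord_eq. Qed.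

Lemma in_level_gt m v a : v 0%N k = a -> G v ->
  (v \in level_gt m) = if a is Some n then (m < n)%N else false.
Proof.
move=> vk Gv; apply/idP/idP => [/set_mem[]|]; rewrite ?inE /level_gt /= vk; first by case: a vk.
by case: a vk.
Qed.

Lemma in_level_eq m v a : v 0%N k = a -> G v -> (v \in level_eq m) = (a == Some m).
Proof. by move=> <- Gv; apply/idP/eqP => [/set_mem[]|h] //; rewrite inE; split. Qed.

(** Only jumps of the coordinate (0, k) across the threshold change the indicator: infinite values
    never cross it, and jumps leave [G] unchanged. *)
Lemma generator_level_gt m v :
  blank_generator mu gamma lambda s \1_(level_gt m) v =
  rate * \1_(level_eq m) v - lambda * \1_(join_region 0 k `&` level_eq m.+1) v.
Proof.
have upd g i j : (i, j) <> (0%N, k) ->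
    \1_(level_gt m) (update g v i j) = \1_(level_gt m) v :> R.
  move=> ij; rewrite !indicE; congr (_%:R); congr nat_of_bool.
  have e : update g v i j 0%N k = v 0%N k.
    rewrite /update; case: ifP => // /andP[/eqP i0 /eqP jk].
    by case: ij; rewrite -i0 -jk.
  by apply/idP/idP; rewrite !inE /level_gt /= e => -[? /G_update ?].
rewrite /blank_generator (bigD1 k)//= [X in _ + X]big1 ?addr0; last first.
  move=> j jk; rewrite limn_series0 => [|i]; rewrite !upd ?subrr ?mulr0 ?addr0//.
  - by case=> jk'; rewrite jk' eqxx in jk.
  - by case=> jk'; rewrite jk' eqxx in jk.
rewrite limn_series0 => [|i]; last by rewrite !upd ?subrr ?mulr0 ?addr0.
have up : \1_(level_gt m) (update succn v 0 k) - \1_(level_gt m) v = \1_(level_eq m) v :> R.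
  rewrite !indicE; have [Gv|Gv] := pselect (G v); last first.
    by rewrite !memNset ?subrr// => -[_]//; move/G_update.
  have e : update succn v 0 k 0%N k = omap succn (v 0%N k) by rewrite /update !eqxx.
  have Gv' g : G (update g v 0 k) by apply/G_update.
  rewrite (in_level_gt m e)// (in_level_gt m erefl Gv) (in_level_eq m erefl Gv).
  case: (v 0%N k) => [n|]; last by rewrite subrr.
  rewrite /= (inj_eq Some_inj) ltnS.
  by case: ltngtP => /=; rewrite ?subrr ?subr0.
have down : \1_(join_region 0 k) v * (\1_(level_gt m) (update predn v 0 k) - \1_(level_gt m) v)
    = - \1_(join_region 0 k `&` level_eq m.+1) v :> R.
  rewrite !indicE in_setI; have [jv|jv] := boolP (v \in join_region 0 k); last by rewrite mul0r oppr0.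
  have nz : v 0%N k <> Some 0%N by move: jv; rewrite inE => -[].
  rewrite mul1r /=; have [Gv|Gv] := pselect (G v); last first.
    by rewrite !memNset ?subrr ?oppr0// => -[_]//; move/G_update.
  have e : update predn v 0 k 0%N k = omap predn (v 0%N k) by rewrite /update !eqxx.
  have Gv' g : G (update g v 0 k) by apply/G_update.
  rewrite (in_level_gt m e)// (in_level_gt m erefl Gv) (in_level_eq m.+1 erefl Gv).
  case: (v 0%N k) nz => [[|n]|]// _; last by rewrite /= subrr oppr0.
  rewrite /= (inj_eq Some_inj) ltnS eqSS.
  by case: ltngtP => /=; rewrite ?subrr ?sub0r ?oppr0.
by rewrite up -(mulrA lambda) down mulrN.
Qed.

Lemma level_balance m :
  rate * fine (pi (level_eq m)) = lambda * fine (pi (join_region 0 k `&` level_eq m.+1)).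
Proof.
have bL := blank_generator_bounded (fun j => ltW (mu_gt0 j)) (fun j => ltW (gamma_gt0 j))
  lambda_ge0 s_state.
have C0 : 0 <= 2 * \sum_(j < M) (gamma j * mu j + lambda).
  by rewrite mulr_ge0// sumr_ge0// => j _; rewrite addr_ge0// mulr_ge0// ltW.
have mR : measurable (join_region 0 k `&` level_eq m.+1).
  by apply: measurableI; [exact: measurable_join_region|exact: measurable_level_eq].
have := stationary_drift_indic C0 bL pi_stationary (measurable_level_gt m).
under eq_Rintegral do rewrite generator_level_gt.
have b1 := @bmeas_indic _ _ R _ (measurable_level_eq m).
have b2 := @bmeas_indic _ _ R _ mR.
rewrite bmeas_RintegralB; last 2 first.
- by apply: bmeasM; [exact: bmeas_cst|].
- by apply: bmeasM; [exact: bmeas_cst|].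
rewrite !bmeas_RintegralZ// !prob_Rintegral_indic//; last exact: measurable_level_eq.
by move/eqP; rewrite subr_eq0 => /eqP.
Qed.

(** Summing the crossing equations over [m] replaces the unbounded test function [v 0 k]. The event
    [G] will be either the whole space or that another coordinate is infinite. *)
Lemma rate_conservation :
  rate * fine (pi ([set v : blank M | v 0%N k <> None] `&` G)) =
  lambda * fine (pi (join_region 0 k `&` ([set v : blank M | v 0%N k <> None] `&` G))).
Proof.
have r0 : 0 <= rate.
  by rewrite !mulr_ge0 ?(ltW (mu_gt0 k)) ?(ltW (gamma_gt0 k))// subr_ge0 (state_dec s_state).
have mR m : measurable (join_region 0 k `&` level_eq m.+1).
  by apply: measurableI; [exact: measurable_join_region|exact: measurable_level_eq].
have E1 : [set v : blank M | v 0%N k <> None] `&` G = \bigcup_m level_eq m.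
  apply/seteqP; split=> v /=.
    by case; case vk : (v 0%N k) => [n|]// _ Gv; exists n.
  by case=> n _ [/= ->].
have E2 : join_region 0 k `&` ([set v : blank M | v 0%N k <> None] `&` G) =
    \bigcup_m (join_region 0 k `&` level_eq m.+1).
  apply/seteqP; split=> v /=.
    case=> jv []; case vk : (v 0%N k) => [[|n]|]// _ Gv; last by exists n.
    by case: jv => _ _ _ _ /=; rewrite vk.
  by case=> n _ [jv [/= -> ?]].
have T1 : trivIset setT level_eq.
  apply/trivIsetP => m n _ _ mn; apply/seteqP; split=> v //= -[[vm _] [vn _]].
  by move: vn; rewrite vm => -[nm]; rewrite nm eqxx in mn.
have T2 : trivIset setT (fun m => join_region 0 k `&` level_eq m.+1).
  apply/trivIsetP => m n _ _ mn; apply/seteqP; split=> v //= -[[_ [vm _]] [_ [vn _]]].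
  by move: vn; rewrite vm => -[nm]; rewrite nm eqxx in mn.
have m1 : measurable ([set v : blank M | v 0%N k <> None] `&` G).
  by rewrite E1; apply: bigcupT_measurable => m; exact: measurable_level_eq.
have m2 : measurable (join_region 0 k `&` ([set v : blank M | v 0%N k <> None] `&` G)).
  by rewrite E2; exact: bigcupT_measurable.
apply: EFin_inj; rewrite !EFinM !fineK ?fin_num_measure//.
rewrite E2 E1 !measure_bigcup//; last by move=> m _; exact: measurable_level_eq.
rewrite -!nneseriesZl//; apply: eq_eseriesr => m _.
rewrite -[X in (_ * X)%E]fineK ?fin_num_measure//; last exact: measurable_level_eq.
rewrite -[X in _ = (_ * X)%E]fineK ?fin_num_measure//.
by rewrite -!EFinM level_balance.
Qed.

End rate_conservation.

Section real_probability.
Context d (T : measurableType d) (R : realType) (P : probability T R).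
Implicit Types A B : set T.

Lemma prob_split A B : measurable A -> measurable B ->
  fine (P A) = fine (P (A `&` B)) + fine (P (A `&` ~` B)).
Proof.
move=> mA mB; have := measureDI P mA mB; rewrite setDE => e.
rewrite -fineD; first by rewrite [X in fine X = _]e addeC.
- by apply: fin_num_measure; exact: measurableI.
- by apply: fin_num_measure; apply: measurableI => //; exact: measurableC.
Qed.

Lemma fine_prob_ge0 A : 0 <= fine (P A).
Proof. exact: fine_ge0. Qed.

Lemma fine_prob_setIl0 A B : measurable A -> measurable B -> fine (P A) = 0 ->
  fine (P (A `&` B)) = 0.
Proof.
move=> mA mB A0; have := prob_split mA mB; rewrite A0.
by have := fine_prob_ge0 (A `&` B); have := fine_prob_ge0 (A `&` ~` B); lra.
Qed.

Lemma fine_prob_setI1 A B : measurable A -> measurable B -> P A = 1%E ->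
  fine (P (A `&` B)) = fine (P B).
Proof.
move=> mA mB A1; have := prob_split mB mA.
have -> : fine (P (B `&` ~` A)) = 0.
  rewrite setIC; apply: fine_prob_setIl0 => //; first exact: measurableC.
  by rewrite probability_setC// A1 subee.
by rewrite addr0 setIC => ->.
Qed.

Lemma fine_prob_setC A : measurable A -> fine (P (~` A)) = 1 - fine (P A).
Proof.
move=> mA; have := prob_split measurableT mA; rewrite !setTI probability_setT /=; lra.
Qed.

Lemma prob_sum_partition (I : finType) (Q : pred I) (A : I -> set T) (B : set T) :
  (forall i, measurable (A i)) -> measurable B ->
  (forall x i i', A i x -> A i' x -> i = i') ->
  (forall x, B x -> exists2 i, Q i & A i x) -> (forall i, A i `<=` B) ->
  \sum_(i | Q i) fine (P (A i)) = fine (P B).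
Proof.
move=> mA mB dA BA AB; rewrite -Rintegral_sum_indic// -prob_Rintegral_indic//.
apply: eq_Rintegral => x _; have [Bx|Bx] := pselect (B x); last first.
  rewrite [RHS]indicE memNset// big1// => i _; rewrite indicE memNset// => /AB.
  exact.
have [i Qi Ai] := BA x Bx; rewrite [RHS]indicE mem_set//.
rewrite (bigD1 i)//= indicE mem_set// big1 ?addr0// => i' /andP[_ i'i].
by rewrite indicE memNset// => Ai'; case/eqP: i'i; exact: dA Ai' Ai.
Qed.

End real_probability.

Section fixed_state_join.
Context {R : realType} {M : nat}.
Variables (mu gamma : 'I_M -> R) (lambda : R).
Hypotheses (mu_gt0 : forall j, 0 < mu j) (gamma_gt0 : forall j, 0 < gamma j).
Hypotheses (lambda_gt0 : 0 < lambda).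
Variable J : 'I_M.
Local Notation a := (fun k => mu k * gamma k).
Hypothesis J_critical : prefix_sum a J <= lambda < prefix_sum a J.+1.
Local Notation xs := (fixed_state mu gamma lambda).

Lemma fixed_state_in_space : state_space xs.
Proof.
have itv := fixed_state_itv lambda mu_gt0 gamma_gt0.
split.
  case=> [|i] j; last by rewrite /= lexx ler01.
  by have /andP[? ?] := itv j; rewrite [X in X <= _]/= lexx; split.
rewrite /norm1; apply: (big_ind (fun y => (y < +oo)%E)) => // [y z yo zo|j _].
  by rewrite gt_max yo zo.
rewrite (_ : (\sum_(0 <= i <oo) _)%E = `|xs 0%N j|%:E) ?ltry//.
apply/cvg_lim => //; rewrite -cvg_shiftS /=.
rewrite (_ : (fun n => _) = fun=> `|xs 0%N j|%:E); first exact: cvg_cst.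
apply/funext => n; rewrite big_nat_recl// big1 ?adde0// => i _.
by rewrite /= normr0.
Qed.

Lemma join_region_level0_cover (v : blank M) (k : 'I_M) : blankE v ->
  v 0%N k <> Some 0%N -> exists2 j : 'I_M, (j <= k)%N & join_region 0 j v.
Proof.
move=> Ev /eqP vk.
pose j := [arg min_(j < k | v 0%N j != Some 0%N) val j].
rewrite /j; case: (@arg_minnP _ k (fun j => v 0%N j != Some 0%N) val vk) => {}j vj jmin.
exists j; first exact: jmin.
split=> //; last exact/eqP.
by move=> l lj; apply/eqP; apply: contraTT lj => vl; rewrite -leqNgt; exact: jmin.
Qed.

(** Let q be the probability that type [k] has infinitely many idle servers. On that event every
    arrival joins a type at most [k]; conservation on and off the event gives lambda p_k = a_k + q
    (lambda - prefix_sum a k.+1). A blank measure satisfies lambda p_k <= a_k, so the last term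
    vanishes. *)
Lemma fixed_state_join_rate pi : is_blank_measure mu gamma lambda xs pi ->
  forall k : 'I_M, (k < J)%N -> lambda * fine (pi (join_region 0 k)) = a k.
Proof.
move=> [st piE _ pile] .
pose N (k : 'I_M) := [set v : blank M | v 0%N k = None].
have mN k : measurable (N k) by exact: measurable_coord_eq.
have NC k : ~` N k = [set v : blank M | v 0%N k <> None] by [].
have NG k : forall g (v : blank M) i j, N k (update g v i j) <-> N k v.
  by move=> g v i j; rewrite /N /update /=; case: ifP => // _; case: (v 0%N k).
have TG : forall g (v : blank M) i j, [set: blank M] (update g v i j) <-> [set: blank M] v by [].
have ss := fixed_state_in_space.
have x0 (k : 'I_M) : (k < J)%N -> xs 0%N k = 1.
  exact: fixed_state_lt.
have mR k : measurable (join_region 0 k : set (blank M)) := measurable_join_region 0 k.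
have mE : measurable (blankE : set (blank M)) := measurable_blankE.
(* The second half feeds the induction. It is conditional because at capacity exactly [lambda] the
   identity leaves q undetermined; for a type l < k < J the strict inequality always holds. *)
suff key n (k : 'I_M) : val k = n -> (k < J)%N ->
    lambda * fine (pi (join_region 0 k)) = a k /\
    (prefix_sum a k.+1 < lambda -> fine (pi (N k)) = 0).
  by move=> k kJ; have [] := key _ k erefl kJ.
elim/ltn_ind: n k => n IH k kn kJ.
have Nl (l : 'I_M) : (l < k)%N -> fine (pi (N l)) = 0.
  move=> lk; have [] := IH l _ l erefl (ltn_trans lk kJ); first by rewrite -kn.
  move=> _; apply; have /andP[JL _] := J_critical; apply: lt_le_trans JL.
  apply: (@lt_le_trans _ _ (prefix_sum a k.+1)).
    rewrite [X in _ < X]prefix_sumS ltr_pwDr ?mulr_gt0//.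
    by apply: prefix_sum_le => // i; rewrite ltW// mulr_gt0.
  by apply: prefix_sum_le => // i; rewrite ltW// mulr_gt0.
have rateE (l : 'I_M) : (l < J)%N -> gamma l * mu l * (xs 0%N l - xs 1%N l) = a l.
  by move=> lJ; rewrite x0// subr0 mulr1 mulrC.
set q := fine (pi (N k)).
have q0 : 0 <= q by exact: fine_prob_ge0.
have cons1 := rate_conservation mu_gt0 gamma_gt0 (ltW lambda_gt0) ss st measurableT TG k.
rewrite rateE// setIT -NC fine_prob_setC// -/q in cons1.
have consl (l : 'I_M) : (l < k)%N -> a l * q = lambda * fine (pi (join_region 0 l `&` N k)).
  move=> lk; have := rate_conservation mu_gt0 gamma_gt0 (ltW lambda_gt0) ss st (mN k) (NG k) l.
  rewrite rateE ?(ltn_trans lk)// -NC.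
  have Nl1 : pi (~` N l) = 1%E.
    have := fine_prob_setC pi (mN l); rewrite Nl// subr0 => e.
    by rewrite -[LHS]fineK ?e// fin_num_measure//; exact: measurableC.
  rewrite fine_prob_setI1//; last exact: measurableC.
  rewrite -/q => ->; congr (_ * _).
  rewrite setICA fine_prob_setI1//; [exact: measurableC|exact: measurableI].
have part : \sum_(l < M | (l < k.+1)%N) fine (pi (join_region 0 l `&` N k)) = q.
  rewrite (@prob_sum_partition _ _ _ pi _ _ _ (blankE `&` N k)).
  - by rewrite fine_prob_setI1.
  - by move=> l; exact: measurableI.
  - exact: measurableI.
  - by move=> v l l' [h _] [h' _]; have [] := join_region_inj h h'.
  - move=> v [Ev vk]; have [|l lk hl] := @join_region_level0_cover v k Ev; first by rewrite vk.
    by exists l.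
  - by move=> l v [[]].
have Rk := prob_split pi (mR k) (mN k).
have lR : lambda * fine (pi (join_region 0 k `&` N k)) = q * (lambda - prefix_sum a k).
  have := part; rewrite -/(prefix_sum (fun l => fine (pi (join_region 0 l `&` N k))) k.+1) prefix_sumS.
  move=> /(congr1 (fun y => lambda * y)); rewrite mulrDr.
  have -> : lambda * prefix_sum (fun l : 'I_M => fine (pi (join_region 0 l `&` N k))) k = prefix_sum a k * q.
    rewrite /prefix_sum mulr_sumr mulr_suml; apply: eq_bigr => l lk.
    by rewrite consl.
  lra.
have le := pile 0%N k (x0 k kJ).
rewrite x0// subr0 mulr1 in le.
have {}le : lambda * fine (pi (join_region 0 k)) <= a k.
  by rewrite -lee_fin EFinM fineK// fin_num_measure.
have tot : lambda * fine (pi (join_region 0 k)) = a k + q * (lambda - prefix_sum a k.+1).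
  rewrite Rk mulrDr lR -cons1 prefix_sumS; ring.
have kL : 0 <= lambda - prefix_sum a k.+1.
  rewrite subr_ge0; have /andP[JL _] := J_critical; apply: le_trans JL.
  by apply: prefix_sum_le => // i; rewrite ltW// mulr_gt0.
have z : q * (lambda - prefix_sum a k.+1) = 0.
  by apply/eqP; rewrite eq_le mulr_ge0// andbT; rewrite tot in le; lra.
split; first by rewrite tot z addr0.
move=> h; move/eqP: z; rewrite mulf_eq0 => /orP[/eqP //|/eqP]; lra.
Qed.

End fixed_state_join.

(* A Markov chain on [X] given by finitely supported transitions [K], with an
   embedding of [X] in [T].  [occ n] is the law of the chain at time n killed at
   its first return to [x0], as a list of weighted points; the occupation
   measure of an excursion from [x0] is invariant. *)
Section excursion.
Context d (T : measurableType d) (R : realType) (X : eqType).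
Variables (e : X -> T) (K : X -> seq (R * X)) (x0 : X) (at0 : pred X).
Variables (g : X -> R) (delta : R).

Definition wsum (l : seq (R * X)) (f : X -> R) : R := \sum_(p <- l) p.1 * f p.2.

Hypothesis K_ge0 : forall x, all (fun p : R * X => 0 <= p.1) (K x).
Hypothesis K_sum : forall x, wsum (K x) (fun=> 1) = 1.
Hypothesis at0_e : forall x, at0 x -> e x = e x0.
Hypothesis g_ge0 : forall x, 0 <= g x.
Hypothesis delta_gt0 : 0 < delta.
Hypothesis g_drift : forall x, ~~ at0 x -> wsum (K x) g <= g x - delta.

Fixpoint occ (n : nat) : seq (R * X) :=
  if n is n'.+1 then
    [seq p <- flatten [seq [seq (p.1 * q.1, q.2) | q <- K p.2] | p <- occ n'] | ~~ at0 p.2]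
  else [:: (1, x0)].

Let pos (l : seq (R * X)) := all (fun p : R * X => 0 <= p.1) l.

Lemma wsumD l f h : wsum l (fun x => f x + h x) = wsum l f + wsum l h.
Proof. by rewrite /wsum -big_split /=; apply: eq_bigr => p _; rewrite mulrDr. Qed.

Lemma wsumZ l a f : wsum l (fun x => a * f x) = a * wsum l f.
Proof. by rewrite /wsum mulr_sumr; apply: eq_bigr => p _; rewrite mulrCA. Qed.

Lemma wsum_le_in (Q : pred X) l f h : pos l -> all (fun p : R * X => Q p.2) l ->
  (forall x, Q x -> f x <= h x) -> wsum l f <= wsum l h.
Proof.
rewrite /wsum; elim: l => [|p l IH] /=; first by rewrite !big_nil.
by move=> /andP[p0 l0] /andP[Qp Ql] fh; rewrite !big_cons lerD ?IH// ler_wpM2l// fh.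
Qed.

Lemma wsum_le l f h : pos l -> (forall x, f x <= h x) -> wsum l f <= wsum l h.
Proof. by move=> l0 fh; apply: (@wsum_le_in xpredT) => //; exact: all_predT. Qed.

Lemma wsum_norm l f c : pos l -> (forall x, `|f x| <= c) -> `|wsum l f| <= c * wsum l (fun=> 1).
Proof.
move=> l0 fc; rewrite ler_norml -mulNr -!wsumZ; apply/andP; split; apply: wsum_le => // x;
  by rewrite mulr1; have := fc x; rewrite ler_norml => /andP[].
Qed.

Lemma occ_pos n : pos (occ n).
Proof.
elim: n => [|n IH] /=; first by rewrite /pos /= ler01.
rewrite /pos all_filter; apply/allP => p /flattenP[_ /mapP[q qn ->] /mapP[r rK ->]] /=.
by apply/implyP => _; rewrite mulr_ge0//; [exact: (allP IH)|exact: (allP (K_ge0 q.2))].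
Qed.

Lemma wsum_occS n f :
  wsum (occ n.+1) f = wsum (occ n) (fun x => wsum (K x) (fun y => (~~ at0 y)%:R * f y)).
Proof.
rewrite /wsum /= big_filter big_flatten big_map; apply: eq_bigr => p _.
rewrite big_map big_mkcond mulr_sumr /=; apply: eq_bigr => q _.
by case: (at0 q.2); rewrite /= ?mul0r ?mulr0// mul1r mulrA.
Qed.

Lemma occ_not_at0 n : all (fun p : R * X => ~~ at0 p.2) (occ n.+1).
Proof. exact: filter_all. Qed.

Let m n := wsum (occ n) (fun=> 1).

Let m_ge0 n : 0 <= m n.
Proof.
have := @wsum_le (occ n) (fun=> 0) (fun=> 1) (occ_pos n) (fun=> ler01).
by rewrite /wsum big1// => p _; rewrite mulr0.
Qed.

(** The mass removed at step n + 1 is the mass that has reached [at0], and [e] sends all such states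
    to [e x0]. *)
Lemma occ_step n f :
  wsum (occ n) (fun x => wsum (K x) (f \o e)) =
  wsum (occ n.+1) (f \o e) + f (e x0) * (m n - m n.+1).
Proof.
have h : forall x, wsum (K x) (f \o e) =
   wsum (K x) (fun y => (~~ at0 y)%:R * f (e y)) +
   f (e x0) * (1 - wsum (K x) (fun y => (~~ at0 y)%:R * 1)).
  move=> x; rewrite -{2}(K_sum x) -mulN1r -wsumZ -wsumD -wsumZ -wsumD.
  apply: eq_bigr => p _; congr (_ * _) => /=; case: (boolP (at0 p.2)) => /= h.
    by rewrite at0_e//; ring.
  by ring.
rewrite /m !wsum_occS -mulN1r -wsumZ -wsumD -wsumZ -wsumD.
by apply: eq_bigr => p _; rewrite h mulN1r.
Qed.

Lemma occ_drift n : wsum (occ n.+2) g <= wsum (occ n.+1) g - delta * m n.+1.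
Proof.
rewrite wsum_occS /m -mulNr -wsumZ -wsumD.
apply: (@wsum_le_in (fun x => ~~ at0 x)); [exact: occ_pos|exact: occ_not_at0|].
move=> x nx; rewrite mulr1.
have h1 : wsum (K x) (fun y => (~~ at0 y)%:R * g y) <= wsum (K x) g.
  apply: wsum_le; first exact: K_ge0.
  by move=> y; case: (at0 y); rewrite /= ?mul0r ?mul1r.
exact: le_trans h1 (g_drift nx).
Qed.

(** Foster's criterion: off [at0] the function [g] falls by [delta] per step, so the expected
    remaining length is at most [g] after the first step divided by [delta]. The 1 counts the
    starting state, where no drift is assumed. *)
Lemma occ_mass_bound n : \sum_(k < n) m k <= 1 + wsum (occ 1) g / delta.
Proof.
have wg k : 0 <= wsum (occ k) g.
  have := @wsum_le (occ k) (fun=> 0) g (occ_pos k) g_ge0.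
  by rewrite {1}/wsum big1// => p _; rewrite mulr0.
have h k : delta * \sum_(i < k) m i.+1 <= wsum (occ 1) g - wsum (occ k.+1) g.
  elim: k => [|k IH]; first by rewrite big_ord0 mulr0 subrr.
  by rewrite big_ord_recr /= mulrDr; have := occ_drift k; lra.
case: n => [|n]; first by rewrite big_ord0 addr_ge0// divr_ge0// ltW.
rewrite big_ord_recl; apply: lerD.
  by rewrite /m /wsum /= big_seq1 mulr1.
by rewrite ler_pdivlMr// mulrC; apply: le_trans (h n) _; have := wg n.+1; lra.
Qed.

Let cm : cvgn (series m).
Proof.
apply: nondecreasing_is_cvgn; first by apply: nondecreasing_series.
exists (1 + wsum (occ 1) g / delta) => _ [n _ <-].
by rewrite /series /= big_mkord; exact: occ_mass_bound.
Qed.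

(** Killed mass is put back at [x0], so the drift of [f] summed over an excursion reduces to
    boundary terms, which vanish with the surviving mass [m n]. *)
Lemma occ_telescope f n :
  series (fun n => wsum (occ n) (fun x => wsum (K x) (f \o e) - f (e x))) n =
  wsum (occ n) (f \o e) - f (e x0) * m n.
Proof.
elim: n => [|n IH].
  by rewrite /series /= big_geq// /m /wsum /= !big_seq1 /= !mul1r mulr1 subrr.
rewrite seriesSr IH.
have -> : wsum (occ n) (fun x => wsum (K x) (f \o e) - f (e x)) =
    wsum (occ n) (fun x => wsum (K x) (f \o e)) - wsum (occ n) (f \o e).
  rewrite -[X in _ - X]mul1r -mulNr -wsumZ -wsumD; apply: eq_bigr => p _.
  by rewrite mulN1r.
by rewrite occ_step; ring.
Qed.

(** The absolute value only packages nonnegativity; [occ_pos] shows that it does not change the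
    weights. *)
Definition occ_measure (n : nat) : {measure set T -> \bar R} :=
  msum (fun i => mscale `|(nth (0, x0) (occ n) i).1|%:nng
                   (\d_(e (nth (0, x0) (occ n) i).2) : {measure set T -> \bar R}))
       (size (occ n)).

Definition excursion_measure : {measure set T -> \bar R} := mseries occ_measure 0.

Lemma integral_excursion (f : T -> R) : measurable_fun setT f -> (forall x, 0 <= f x) ->
  (\int[excursion_measure]_x (f x)%:E = \sum_(n <oo) (wsum (occ n) (f \o e))%:E)%E.
Proof.
move=> mf f0; have mf' := (measurable_EFinP _ _).2 mf.
rewrite ge0_integral_measure_series//; last by move=> t _; rewrite lee_fin.
apply: eq_eseriesr => n _.
rewrite ge0_integral_measure_sum//; last by move=> t _; rewrite lee_fin.
rewrite /wsum (big_nth (0, x0)) big_mkord -sumEFin; apply: eq_bigr => i _.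
rewrite ge0_integral_mscale//; last by move=> t _; rewrite lee_fin.
rewrite integral_dirac// diracT mul1e -EFinM /= ger0_norm//.
exact: (all_nthP (0, x0) (occ_pos n)).
Qed.

(** The function [h] plays the role of a generator applied to [f]. It is prescribed on the image of
    [e] only, where uniformization at rate [c] expresses it through [K]. *)
Lemma excursion_invariant : exists P : probability T R,
  (forall A, measurable A -> (forall x, A (e x)) -> P A = 1%E) /\
  (forall (c : R) f h, bmeas f -> bmeas h ->
     (forall x, h (e x) = c * (wsum (K x) (f \o e) - f (e x))) -> \int[P]_x h x = 0).
Proof.
set nu := excursion_measure.
pose mass := limn (series m).
have mass1 : 1 <= mass.
  have := @nondecreasing_cvgn_le R (series m) (nondecreasing_series (fun n _ _ => m_ge0 n)) cm 1%N.
  by rewrite /series /= big_nat1 /m /wsum /= big_seq1 mulr1.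
have nu_cst (c : R) : 0 <= c -> (\int[nu]_x c%:E = (c * mass)%:E)%E.
  move=> c0; rewrite integral_excursion//.
  apply/cvg_lim => //.
  have -> : (fun n => (\sum_(0 <= i < n) (wsum (occ i) ((fun=> c) \o e))%:E)%E) =
     EFin \o (fun n => c * series m n).
    apply/funext => n /=; rewrite sumEFin; congr EFin.
    by rewrite /series /= mulr_sumr; apply: eq_bigr => i _; rewrite -wsumZ; apply: eq_bigr => p _; rewrite /= mulr1.
  by apply: cvg_EFin; [exact: nearW|apply: cvgMr].
have nuT : nu setT = mass%:E.
  by have := nu_cst 1 ler01; rewrite integral_cst// mul1e mul1r.
pose P := mnormalize nu (\d_point : probability T R).
have mass0 : 0 < mass by exact: lt_le_trans mass1.
have PE A : P A = (nu A * (mass^-1)%:E)%E.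
  rewrite /P /mnormalize nuT; case: ifPn => // /orP[|//].
  by rewrite eqe gt_eqF.
have iPE (f : T -> R) : measurable_fun setT f -> (forall x, 0 <= f x) ->
    (\int[P]_x (f x)%:E = (mass^-1)%:E * \int[nu]_x (f x)%:E)%E.
  move=> mf f0; have k0 : 0 <= mass^-1 by rewrite invr_ge0 ltW.
  have -> : (\int[P]_x (f x)%:E = \int[mscale (NngNum k0) nu]_x (f x)%:E)%E.
    apply: eq_measure_integral => A mA _.
    transitivity (nu A * (mass^-1)%:E)%E; first exact: PE.
    by rewrite /mscale /= muleC.
  rewrite ge0_integral_mscale//; first exact/measurable_EFinP.
  by move=> x _; rewrite lee_fin.
have limE (k : T -> R) (l : R) : measurable_fun setT k -> (forall x, 0 <= k x) ->
    (fun n => series (fun n => wsum (occ n) (k \o e)) n) @ \oo --> l ->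
    \int[P]_x k x = mass^-1 * l.
  move=> mk k0 kl; rewrite /Rintegral iPE// integral_excursion//.
  rewrite (_ : (\sum_(n <oo) _)%E = l%:E); first by rewrite -EFinM.
  apply/cvg_lim => //.
  rewrite (_ : (fun n => _) = EFin \o (fun n => series (fun n => wsum (occ n) (k \o e)) n)).
    by apply: cvg_EFin; [exact: nearW|].
  by apply/funext => n /=; rewrite sumEFin.
exists P; split.
  move=> A mA eA.
  have : \int[P]_x (\1_A x : R) = 1.
    rewrite (limE _ mass); [by rewrite mulVf// gt_eqF|exact: measurable_indic| |].
      by move=> x; rewrite indicE ler0n.
    rewrite (_ : (fun n => _) = series m)//; apply/funext => n; rewrite /series /=.
    apply: eq_bigr => i _; apply: eq_bigr => p _ /=.
    by rewrite indicE mem_set//; exact: eA.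
  rewrite prob_Rintegral_indic// => PA1.
  by rewrite -[LHS]fineK ?PA1// fin_num_measure.
move=> c f h [mf [cf fP]] bh hE; have [mh [ch hP]] := bh.
have m0 : m @ \oo --> (0 : R) by exact: cvg_series_cvg_0.
have fto0 : (fun n => wsum (occ n) (f \o e)) @ \oo --> (0 : R).
  apply/cvgr0Pnorm_le => eps eps0.
  have cf0 : 0 <= cf by apply: le_trans (fP point).
  have c0 : (fun n => cf * m n) @ \oo --> cf * 0 by apply: cvgMr.
  rewrite mulr0 in c0.
  have /cvgr0Pnorm_le/(_ _ eps0) := c0; apply: filterS => n hn.
  apply: le_trans hn; rewrite [leRHS]ger0_norm ?mulr_ge0//.
  by apply: wsum_norm => [|x]; [exact: occ_pos|exact: fP].
have ch0 : 0 <= ch by apply: le_trans (hP point).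
(* Adding [ch] makes the integrand nonnegative, as [integral_excursion] requires; the constant
   cancels at the end. *)
have : \int[P]_x (h x + ch) = mass^-1 * (ch * mass).
  apply: limE => [|x|].
  - exact: measurable_funD.
  - by have := hP x; rewrite ler_norml => /andP[]; lra.
  have -> : (fun n => series (fun n => wsum (occ n) ((fun x => h x + ch) \o e)) n) =
     (fun n => c * (wsum (occ n) (f \o e) - f (e x0) * m n) + ch * series m n).
    apply/funext => n; rewrite -occ_telescope /series /= !mulr_sumr -big_split /=.
    apply: eq_bigr => i _; rewrite -!wsumZ -wsumD; apply: eq_bigr => p _ /=.
    by rewrite hE; ring.
  have : (fun n => c * (wsum (occ n) (f \o e) - f (e x0) * m n) + ch * series m n)
     @ \oo --> c * (0 - f (e x0) * 0) + ch * mass.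
    apply: cvgD; last by apply: cvgMr.
    apply: cvgMr; apply: cvgB => //.
    by apply: cvgMr.
  by rewrite mulr0 subr0 mulr0 add0r.
rewrite bmeas_RintegralD//; last exact: bmeas_cst.
rewrite prob_Rintegral_cst => hE1.
have : mass^-1 * (ch * mass) = ch by field; rewrite gt_eqF.
lra.
Qed.

End excursion.

(** * A blank measure at the fixed state *)

Section fixed_blank_measure.
Context {R : realType} {M : nat}.
Variables (mu gamma : 'I_M -> R) (lambda : R).
Hypotheses (mu_gt0 : forall j, 0 < mu j) (gamma_gt0 : forall j, 0 < gamma j).
Hypothesis (lambda_gt0 : 0 < lambda).
Local Notation a := (fun k => mu k * gamma k).
Variables J I : 'I_M.
Hypothesis J_critical : prefix_sum a J <= lambda < prefix_sum a J.+1.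
Hypothesis I_critical : prefix_sum a I < lambda <= prefix_sum a I.+1.
Local Notation xs := (fixed_state mu gamma lambda).
Local Notation counts := {ffun 'I_M -> nat}.
Implicit Types (c : counts) (k : 'I_M).

(* Types below [I] have finitely many idle servers, counted by [c]; there are
   infinitely many idle servers of type [I]. *)
Definition embed c : blank M :=
  fun i j => if (i == 0%N) && (j < I)%N then Some (c j) else None.

Definition incr c k : counts := [ffun j => if j == k then (c j).+1 else c j].

Definition is_first c k := [&& (k < I)%N, c k != 0%N & [forall l : 'I_M, (l < k)%N ==> (c l == 0%N)]].

Definition decr_at c k : counts := [ffun j => if j == k then (c j).-1 else c j].

Definition decr c : counts := if [pick k | is_first c k] is Some k then decr_at c k else c.

Definition total_rate : R := lambda + prefix_sum a I.

(** Uniformization at rate [total_rate]. An arrival takes an idle server of the first available type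
    below [I]; when there is none, it joins type [I] and [decr] keeps the state. *)
Definition jump c : seq (R * counts) :=
  rcons [seq (a k / total_rate, incr c k) | k <- enum 'I_M & (k < I)%N]
    (lambda / total_rate, decr c).

Let a_ge0 k : 0 <= a k. Proof. by rewrite ltW// mulr_gt0. Qed.

Let rate_gt0 : 0 < total_rate. Proof. by rewrite ltr_pwDl// sumr_ge0. Qed.

Lemma wsum_jump c (f : counts -> R) : wsum (jump c) f =
  \sum_(k < M | (k < I)%N) a k / total_rate * f (incr c k) + lambda / total_rate * f (decr c).
Proof.
rewrite /wsum /jump -cats1 big_cat big_seq1 /=; congr (_ + _).
by rewrite big_map big_filter big_enum_cond.
Qed.

Lemma jump_ge0 c : all (fun p : R * counts => 0 <= p.1) (jump c).
Proof.
rewrite all_rcons /= divr_ge0 ?(ltW lambda_gt0) ?(ltW rate_gt0)//=.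
by apply/allP => _ /mapP[k _ ->] /=; rewrite divr_ge0// ltW.
Qed.

Lemma jump_sum c : wsum (jump c) (fun=> 1) = 1.
Proof.
rewrite wsum_jump; under eq_bigr do rewrite mulr1.
by rewrite mulr1 -mulr_suml -mulrDl addrC divff// gt_eqF.
Qed.

(** [embed] ignores the counts of types from [I] on, so emptiness is a predicate and not equality
    with the zero count. *)
Definition empty c := [forall k : 'I_M, (k < I)%N ==> (c k == 0%N)].

Definition count c : R := \sum_(k < M | (k < I)%N) (c k)%:R.

Lemma count_incr c k : (k < I)%N -> count (incr c k) = count c + 1.
Proof.
move=> kI; rewrite /count (bigD1 k)//= [in RHS](bigD1 k)//= ffunE eqxx -natr1.
rewrite (eq_bigr (fun l => (c l)%:R)); first by ring.
by move=> l /andP[_ lk]; rewrite ffunE (negbTE lk).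
Qed.

Lemma count_decr_at c k : (k < I)%N -> c k != 0%N -> count (decr_at c k) = count c - 1.
Proof.
move=> kI ck; rewrite /count (bigD1 k)//= [in RHS](bigD1 k)//= ffunE eqxx.
rewrite (eq_bigr (fun l => (c l)%:R)).
  by case: (c k) ck => // n _; rewrite /= -natr1; ring.
by move=> l /andP[_ lk]; rewrite ffunE (negbTE lk).
Qed.

Lemma is_first_exists c : ~~ empty c -> exists k, is_first c k.
Proof.
rewrite negb_forall => /existsP[k0]; rewrite negb_imply => /andP[k0I ck0].
case: (@arg_minnP _ k0 (fun k => c k != 0%N) val ck0) => k ck kmin.
exists k; apply/and3P; split=> //; first by apply: leq_ltn_trans (kmin k0 ck0) k0I.
by apply/forallP => l; apply/implyP; apply: contraTT => cl; rewrite -leqNgt; exact: kmin.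
Qed.

(** The total grows at rate [prefix_sum a I] and falls at rate [lambda]. The strict inequality in
    [I_critical] makes the drift negative; with [J] in place of [I] it would be 0 when lambda equals
    [prefix_sum a J]. *)
Lemma count_drift c : ~~ empty c ->
  wsum (jump c) count <= count c - (lambda - prefix_sum a I) / total_rate.
Proof.
move=> /is_first_exists[k0 k0P]; rewrite wsum_jump /decr.
case: pickP => [k /and3P[kI ck _]|/(_ k0)]; last by rewrite k0P.
rewrite count_decr_at// (eq_bigr (fun k => a k / total_rate * (count c + 1))); last first.
  by move=> l lI; rewrite count_incr.
rewrite -!mulr_suml -/(prefix_sum a I) le_eqVlt; apply/orP; left; apply/eqP.
have := rate_gt0; rewrite /total_rate => r0; field; rewrite gt_eqF//.
Qed.

Let zero : counts := [ffun=> 0%N].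

Lemma embed_empty c : empty c -> embed c = embed zero.
Proof.
move=> /forallP ce; apply/funext => i; apply/funext => j; rewrite /embed.
by case: ifP => // /andP[_ jI]; have /implyP/(_ jI)/eqP -> := ce j; rewrite ffunE.
Qed.

Lemma blankE_embed c : blankE (embed c).
Proof. by move=> i j; rewrite [embed c i.+1 j]/embed /=; case: (embed c i j). Qed.

Lemma update_embed_id g c i k : ~~ ((i == 0%N) && (k < I)%N) -> update g (embed c) i k = embed c.
Proof.
move=> h; apply/funext => i'; apply/funext => j'; rewrite /update.
by case: ifP => // /andP[/eqP -> /eqP ->]; rewrite /embed (negbTE h).
Qed.

Lemma update_embed_incr c k : (k < I)%N -> update succn (embed c) 0 k = embed (incr c k).
Proof.
move=> kI; apply/funext => i'; apply/funext => j'; rewrite /update /embed.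
case: (eqVneq i' 0%N) => _ //=.
by rewrite ffunE; case: eqVneq => [->|]; rewrite ?kI.
Qed.

Lemma update_embed_decr c k : (k < I)%N -> update predn (embed c) 0 k = embed (decr_at c k).
Proof.
move=> kI; apply/funext => i'; apply/funext => j'; rewrite /update /embed.
case: (eqVneq i' 0%N) => _ //=.
by rewrite ffunE; case: eqVneq => [->|]; rewrite ?kI.
Qed.

Lemma join_region_embed c k : (k < I)%N -> join_region 0 k (embed c) <-> is_first c k.
Proof.
move=> kI; split.
  move=> [_ lt _ _]; rewrite /embed /= kI => ck; apply/and3P; split=> //.
    by apply/eqP => ck0; apply: ck; rewrite ck0.
  apply/forallP => l; apply/implyP => lk; have := lt l lk.
  by rewrite /embed /= (ltn_trans lk kI) => -[->].
move=> /and3P[_ ck /forallP cl]; split=> //.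
- exact: blankE_embed.
- move=> l lk; rewrite /embed /= (ltn_trans lk kI).
  by have /implyP/(_ lk)/eqP -> := cl l.
- by rewrite /embed /= kI => -[/eqP]; exact/negP.
Qed.

Lemma is_first_inj c k l : is_first c k -> is_first c l -> k = l.
Proof.
move=> /and3P[_ ck /forallP hk] /and3P[_ cl /forallP hl]; apply/val_inj.
have [kl|lk|//] := ltngtP (val k) (val l).
- by have /implyP/(_ kl) := hl k; rewrite (negbTE ck).
- by have /implyP/(_ lk) := hk l; rewrite (negbTE cl).
Qed.

Lemma lt_I_fixed k : (k < I)%N -> xs 0%N k = 1.
Proof.
move=> kI; apply: (fixed_state_lt mu_gt0 gamma_gt0 J_critical).
rewrite ltnNge; apply/negP => Jk; have /andP[_ JU] := J_critical; have /andP[IL _] := I_critical.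
have := @prefix_sum_le R M a J.+1 I a_ge0 (leq_ltn_trans Jk kI).
lra.
Qed.

Lemma generator_embed (f : blank M -> R) c :
  blank_generator mu gamma lambda xs f (embed c) =
  total_rate * (wsum (jump c) (f \o embed) - f (embed c)).
Proof.
have r0 : total_rate != 0 by rewrite gt_eqF.
transitivity (\sum_(k < M | (k < I)%N) (a k * (f (embed (incr c k)) - f (embed c)) +
   lambda * (is_first c k)%:R * (f (embed (decr_at c k)) - f (embed c)))).
  rewrite /blank_generator [RHS]big_mkcond; apply: eq_bigr => k _.
  rewrite limn_series0 => [|i]; last by rewrite !update_embed_id// !subrr !mulr0 addr0.
  case: ifP => kI; last by rewrite !update_embed_id ?kI//= !subrr !mulr0 addr0.
  rewrite update_embed_incr// update_embed_decr// lt_I_fixed// [xs 1%N k]/= subr0 mulr1.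
  rewrite [gamma k * _]mulrC indicE; congr (_ + _ * _%:R * _); congr nat_of_bool.
  by apply/idP/idP; rewrite inE => /join_region_embed; apply.
rewrite big_split /= wsum_jump mulrBr mulrDr /=.
have -> : \sum_(k < M | (k < I)%N) a k * (f (embed (incr c k)) - f (embed c)) =
   total_rate * (\sum_(k < M | (k < I)%N) a k / total_rate * f (embed (incr c k)))
   - prefix_sum a I * f (embed c).
  rewrite /prefix_sum mulr_sumr mulr_suml -sumrB; apply: eq_bigr => k _.
  by rewrite mulrBr; congr (_ - _); field.
have -> : \sum_(k < M | (k < I)%N)
     lambda * (is_first c k)%:R * (f (embed (decr_at c k)) - f (embed c)) =
   lambda * (f (embed (decr c)) - f (embed c)).
  rewrite /decr; case: pickP => [k kP|nP].
    have /and3P[kI _ _] := kP.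
    rewrite (bigD1 k)//= kP mulr1 big1 ?addr0// => l /andP[lI lk].
    case: (boolP (is_first c l)) => [lP|]; last by rewrite mulr0 mul0r.
    by case/eqP: lk; exact: is_first_inj lP kP.
  rewrite subrr mulr0 big1// => k _.
  by rewrite nP mulr0 mul0r.
rewrite /total_rate in r0 *; field.
exact: r0.
Qed.

Lemma fixed_state_blank_measure : exists pi, is_blank_measure mu gamma lambda xs pi.
Proof.
have d0 : 0 < (lambda - prefix_sum a I) / total_rate.
  by rewrite divr_gt0// subr_gt0; have /andP[] := I_critical.
have c0 c : 0 <= count c by exact: sumr_ge0.
have [pi [pi1 pi0]] := @excursion_invariant _ (blank M) R _ embed jump zero empty count
  ((lambda - prefix_sum a I) / total_rate) jump_ge0 jump_sum embed_empty c0 d0 count_drift.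
have ss := fixed_state_in_space lambda mu_gt0 gamma_gt0.
have bL := blank_generator_bounded (fun j => ltW (mu_gt0 j)) (fun j => ltW (gamma_gt0 j))
  (ltW lambda_gt0) ss.
have st : is_stationary (blank_generator mu gamma lambda xs) pi.
  apply: (drift0_stationary bL) => f bf.
  apply: (pi0 total_rate f _ bf (bop_bmeas bL bf)) => c.
  exact: generator_embed.
have mR k : measurable (join_region 0 k : set (blank M)) := measurable_join_region 0 k.
have rateE k : (k < I)%N -> lambda * fine (pi (join_region 0 k)) = a k.
  move=> kI.
  have TG : forall g (v : blank M) i j, [set: blank M] (update g v i j) <-> [set: blank M] v by [].
  have := rate_conservation mu_gt0 gamma_gt0 (ltW lambda_gt0) ss st measurableT TG k.
  have mS : measurable [set v : blank M | v 0%N k <> None].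
    exact: (measurable_coord 0 k (fun a => a <> None)).
  have S1 : pi [set v : blank M | v 0%N k <> None] = 1%E.
    by apply: pi1 => // c; rewrite /embed /= kI.
  rewrite setIT [join_region 0 k `&` _]setIC (fine_prob_setI1 mS (mR k) S1) S1 => <-.
  by rewrite lt_I_fixed// subr0 !mulr1 mulrC.
exists pi; split=> //.
- by apply: pi1; [exact: measurable_blankE|exact: blankE_embed].
- move=> i j xij; apply: pi1; first exact: measurable_coord_eq.
  move=> c; rewrite /embed /=; case: ifP => // /andP[/eqP i0 jI].
  by move: xij; rewrite i0 lt_I_fixed// ltxx.
- move=> i j xij; have i0 : i = 0%N.
    by case: i xij => // i /= /eqP; rewrite eq_sym oner_eq0.
  rewrite {i}i0 in xij *; rewrite xij [xs 1%N j]/= subr0 mulr1.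
  rewrite -[pi _]fineK ?fin_num_measure// -EFinM lee_fin.
  have [jI|Ij|/val_inj jI] := ltngtP (val j) (val I); first by rewrite rateE.
    rewrite (_ : fine _ = 0) ?mulr0//.
    have n1 : pi (~` (join_region 0 j : set (blank M))) = 1%E.
      apply: pi1; first exact: measurableC.
      by move=> c [_ lt _ _ _]; have := lt I Ij; rewrite /embed /= ltnn.
    by have := fine_prob_setC pi (mR j); rewrite n1 /=; lra.
  (* Type [I] gets at most what the types below it leave, lambda - [prefix_sum a I], and
     [I_critical] bounds this by its own rate. *)
  have := @prob_sum_disjoint_le1 _ _ _ pi _ (fun k : 'I_M => (k < I.+1)%N) (join_region 0) mR
    (fun v k l h h' => (join_region_inj h h').2).
  rewrite -/(prefix_sum (fun k => fine (pi (join_region 0 k))) I.+1) prefix_sumS -jI.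
  move/(ler_wpM2l (ltW lambda_gt0)); rewrite mulrDr mulr1.
  have -> : lambda * prefix_sum (fun k => fine (pi (join_region 0 k))) j = prefix_sum a j.
    by rewrite /prefix_sum mulr_sumr; apply: eq_bigr => k kj; rewrite rateE// -jI.
  have /andP[_] := I_critical; rewrite prefix_sumS -jI; lra.
Qed.

End fixed_blank_measure.

Section fixed_point.
Context {R : realType} {M : nat}.
Variables (mu gamma : 'I_M -> R) (lambda : R).
Hypotheses (mu_gt0 : forall j, 0 < mu j) (gamma_gt0 : forall j, 0 < gamma j).
Hypothesis lambda_gt0 : 0 < lambda.
Variable J : 'I_M.
Local Notation a := (fun k => mu k * gamma k).
Hypothesis J_critical : prefix_sum a J <= lambda < prefix_sum a J.+1.
Local Notation xs := (fixed_state mu gamma lambda).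
Local Notation p := (join_prob mu gamma lambda xs).

Lemma saturated_type : exists I : 'I_M, prefix_sum a I < lambda <= prefix_sum a I.+1.
Proof.
have aJ : lambda <= prefix_sum a J.+1 by have /andP[_ /ltW] := J_critical.
case: (ex_minnP (ex_intro (fun n => lambda <= prefix_sum a n) J.+1 aJ)) => -[|n] hn nmin.
  by have := lambda_gt0; move: hn; rewrite /prefix_sum big_pred0//; lra.
have nM : (n < M)%N := leq_trans (nmin _ aJ) (ltn_ord J).
exists (Ordinal nM); rewrite /= hn andbT ltNge; apply/negP => /nmin.
by rewrite ltnn.
Qed.

Lemma fixed_state_join_prob :
  (forall k, lambda * p 0%N k = mu k * gamma k * xs 0%N k) /\
  (forall i k, p i.+1 k = 0).
Proof.
have [I IP] := saturated_type.
have [pi0 hpi0] := fixed_state_blank_measure mu_gt0 gamma_gt0 lambda_gt0 J_critical IP.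
case: (join_probP mu gamma lambda xs) => [[pi hpi pE]|[npi _]]; last first.
  by case: npi; exists pi0.
have l0 := lambda_gt0.
have plt (k : 'I_M) : (k < J)%N -> lambda * p 0%N k = a k.
  by move=> kJ; rewrite pE; exact: (fixed_state_join_rate mu_gt0 gamma_gt0 lambda_gt0 J_critical hpi).
have p0 i k : 0 <= p i k := join_prob_ge0 mu gamma lambda xs i k.
(* Type [J] has idle servers at the fixed state, so types up to [J] take all arrivals; as the total
   is at most 1, every other entry is 0. *)
have p1 : 1 <= \sum_(k < M | (k < J.+1)%N) p 0%N k.
  under eq_bigr do rewrite pE.
  apply: (blank_measure_join_ge1 hpi (ltnSn J)).
  exact: fixed_state_crit_lt1 J_critical.
have ple n := join_prob_sum_le1 mu gamma lambda xs n.
have sE := prefix_sum_split (p 0%N) J.+1.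
rewrite -/(prefix_sum (p 0%N) J.+1) in p1.
have rest0 : 0 <= \sum_(k < M | (J.+1 <= k)%N) p 0%N k by exact: sumr_ge0.
have lev0 : \sum_(k < M) p 0%N k = 1.
  by apply/eqP; rewrite eq_le; have := ple 1%N; rewrite big_ord1 => ->; rewrite sE; lra.
have lev i k : p i.+1 k = 0.
  apply/eqP; rewrite eq_le p0 andbT.
  have := ple i.+2; rewrite big_ord_recr big_ord_recl /= lev0.
  have h1 : 0 <= \sum_(i0 < i) \sum_(j < M) p (bump 0 i0) j.
    by apply: sumr_ge0 => ? _; exact: sumr_ge0.
  rewrite (bigD1 k)//=.
  have h2 : 0 <= \sum_(i0 < M | i0 != k) p i.+1 i0 by exact: sumr_ge0.
  lra.
have pgt (k : 'I_M) : (J < k)%N -> p 0%N k = 0.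
  move=> Jk; apply/eqP; rewrite eq_le p0 andbT.
  have : \sum_(k < M | (J.+1 <= k)%N) p 0%N k <= 0 by rewrite lev0 in sE; lra.
  rewrite (bigD1 k)//=.
  have h2 : 0 <= \sum_(i < M | (J < i)%N && (i != k)) p 0%N i by exact: sumr_ge0.
  lra.
split=> // k; have [kJ|Jk|/val_inj ->] := ltngtP (val k) (val J).
- by rewrite plt// (fixed_state_lt mu_gt0 gamma_gt0 J_critical kJ) mulr1.
- by rewrite pgt// (fixed_state_gt mu_gt0 gamma_gt0 J_critical Jk) !mulr0.
- rewrite (fixed_state_crit mu_gt0 gamma_gt0 J_critical).
  have r0 : \sum_(k < M | (J.+1 <= k)%N) p 0%N k = 0 by rewrite big1// => l Jl; exact: pgt.
  have := sE; rewrite lev0 r0 addr0 prefix_sumS => /(congr1 (fun y => lambda * y)).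
  rewrite mulr1 mulrDr.
  have -> : lambda * prefix_sum (p 0%N) J = prefix_sum a J.
    by rewrite /prefix_sum mulr_sumr; apply: eq_bigr => l lJ; rewrite plt.
  lra.
Qed.

Lemma fixed_state_is_fixed_point : is_fixed_point mu gamma lambda xs.
Proof.
have ss := fixed_state_in_space lambda mu_gt0 gamma_gt0.
split=> //; split=> // t t0 i j.
have fin c : lebesgue_measure.-integrable `[0, t] (EFin \o cst (c : R)).
  apply: measurable_bounded_integrable => //.
    by rewrite /= lebesgue_measure_itv/=; case: ifP => //; rewrite -EFinB ltry.
  by exists `|c|; split=> // m /ltW cm u _ /=.
split; [exact: fin|exact: fin|].
rewrite !Rintegral_cst//; set T := fine _.
have [pl0 pl] := fixed_state_join_prob.
have xS i' : xs i'.+1 j = 0 by [].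
case: i => [|i]; last by rewrite pl !xS subrr !mulr0 !mul0r mulr0 addr0 subr0.
rewrite xS subr0 -[LHS]addr0 -addrA; congr (_ + _).
have -> : lambda / gamma j * (p 0%N j * T) = lambda * p 0%N j * T / gamma j.
  by field; rewrite gt_eqF.
by rewrite pl0; field; rewrite gt_eqF.
Qed.

End fixed_point.

(** * Stationary distributions of the finite systems *)

Section servers.
Context {R : realType} {M : nat}.
Variables mu gamma : 'I_M -> R.
Hypothesis gamma_gt0 : forall j, 0 < gamma j.
Hypothesis capacity : \sum_(j < M) gamma j * mu j = 1.
Variable N : nat.
Hypothesis N_adm : admissible gamma N.
Local Notation server := (server gamma N).
Local Notation config := (config gamma N).
Implicit Types (q : config) (r : server).

Let N_gt0 : 0 < N%:R :> R. Proof. by rewrite ltr0n; exact: N_adm.1. Qed.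

Lemma sum_types (P : pred 'I_M) (F : 'I_M -> R) :
  \sum_(r : server | P (tag r)) F (tag r) = \sum_(k < M | P k) N%:R * gamma k * F k.
Proof.
transitivity (\sum_(r : server | P (tag r) && xpredT (tagged r)) F (tag r)).
  by apply: eq_bigl => r; rewrite andbT.
rewrite -(sig_big_dep P (fun k (_ : 'I_(Num.truncn (N%:R * gamma k))) => true) (fun k _ => F k)) /=.
apply: eq_bigr => k _; rewrite sumr_const card_ord -[LHS]mulr_natl; congr (_ * _).
by have [n _ ->] := N_adm.2 k; rewrite natrK.
Qed.

Lemma sum_tag (P : pred 'I_M) (h : server -> R) :
  \sum_(r : server | P (tag r)) h r = \sum_(k < M | P k) \sum_(r : server | tag r == k) h r.
Proof.
rewrite (partition_big (fun r : server => tag r) P)//=; apply: eq_bigr => k Pk.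
by apply: eq_bigl => r; case: eqP => [->|_]; rewrite ?Pk ?andbF.
Qed.

Lemma occupancyE q i k : N%:R * gamma k * occupancy q i k =
  \sum_(r : server | tag r == k) (i < q r)%N%:R.
Proof.
have gk := gamma_gt0 k.
rewrite /occupancy mulrC divfK; last by rewrite mulf_neq0// gt_eqF.
rewrite -sum1_card natr_sum big_mkcond /= [RHS]big_mkcond /=; apply: eq_bigr => r _.
rewrite (_ : (r \in in_set _) = `[< (tag r == k) && (i < q r)%N >])// asboolb.
by case: (tag r == k); case: (i < q r)%N.
Qed.

Lemma sum_occupancy (P : pred 'I_M) (c : 'I_M -> R) q i :
  \sum_(k < M | P k) gamma k * c k * occupancy q i k =
  N%:R^-1 * \sum_(r : server | P (tag r)) c (tag r) * (i < q r)%N%:R.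
Proof.
rewrite sum_tag mulr_sumr; apply: eq_bigr => k _.
rewrite (eq_bigr (fun r : server => c k * (i < q r)%N%:R)); last by move=> r /eqP ->.
rewrite -mulr_sumr -occupancyE; field; rewrite gt_eqF//.
Qed.

Lemma mu_total : \sum_(r : server) mu (tag r) = N%:R.
Proof.
rewrite (sum_types xpredT mu); under eq_bigr do rewrite -mulrA.
by rewrite -mulr_sumr capacity mulr1.
Qed.

(** Because of this, the uniform split among targets does not affect the drift of a sum of
    contributions of single servers. *)
Lemma targets_const q r r' : r \in targets q -> r' \in targets q ->
  q r = q r' /\ tag r = tag r'.
Proof.
rewrite !inE => /forallP h /forallP h'.
have /andP[a1 b1] := h r'; have /andP[a2 b2] := h' r.
have e : q r = q r' by apply/eqP; rewrite eqn_leq a1.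
split=> //; apply/val_inj/eqP; rewrite eqn_leq.
by rewrite (implyP b1) ?e// (implyP b2) ?e.
Qed.

Lemma targets_min q r r' : r \in targets q -> (q r <= q r')%N.
Proof. by rewrite inE => /forallP/(_ r')/andP[]. Qed.

Lemma targets_tag q r r' : r \in targets q -> q r' = q r -> (tag r <= tag r')%N.
Proof. by rewrite inE => /forallP/(_ r')/andP[_ /implyP h] e; apply: h; rewrite e. Qed.

Lemma targets_exists q (r0 : server) : exists r, r \in targets q.
Proof.
case: (@arg_minnP _ r0 xpredT (fun r => q r) isT) => r1 _ m1.
case: (@arg_minnP _ r1 (fun r => q r == q r1) (fun r => val (tag r)) (eqxx _)) => r2 e2 m2.
exists r2; rewrite inE; apply/forallP => r; apply/andP; split.
  by rewrite (eqP e2); exact: m1.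
by apply/implyP; rewrite (eqP e2) => /m2.
Qed.

End servers.

(** * Drift under the generator of the system with N servers *)

Section sajsq_drift.
Context {R : realType} {M : nat}.
Variables (mu gamma : 'I_M -> R) (lambda : R).
Hypothesis mu_gt0 : forall j, 0 < mu j.
Hypothesis capacity : \sum_(j < M) gamma j * mu j = 1.
Hypothesis lambda_gt0 : 0 < lambda.
Hypothesis M_gt0 : (0 < M)%N.
Variable N : nat.
Hypothesis N_adm : admissible gamma N.
Local Notation server := (server gamma N).
Local Notation config := (config gamma N).
Local Notation L := (@sajsq_generator R M mu gamma lambda N).
Implicit Types (q : config) (r : server) (f h : config -> R).

Let N_gt0 : 0 < N%:R :> R. Proof. by rewrite ltr0n; exact: N_adm.1. Qed.

Lemma server_exists : server.
Proof.
have [n n0 e] := cid2 (N_adm.2 (Ordinal M_gt0)).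
have h : (0 < Num.truncn (N%:R * gamma (Ordinal M_gt0)))%N by rewrite e natrK.
exact: (Tagged (fun j => 'I_(Num.truncn (N%:R * gamma j))) (Ordinal h)).
Qed.

Lemma targets_card_gt0 q : 0 < #|targets q|%:R :> R.
Proof.
rewrite ltr0n; apply/card_gt0P.
exact: (targets_exists q server_exists).
Qed.

Lemma arrival_rate_ge0 q : 0 <= N%:R * lambda / #|targets q|%:R :> R.
Proof. by rewrite divr_ge0 ?mulr_ge0// ltW. Qed.

Lemma arrival_sum q (c : R) :
  \sum_(r in targets q) N%:R * lambda / #|targets q|%:R * c = N%:R * lambda * c.
Proof.
rewrite sumr_const -[LHS]mulr_natr; have := targets_card_gt0 q.
by move=> h; field; rewrite gt_eqF.
Qed.

(** The jump rates are nonnegative. Applied to [Num.min (F q) n], this compares with [F] where F < n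
    and with the constant n elsewhere. *)
Lemma generator_monotone f h q : (forall q', f q' <= h q') -> f q = h q -> L f q <= L h q.
Proof.
move=> fh fhq; rewrite /sajsq_generator fhq; apply: lerD.
  by apply: ler_sum => r _; rewrite ler_wpM2l ?arrival_rate_ge0// lerB.
by apply: ler_sum => r _; rewrite ler_wpM2l ?(ltW (mu_gt0 _))// lerB.
Qed.

Lemma generator_cst (c : R) q : L (fun=> c) q = 0.
Proof.
rewrite /sajsq_generator !big1 ?addr0// => r _; by rewrite subrr mulr0.
Qed.

Lemma generator_linear a f h q : L (fun q => a * f q + h q) q = a * L f q + L h q.
Proof.
rewrite /sajsq_generator mulrDr !mulr_sumr addrACA -!big_split /=.
by congr (_ + _); apply: eq_bigr => r _; ring.
Qed.

Lemma generatorD f h q : L (fun q => f q + h q) q = L f q + L h q.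
Proof.
by have := generator_linear 1 f h q; rewrite mul1r; under eq_fun do rewrite mul1r.
Qed.

Lemma generatorZ a f q : L (fun q => a * f q) q = a * L f q.
Proof.
have := generator_linear a f (fun=> 0) q; rewrite generator_cst addr0.
by under eq_fun do rewrite addr0.
Qed.

Lemma departure_sum_le q (c : R) : 0 <= c ->
  \sum_(r | (0 < q r)%N) mu (tag r) * c <= N%:R * c.
Proof.
move=> c0; rewrite -mulr_suml ler_wpM2r//; have e := mu_total capacity N_adm.
apply: (@le_trans _ _ (\sum_(r : server) mu (tag r))); last by rewrite e.
rewrite [leRHS](bigID (fun r => (0 < q r)%N))/= lerDl sumr_ge0// => r _; exact: ltW.
Qed.

Lemma sajsq_bounded : bounded_operator (2 * N%:R * (lambda + 1)) L.
Proof.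
split=> //.
- move=> f c _ fc q; have c0 : 0 <= c by apply: le_trans (fc q).
  have df q' : `|f q' - f q| <= 2 * c.
    by rewrite mulr_natl mulr2n; exact: le_trans (ler_normB _ _) (lerD (fc _) (fc _)).
  have -> : 2 * N%:R * (lambda + 1) * c = N%:R * lambda * (2 * c) + N%:R * (2 * c) by ring.
  apply: le_trans (ler_normD _ _) _; apply: lerD.
    apply: le_trans (ler_norm_sum _ _ _) _; rewrite -(arrival_sum q (2 * c)).
    apply: ler_sum => r _; rewrite normrM ger0_norm ?arrival_rate_ge0//.
    by rewrite ler_wpM2l ?arrival_rate_ge0.
  apply: le_trans (ler_norm_sum _ _ _) _.
  apply: le_trans (departure_sum_le q _); last exact: mulr_ge0.
  apply: ler_sum => r _; rewrite normrM gtr0_norm//.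
  by rewrite ler_wpM2l ?(ltW (mu_gt0 _)).
- by move=> a f h _ _ q; exact: generator_linear.
Qed.

Definition server_sum (phi : 'I_M -> nat -> R) (c : R) : config -> R :=
  fun q => c + \sum_r phi (tag r) (q r).

Lemma server_sum_set_queue phi c q r n :
  server_sum phi c (set_queue q r n) - server_sum phi c q = phi (tag r) n - phi (tag r) (q r).
Proof.
rewrite /server_sum (bigD1 r)//= [in X in _ - X](bigD1 r)//= ffunE eqxx.
rewrite (eq_bigr (fun r' => phi (tag r') (q r'))); first by ring.
by move=> r' /negbTE rr; rewrite ffunE rr.
Qed.

Lemma generator_server_sum phi c q r0 : r0 \in targets q ->
  L (server_sum phi c) q =
  N%:R * lambda * (phi (tag r0) (q r0).+1 - phi (tag r0) (q r0)) +
  \sum_(r | (0 < q r)%N) mu (tag r) * (phi (tag r) (q r).-1 - phi (tag r) (q r)).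
Proof.
move=> r0q; rewrite /sajsq_generator; congr (_ + _); last first.
  by apply: eq_bigr => r _; rewrite server_sum_set_queue.
rewrite -(arrival_sum q (_ - _)); apply: eq_bigr => r rq.
by rewrite server_sum_set_queue; have [-> ->] := targets_const r0q rq.
Qed.

(** The remainder is the sum of rate times squared increment over all jumps. The total rate is at
    most N (lambda + 1), so increments of size 1 / N leave a remainder of order 1 / N. *)
Lemma generator_square phi c (delta : R) q :
  (forall k n, `|phi k n.+1 - phi k n| <= delta) ->
  L (fun q => server_sum phi c q ^+ 2) q <=
  2 * server_sum phi c q * L (server_sum phi c) q + N%:R * (lambda + 1) * delta ^+ 2.
Proof.
move=> dphi; set S := server_sum phi c.
have d0 : 0 <= delta by apply: le_trans (dphi (Ordinal M_gt0) 0%N).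
have sq q' : S q' ^+ 2 - S q ^+ 2 = 2 * S q * (S q' - S q) + (S q' - S q) ^+ 2 by ring.
have sqle (y : R) : `|y| <= delta -> y ^+ 2 <= delta ^+ 2.
  by move=> h; rewrite -[leLHS]real_normK ?num_real// ler_sqr ?nnegrE.
have -> : N%:R * (lambda + 1) * delta ^+ 2 =
  N%:R * lambda * delta ^+ 2 + N%:R * delta ^+ 2 by ring.
rewrite /sajsq_generator mulrDr addrACA; apply: lerD.
  rewrite mulr_sumr -(arrival_sum q (delta ^+ 2)) -big_split /=; apply: ler_sum => r _.
  rewrite sq mulrDr [X in X + _]mulrCA lerD2l ler_wpM2l ?arrival_rate_ge0//.
  by apply: sqle; rewrite server_sum_set_queue.
apply: le_trans (lerD (lexx _) (departure_sum_le q (sqr_ge0 _))).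
rewrite mulr_sumr -big_split /=; apply: ler_sum => r qr.
rewrite sq mulrDr [X in X + _]mulrCA lerD2l ler_wpM2l ?(ltW (mu_gt0 _))//.
apply: sqle; rewrite server_sum_set_queue distrC.
by case: (q r) qr => // n _ /=.
Qed.

Variable P : probability config R.
Hypothesis P_stationary : is_stationary L P.

Lemma measurable_config (A : set config) : measurable A.
Proof. by []. Qed.

(** [F] may be unbounded, so its mean drift need not vanish. Its truncation at n has drift at most
    C0 - eta on [A n] and at most C0 elsewhere, and the events [A n] increase to the one in
    question. *)
Lemma foster_bound (F G : config -> R) (C0 eta : R) : 0 <= C0 -> 0 < eta -> (forall q, 0 <= F q) ->
  (forall q, 0 <= G q) -> (forall q, L F q <= C0 - G q) ->
  fine (P [set q | eta <= G q]) <= C0 / eta.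
Proof.
move=> C00 eta0 F0 G0 LF.
pose A n := [set q | eta <= G q /\ F q < n%:R].
have bmeas_fin f c : (forall q, `|f q| <= c) -> bmeas f by move=> fc; split=> //; exists c.
have step n : fine (P (A n)) <= C0 / eta.
  pose Fn q := Num.min (F q) n%:R.
  have bF : bmeas Fn.
    apply: (@bmeas_fin _ n%:R) => q; rewrite ger0_norm; first by rewrite ge_min lexx orbT.
    by rewrite le_min F0 ler0n.
  have b0 : 0 <= 2 * N%:R * (lambda + 1).
    by rewrite !mulr_ge0// addr_ge0// ltW.
  have LFn q : L Fn q <= C0 - eta * \1_(A n) q.
    have [Fq|Fq] := ltP (F q) n%:R.
      apply: (@le_trans _ _ (L F q)).
        apply: generator_monotone => [q'|]; first by rewrite ge_min lexx.
        by apply/min_idPl; exact: ltW.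
      apply: le_trans (LF q) _; rewrite lerB// indicE.
      by have [/set_mem[]|] := boolP (q \in A n); rewrite ?mulr1// mulr0.
    rewrite indicE memNset ?mulr0 ?subr0; last by case=> _; rewrite ltNge Fq.
    apply: le_trans C00; rewrite -(generator_cst n%:R q).
    apply: generator_monotone => [q'|]; first by rewrite ge_min lexx orbT.
    by apply/min_idPr.
  have bi : bmeas (fun q => C0 - eta * \1_(A n) q).
    by apply: bmeasB; [exact: bmeas_cst|apply: bmeasM; [exact: bmeas_cst|exact: bmeas_indic]].
  have := bmeas_le_Rintegral P (bop_bmeas sajsq_bounded bF) bi LFn.
  rewrite (stationary_drift b0 sajsq_bounded P_stationary bF).
  rewrite bmeas_RintegralB; [|exact: bmeas_cst|by apply: bmeasM; [exact: bmeas_cst|exact: bmeas_indic]].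
  rewrite prob_Rintegral_cst bmeas_RintegralZ; last exact: bmeas_indic.
  by rewrite prob_Rintegral_indic// subr_ge0 ler_pdivlMr// mulrC.
have AE : [set q | eta <= G q] = \bigcup_n A n.
  apply/seteqP; split=> q /=; last by case=> n _ [].
  by move=> h; exists (Num.truncn (F q)).+1 => //; split=> //; exact: truncnS_gt.
have mU : measurable (\bigcup_n A n) by [].
have ndA : nondecreasing_seq A.
  move=> m n mn; apply/subsetPset => q [h1 h2]; split=> //.
  by apply: lt_le_trans h2 _; rewrite ler_nat.
have cvP : P \o A @ \oo --> (fine (P (\bigcup_n A n)))%:E.
  rewrite fineK ?fin_num_measure//.
  exact: (nondecreasing_cvg_mu (fun n => measurable_config (A n)) mU ndA).
rewrite AE; apply: (cvgr_to_le (fine_cvg cvP)).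
by apply: nearW => n /=; exact: step.
Qed.

End sajsq_drift.

(** * The Lyapunov function of the system with N servers *)

Section sajsq_lyapunov.
Context {R : realType} {M : nat}.
Variables (mu gamma : 'I_M -> R) (lambda : R).
Hypothesis mu_decr : forall j k : 'I_M, (j < k)%N -> mu k < mu j.
Hypotheses (mu_gt0 : forall j, 0 < mu j) (gamma_gt0 : forall j, 0 < gamma j).
Hypothesis gamma_sum : \sum_(j < M) gamma j = 1.
Hypothesis capacity : \sum_(j < M) gamma j * mu j = 1.
Hypotheses (lambda_gt0 : 0 < lambda) (lambda_lt1 : lambda < 1).
Hypothesis M_gt0 : (0 < M)%N.
Variable J : 'I_M.
Hypothesis J_critical : prefix_sum (fun k => mu k * gamma k) J <= lambda <
  prefix_sum (fun k => mu k * gamma k) J.+1.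
Variable N : nat.
Hypothesis N_adm : admissible gamma N.
Local Notation xs := (fixed_state mu gamma lambda).
Local Notation udev := (busy_dev mu gamma lambda J).
Local Notation umax := (busy_dev_max mu gamma lambda J).
Local Notation bdev := (idle_below gamma J).
Local Notation Bcap := (busy_capacity mu gamma J).
Local Notation Ecap := (busy_above mu gamma J).
Local Notation server := (server gamma N).
Local Notation config := (config gamma N).
Local Notation L := (@sajsq_generator R M mu gamma lambda N).
Local Notation kw := (idle_weight mu gamma lambda J).
Implicit Types (q : config) (r : server).

Let N_gt0 : 0 < N%:R :> R. Proof. by rewrite ltr0n; exact: N_adm.1. Qed.
Let umax_gt0 : 0 < umax. Proof. exact: busy_dev_max_gt0. Qed.

Lemma occupancy_itv q i k : 0 <= occupancy q i k <= 1.
Proof.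
have Ng : 0 < N%:R * gamma k by rewrite mulr_gt0.
rewrite -(pmulr_rge0 _ Ng); apply/andP; split; first by rewrite occupancyE// sumr_ge0.
rewrite -(ler_pM2l Ng) mulr1 occupancyE//.
have := sum_types N_adm (fun l => l == k) (fun=> 1).
rewrite big_pred1_eq mulr1 => <-; apply: ler_sum => r _.
by case: (i < q r)%N.
Qed.

(** By [capacity] the weights mu / N of all servers sum to 1, so this is a mean. *)
Definition mu_avg (h : server -> R) : R := N%:R^-1 * \sum_r mu (tag r) * h r.

Lemma mu_avg_le h h' : (forall r, h r <= h' r) -> mu_avg h <= mu_avg h'.
Proof.
move=> hh; rewrite /mu_avg ler_wpM2l ?invr_ge0 ?(ltW N_gt0)//; apply: ler_sum => r _.
by rewrite ler_wpM2l ?(ltW (mu_gt0 _)).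
Qed.

Lemma mu_avg_cst (c : R) : mu_avg (fun=> c) = c.
Proof.
rewrite /mu_avg -mulr_suml; have e := mu_total capacity N_adm.
transitivity (N%:R^-1 * (N%:R * c)); first by congr (_ * (_ * _)).
by rewrite mulKf// gt_eqF.
Qed.

Lemma mu_avgD h h' : mu_avg (fun r => h r + h' r) = mu_avg h + mu_avg h'.
Proof.
by rewrite /mu_avg -mulrDr -big_split /=; congr (_ * _); apply: eq_bigr => r _; rewrite mulrDr.
Qed.

Lemma mu_avgZ a h : mu_avg (fun r => a * h r) = a * mu_avg h.
Proof. by rewrite /mu_avg [RHS]mulrCA; congr (_ * _); rewrite mulr_sumr; apply: eq_bigr => r _; rewrite mulrCA. Qed.

Lemma mu_avg_prefix q n :
  \sum_(k < M | (k < n)%N) mu k * gamma k * occupancy q 0 k =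
  mu_avg (fun r => ((tag r < n) && (0 < q r))%N%:R).
Proof.
rewrite /mu_avg (eq_bigr (fun k => gamma k * mu k * occupancy q 0 k)); last first.
  by move=> k _; rewrite [mu k * _]mulrC.
rewrite (sum_occupancy gamma_gt0 N_adm (fun k : 'I_M => (k < n)%N)); congr (_ * _).
rewrite big_mkcond; apply: eq_bigr => r _.
by case: (tag r < n)%N; rewrite /= ?mulr0.
Qed.

Lemma busy_capacity_avg q : Bcap (occupancy q 0) =
  mu_avg (fun r => ((tag r < J.+1) && (0 < q r))%N%:R).
Proof. by rewrite -mu_avg_prefix. Qed.

Lemma busy_above_avg q : Bcap (occupancy q 0) + Ecap (occupancy q 0) =
  mu_avg (fun r => (0 < q r)%N%:R).
Proof.
rewrite -(prefix_sum_split (fun k => mu k * gamma k * occupancy q 0 k) J.+1).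
transitivity (\sum_(k < M | (k < M)%N) mu k * gamma k * occupancy q 0 k).
  by apply: eq_bigl => k; rewrite ltn_ord.
rewrite mu_avg_prefix; congr mu_avg; apply/funext => r.
by rewrite ltn_ord.
Qed.

Lemma idle_prefix q n :
  prefix_sum (fun k => gamma k * (1 - occupancy q 0 k)) n =
  N%:R^-1 * \sum_(r : server | (tag r < n)%N) (q r == 0%N)%:R.
Proof.
rewrite /prefix_sum (eq_bigr (fun k => gamma k - gamma k * 1 * occupancy q 0 k)); last first.
  by move=> k _; ring.
rewrite sumrB (sum_occupancy gamma_gt0 N_adm (fun k : 'I_M => (k < n)%N) (fun=> 1)).
have := sum_types N_adm (fun k : 'I_M => (k < n)%N) (fun=> 1).
rewrite (eq_bigr (fun k => N%:R * gamma k)); last by move=> k _; rewrite mulr1.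
rewrite -[X in _ = X -> _]mulr_sumr => e.
have -> : \sum_(k < M | (k < n)%N) gamma k = N%:R^-1 * \sum_(r : server | (tag r < n)%N) 1.
  by rewrite e mulKf// gt_eqF.
rewrite -mulrBr -sumrB; congr (_ * _); apply: eq_bigr => r _.
by case: (q r) => [|n']; rewrite /= mul1r ?subr0 ?subrr.
Qed.

(** Targets minimize first the queue length and then the type, so one idle server of type below [n]
    would force every target to be such a server. *)
Lemma idle_prefix_eq0 q n r0 : r0 \in targets q -> ~~ ((tag r0 < n)%N && (q r0 == 0%N)) ->
  prefix_sum (fun k => gamma k * (1 - occupancy q 0 k)) n = 0.
Proof.
move=> r0q nidle; rewrite idle_prefix big1 ?mulr0// => r rn.
case: (eqVneq (q r) 0%N) => [qr|//]; case/negP: nidle.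
have q0 : q r0 = 0%N by apply/eqP; rewrite -leqn0 -qr; exact: targets_min r0q.
rewrite q0 eqxx andbT; apply: leq_ltn_trans rn.
by apply: (targets_tag r0q); rewrite qr.
Qed.

Definition phi_u (k : 'I_M) (n : nat) : R := ((k < J.+1) && (0 < n))%N%:R / N%:R.
Definition phi_b (k : 'I_M) (n : nat) : R := ((k < J) && (n == 0))%N%:R / N%:R.
Definition phi_w (k : 'I_M) (n : nat) : R := (n%:R - ((k < J.+1) && (0 < n))%N%:R) / N%:R.
(** Increments of the binomial are queue lengths, so its drift contains minus [excess]. This
    controls the waiting jobs of all levels at once, as convergence in [norm1] demands. *)
Definition phi_h (n : nat) : R := 'C(n, 2)%:R / N%:R.

Lemma busy_dev_server_sum q : udev (occupancy q 0) =
  server_sum phi_u (- prefix_sum (fun k => gamma k * xs 0%N k) J.+1) q.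
Proof.
rewrite /busy_dev /server_sum addrC; congr (_ + _).
rewrite /prefix_sum (eq_bigr (fun k => gamma k * 1 * occupancy q 0 k)); last first.
  by move=> k _; rewrite mulr1.
rewrite (sum_occupancy gamma_gt0 N_adm (fun k : 'I_M => (k < J.+1)%N) (fun=> 1)).
rewrite big_mkcond mulr_sumr; apply: eq_bigr => r _; rewrite /phi_u.
by case: (tag r < J.+1)%N; rewrite /= ?mulr0 ?mul0r// mul1r mulrC.
Qed.

Lemma idle_below_server_sum q : bdev (occupancy q 0) = server_sum phi_b 0 q.
Proof.
rewrite /server_sum add0r /idle_below idle_prefix big_mkcond mulr_sumr; apply: eq_bigr => r _.
by rewrite /phi_b; case: (tag r < J)%N; rewrite /= ?mulr0 ?mul0r// mulrC.
Qed.

Lemma departure_avg q (phi : 'I_M -> nat -> R) (h : server -> R) :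
  (forall r, (0 < q r)%N -> phi (tag r) (q r).-1 - phi (tag r) (q r) = h r / N%:R) ->
  (forall r, q r = 0%N -> h r = 0) ->
  \sum_(r | (0 < q r)%N) mu (tag r) * (phi (tag r) (q r).-1 - phi (tag r) (q r)) = mu_avg h.
Proof.
move=> hp h0; rewrite /mu_avg mulr_sumr big_mkcond; apply: eq_bigr => r _.
case: ltnP => [qr|]; first by rewrite hp//; ring.
by rewrite leqn0 => /eqP /h0 ->; rewrite !mulr0.
Qed.

(** The rate, per server of the system, at which servers of type below [n] fall idle. *)
Definition one_job_capacity q (n : nat) : R :=
  mu_avg (fun r => ((tag r < n) && (q r == 1))%N%:R).

Lemma generator_u q c r0 : r0 \in targets q ->
  L (server_sum phi_u c) q =
  lambda * ((tag r0 < J.+1) && (q r0 == 0))%N%:R - one_job_capacity q J.+1.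
Proof.
move=> r0q; rewrite (generator_server_sum mu lambda M_gt0 N_adm _ _ r0q).
rewrite (departure_avg (h := fun r => -1 * ((tag r < J.+1) && (q r == 1))%N%:R)).
- rewrite mu_avgZ mulN1r; congr (_ - _); rewrite /phi_u.
  case: (tag r0 < J.+1)%N; case: (q r0) => [|n]; rewrite /= ?subrr ?mulr0//; field; rewrite gt_eqF//.
- move=> r; rewrite /phi_u; case: (tag r < J.+1)%N; case: (q r) => [|[|n]]//= _;
   rewrite ?subrr ?mulr0 ?mul0r//; ring.
- by move=> r ->; rewrite andbF mulr0.
Qed.

Lemma generator_b q r0 : r0 \in targets q ->
  L (server_sum phi_b 0) q =
  - lambda * ((tag r0 < J) && (q r0 == 0))%N%:R + one_job_capacity q J.
Proof.
move=> r0q; rewrite (generator_server_sum mu lambda M_gt0 N_adm _ _ r0q).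
rewrite (departure_avg (h := fun r => ((tag r < J) && (q r == 1))%N%:R)).
- congr (_ + _); rewrite /phi_b.
  case: (tag r0 < J)%N; case: (q r0) => [|n]; rewrite /= ?subrr ?mulr0//; field; rewrite gt_eqF//.
- move=> r; rewrite /phi_b; case: (tag r < J)%N; case: (q r) => [|[|n]]//= _;
   rewrite ?subrr ?mulr0 ?mul0r//; ring.
- by move=> r ->; rewrite andbF.
Qed.

Lemma generator_w q c r0 : r0 \in targets q ->
  L (server_sum phi_w c) q =
  lambda * (1 - ((tag r0 < J.+1) && (q r0 == 0))%N%:R) -
  (Bcap (occupancy q 0) + Ecap (occupancy q 0)) + one_job_capacity q J.+1.
Proof.
move=> r0q; rewrite (generator_server_sum mu lambda M_gt0 N_adm _ _ r0q).
rewrite (departure_avg (h := fun r => -1 * (0 < q r)%N%:R + ((tag r < J.+1) && (q r == 1))%N%:R)).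
- rewrite mu_avgD mu_avgZ mulN1r -busy_above_avg addrA; congr (_ - _ + _); rewrite /phi_w.
  case: (tag r0 < J.+1)%N; case: (q r0) => [|n]; rewrite /= -?natr1 ; field; rewrite gt_eqF//.
- move=> r; rewrite /phi_w; case: (tag r < J.+1)%N; case: (q r) => [|[|n]]//= _;
    rewrite -?natr1; ring.
- by move=> r ->; rewrite andbF mulr0 addr0.
Qed.

Definition excess q : R := mu_avg (fun r => (q r).-1%:R).

Lemma generator_h q r0 : r0 \in targets q ->
  L (server_sum (fun=> phi_h) 0) q = lambda * (q r0)%:R - excess q.
Proof.
move=> r0q; rewrite (generator_server_sum mu lambda M_gt0 N_adm _ _ r0q).
rewrite (departure_avg (phi := fun=> phi_h) (h := fun r => -1 * (q r).-1%:R)).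
- rewrite mu_avgZ mulN1r; congr (_ - _); rewrite /phi_h binS bin1 natrD; field; rewrite gt_eqF//.
- move=> r; case: (q r) => //= n _; rewrite /phi_h binS bin1 natrD; ring.
- by move=> r ->; rewrite mulr0.
Qed.

(* Chosen so that [eps * lambda * (u / umax) ^+ 2], which bounds the drift due
   to arrivals that find no idle server of type at most [J], takes half of the
   negative drift in [u ^+ 2]. *)
Definition eps : R := mu J * umax / (4 * lambda).

Definition config_lyapunov q : R :=
  (2 * umax)^-1 * (server_sum phi_u (- prefix_sum (fun k => gamma k * xs 0%N k) J.+1) q) ^+ 2 +
  (kw * server_sum phi_b 0 q ^+ 2 + (server_sum phi_w 0 q + eps * server_sum (fun=> phi_h) 0 q)).

Definition config_dissipation q : R :=
  mu J / (4 * umax) * udev (occupancy q 0) ^+ 2 + bdev (occupancy q 0) ^+ 2 +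
  Ecap (occupancy q 0) + eps * (1 - lambda) * excess q.

(** N times the remainders that [generator_square] leaves for the two squared terms, whose
    increments are at most 1 / N. *)
Definition noise_cst : R := (1 + lambda) * ((2 * umax)^-1 + kw).

Lemma eps_gt0 : 0 < eps.
Proof.
apply: divr_gt0; first exact: mulr_gt0 (mu_gt0 J) umax_gt0.
by apply: mulr_gt0.
Qed.

Lemma excess_ge0 q : 0 <= excess q.
Proof. by rewrite -(mu_avg_cst 0); apply: mu_avg_le. Qed.

Lemma config_dissipation_ge0 q : 0 <= config_dissipation q.
Proof.
have /andP[E0 _] := busy_above_itv mu_gt0 gamma_gt0 capacity J (fun k => occupancy_itv q 0 k).
have e0 := eps_gt0; have l1 := lambda_lt1; have Y0 := excess_ge0 q.
apply: addr_ge0; [apply: addr_ge0; [apply: addr_ge0|]|] => //.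
- apply: mulr_ge0; last exact: sqr_ge0.
  by apply: divr_ge0; [exact: ltW|apply: mulr_ge0 => //; exact: ltW].
- exact: sqr_ge0.
- by apply: mulr_ge0 => //; apply: mulr_ge0; lra.
Qed.

Lemma phi_w_ge0 k n : 0 <= phi_w k n.
Proof.
rewrite /phi_w divr_ge0 ?(ltW N_gt0)// subr_ge0 ler_nat.
by case: n => [|n]; rewrite ?andbF//; case: (k < J.+1)%N.
Qed.

Lemma config_lyapunov_ge0 q : 0 <= config_lyapunov q.
Proof.
have kw0 : 0 < kw by exact: idle_weight_gt0.
have e0 := eps_gt0.
apply: addr_ge0.
  by apply: mulr_ge0; [rewrite invr_ge0 mulr_ge0// ltW|exact: sqr_ge0].
apply: addr_ge0; first by apply: mulr_ge0; [exact: ltW|exact: sqr_ge0].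
apply: addr_ge0; first by rewrite /server_sum add0r sumr_ge0// => r _; exact: phi_w_ge0.
apply: mulr_ge0; first exact: ltW.
by rewrite /server_sum add0r sumr_ge0// => r _; rewrite divr_ge0// ltW.
Qed.

(** The target [r0] decides every case: if it is not an idle server of type at most [J], then u =
    umax, and if it is not an idle server of type below [J], then b = 0. So an arrival either acts
    as in the fluid limit or meets a vanishing factor 1 - u / umax or b. *)
Lemma config_drift q : L config_lyapunov q <= noise_cst / N%:R - config_dissipation q.
Proof.
have [r0 r0q] := targets_exists q (server_exists M_gt0 N_adm).
have um := umax_gt0; have muJ := mu_gt0 J; have l0 := lambda_gt0; have l1 := lambda_lt1.
have kw0 : 0 < kw by exact: idle_weight_gt0.
have e0 := eps_gt0; have Y0 := excess_ge0 q.
have y01 k := occupancy_itv q 0 k.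
have cd := capacity_drift mu_gt0 gamma_gt0 gamma_sum J_critical y01.
have /andP[b0 b1] := idle_below_itv gamma_gt0 gamma_sum J y01.
have ule := busy_dev_le_max mu_gt0 gamma_gt0 J_critical y01.
rewrite /config_lyapunov (generatorD mu lambda (fun q => (2 * umax)^-1 * server_sum phi_u _ q ^+ 2)).
rewrite generatorZ (generatorD mu lambda (fun q => kw * server_sum phi_b 0 q ^+ 2)) generatorZ.
rewrite (generatorD mu lambda (server_sum phi_w 0)) generatorZ.
have norm_le (b c : bool) : `|b%:R / N%:R - c%:R / N%:R| <= N%:R^-1 :> R.
  by case: b; case: c; rewrite /= ?subrr ?normr0 ?mul1r ?mul0r ?subr0 ?sub0r ?normrN
    ?invr_ge0 ?(ltW N_gt0)// ger0_norm// invr_ge0 ltW.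
have sq_u := @generator_square R M mu gamma lambda mu_gt0 capacity lambda_gt0 M_gt0 N
  N_adm phi_u (- prefix_sum (fun k => gamma k * xs 0%N k) J.+1) (N%:R^-1) q
  (fun k n => norm_le _ _).
have sq_b := @generator_square R M mu gamma lambda mu_gt0 capacity lambda_gt0 M_gt0 N
  N_adm phi_b 0 (N%:R^-1) q (fun k n => norm_le _ _).
rewrite -busy_dev_server_sum (generator_u _ r0q) in sq_u.
rewrite -idle_below_server_sum (generator_b r0q) in sq_b.
rewrite (generator_w _ r0q) (generator_h r0q).
rewrite /config_dissipation /noise_cst.
move: sq_u sq_b cd ule b0 b1.
have hB1 : 0 <= one_job_capacity q J.+1 <= Bcap (occupancy q 0).
  rewrite busy_capacity_avg -{1}(mu_avg_cst 0); apply/andP; split; apply: mu_avg_le => r //.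
  by case: (tag r < J.+1)%N => //; case: (q r) => [|[|n]].
have hB1' : one_job_capacity q J <= prefix_sum (fun k => mu k * gamma k * occupancy q 0 k) J.
  rewrite /prefix_sum mu_avg_prefix; apply: mu_avg_le => r.
  by case: (tag r < J)%N => //; case: (q r) => [|[|n]].
have chi_u : ~~ ((tag r0 < J.+1) && (q r0 == 0%N))%N -> udev (occupancy q 0) = umax.
  move=> h; apply/eqP; rewrite eq_sym -subr_eq0 (busy_dev_maxE mu_gt0 gamma_gt0 J_critical).
  by rewrite (idle_prefix_eq0 r0q h).
have chi_b : ~~ ((tag r0 < J) && (q r0 == 0%N))%N -> bdev (occupancy q 0) = 0.
  exact: idle_prefix_eq0 r0q.
have below : mu J * bdev (occupancy q 0) <=
    lambda - prefix_sum (fun k => mu k * gamma k * occupancy q 0 k) J.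
  have /andP[JL _] := J_critical.
  rewrite lerBrDr; apply: le_trans JL.
  rewrite /idle_below /prefix_sum mulr_sumr -big_split /=; apply: ler_sum => k kJ.
  have muk := mu_decr kJ; have gk := gamma_gt0 k; have /andP[x0 x1] := y01 k.
  have h1 : mu J * (gamma k * (1 - occupancy q 0 k)) <= mu k * (gamma k * (1 - occupancy q 0 k)).
    by rewrite ler_wpM2r ?(ltW muk)// mulr_ge0 ?(ltW gk)// subr_ge0.
  lra.
(* The queue of [r0] is minimal, so its waiting jobs number at most the mean [excess]. *)
have exc : (q r0 != 0%N) -> lambda * (q r0)%:R - excess q <= lambda - (1 - lambda) * excess q.
  move=> qn; have h : (q r0).-1%:R <= excess q.
    rewrite -(mu_avg_cst (q r0).-1%:R); apply: mu_avg_le => r.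
    by rewrite ler_nat -!subn1 leq_sub2r//; exact: targets_min.
  have -> : (q r0)%:R = (q r0).-1%:R + 1 :> R by rewrite natr1 prednK// lt0n.
  have := ler_wpM2l (ltW l0) h; lra.
move: hB1 hB1' chi_u chi_b below exc.
set u := udev _; set b := bdev _; set B := Bcap _; set E := Ecap _; set Y := excess q.
set B1 := one_job_capacity q J.+1; set B1' := one_job_capacity q J.
set A := prefix_sum _ J.
set X := server_sum _ _ ; set Z := server_sum _ _.
move=> /andP[B10 B1B] B1A chi_u chi_b below exc sq_u sq_b cd ule b0 b1.
have iu : 0 <= umax^-1 by rewrite invr_ge0 ltW.
(* The term (1 - u / umax) (B - B1), the counterpart of the last term of the fluid [dissipation], is
   dropped; [excess] measures the waiting jobs instead. *)
have P1 : u / umax * (lambda * ((tag r0 < J.+1) && (q r0 == 0%N))%N%:R - B1) +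
   lambda * (1 - ((tag r0 < J.+1) && (q r0 == 0%N))%N%:R) - B + B1 <= u / umax * (lambda - B).
  case: (boolP (_ && _)) chi_u => [_ _|_ /(_ isT) ->] /=.
    have c1 : u / umax <= 1 by rewrite ler_pdivrMr// mul1r.
    have : 0 <= (1 - u / umax) * (B - B1) by rewrite mulr_ge0// subr_ge0.
    lra.
  rewrite divff ?gt_eqF//; lra.
have P2 : b * (- lambda * ((tag r0 < J) && (q r0 == 0%N))%N%:R + B1') <= - mu J * b ^+ 2.
  case: (boolP (_ && _)) chi_b => [_ _|_ /(_ isT) ->] /=; last by rewrite mul0r expr0n /= mulr0.
  have : 0 <= b * (lambda - B1' - mu J * b) by rewrite mulr_ge0//; lra.
  rewrite mulr1 expr2; lra.
(* A busy target forces u = umax, so the leftover [lambda] equals lambda (u / umax)^2 and can be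
   charged to the decay in u^2. *)
have P3 : lambda * (q r0)%:R - Y <= lambda * (u ^+ 2 / umax ^+ 2) - (1 - lambda) * Y.
  have [q0|qn] := eqVneq (q r0) 0%N.
    have : 0 <= lambda * (u ^+ 2 / umax ^+ 2).
      by apply: mulr_ge0; [exact: ltW|apply: divr_ge0; exact: sqr_ge0].
    have : 0 <= lambda * Y by rewrite mulr_ge0// ltW.
    rewrite q0 mulr0; lra.
  have -> : u = umax by apply: chi_u; rewrite (negbTE qn) andbF.
  rewrite divff ?mulr1; last by rewrite expf_neq0// gt_eqF.
  exact: exc.
have P3' := ler_wpM2l (ltW e0) P3.
have epsE : eps * (lambda * (u ^+ 2 / umax ^+ 2)) = mu J / (4 * umax) * u ^+ 2.
  by rewrite /eps; field; rewrite !gt_eqF.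
have i2u : 0 <= (2 * umax)^-1 by rewrite invr_ge0 mulr_ge0// ltW.
have Q1 := ler_wpM2l i2u sq_u.
have Q2 := ler_wpM2l (ltW kw0) sq_b.
have P2' := ler_wpM2l (ltW kw0) P2.
have kwE : 2 * mu J * kw = idle_cost mu J / umax + 1.
  by rewrite /idle_weight; field; rewrite !gt_eqF.
have cd' : u / umax * (lambda - B) <=
    - (mu J / (2 * umax)) * u ^+ 2 + idle_cost mu J / umax * b ^+ 2.
  have := ler_wpM2r iu cd.
  have -> : u * (lambda - B) / umax = u / umax * (lambda - B) by ring.
  by have -> : (- (mu J / 2) * u ^+ 2 + idle_cost mu J * b ^+ 2) / umax =
     - (mu J / (2 * umax)) * u ^+ 2 + idle_cost mu J / umax * b ^+ 2 by field; rewrite gt_eqF.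
have nE : (1 + lambda) * ((2 * umax)^-1 + kw) / N%:R =
   (2 * umax)^-1 * (N%:R * (lambda + 1) * N%:R^-1 ^+ 2) + kw * (N%:R * (lambda + 1) * N%:R^-1 ^+ 2).
  by field; rewrite !gt_eqF.
rewrite nE; move: Q1 Q2 P3' P2'.
rewrite !mulrDr epsE.
have e1 D : (2 * umax)^-1 * (2 * u * D) = u / umax * D by field; rewrite gt_eqF.
have e2 D : kw * (2 * b * D) = 2 * (kw * (b * D)) by ring.
rewrite -!mulrDr.
rewrite [(2 * umax)^-1 * (2 * u * _ + _)]mulrDr e1 [kw * (2 * b * _ + _)]mulrDr e2.
have e3 : 2 * (kw * (- mu J * b ^+ 2)) = - (idle_cost mu J / umax * b ^+ 2) - b ^+ 2.
  have -> : 2 * (kw * (- mu J * b ^+ 2)) = - (2 * mu J * kw) * b ^+ 2 by ring.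
  by rewrite kwE; ring.
have e4 : mu J / (2 * umax) * u ^+ 2 = mu J / (4 * umax) * u ^+ 2 + mu J / (4 * umax) * u ^+ 2.
  by field; rewrite gt_eqF.
move=> Q1 Q2 P3' P2'.
rewrite mulNr e4 in cd'.
lra.
Qed.

End sajsq_lyapunov.

Lemma norm1_le (R : realType) (M : nat) (s : state R M) (c : R) : 0 <= c ->
  (forall j n, \sum_(i < n) `|s i j| <= c) -> (norm1 s <= c%:E)%E.
Proof.
move=> c0 sc; rewrite /norm1; apply: (big_ind (fun y => (y <= c%:E)%E)) => [|y z yo zo|j _].
- by rewrite lee_fin.
- by rewrite ge_max yo zo.
- apply: lime_le; first by apply: is_cvg_nneseries => n _ _; rewrite lee_fin.
  by apply: nearW => n; rewrite /= big_mkord sumEFin lee_fin.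
Qed.

(** * Concentration of stationary laws and weak convergence *)

Section stationary_concentration.
Context {R : realType} {M : nat}.
Variables (mu gamma : 'I_M -> R) (lambda : R).
Hypothesis mu_decr : forall j k : 'I_M, (j < k)%N -> mu k < mu j.
Hypotheses (mu_gt0 : forall j, 0 < mu j) (gamma_gt0 : forall j, 0 < gamma j).
Hypothesis gamma_sum : \sum_(j < M) gamma j = 1.
Hypothesis capacity : \sum_(j < M) gamma j * mu j = 1.
Hypotheses (lambda_gt0 : 0 < lambda) (lambda_lt1 : lambda < 1).
Hypothesis M_gt0 : (0 < M)%N.
Variable J : 'I_M.
Hypothesis J_critical : prefix_sum (fun k => mu k * gamma k) J <= lambda <
  prefix_sum (fun k => mu k * gamma k) J.+1.
Local Notation xs := (fixed_state mu gamma lambda).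
Local Notation udev := (busy_dev mu gamma lambda J).
Local Notation umax := (busy_dev_max mu gamma lambda J).
Local Notation bdev := (idle_below gamma J).
Local Notation Ecap := (busy_above mu gamma J).

(** Summed over levels, the indicators of more than i + 1 jobs count the waiting jobs of each
    server, whose mean weighted by mu is [excess]. *)
Lemma occupancy_tail N (q : config gamma N) j n : admissible gamma N ->
  \sum_(i < n) occupancy q i.+1 j <= excess mu q / (mu j * gamma j).
Proof.
move=> N_adm; have N0 : 0 < N%:R :> R by rewrite ltr0n; exact: N_adm.1.
have mj := mu_gt0 j; have gj := gamma_gt0 j.
have Ng : 0 < N%:R * gamma j by exact: mulr_gt0.
have count m : (\sum_(i < n) (i.+1 < m) <= m.-1)%N.
  suff : (\sum_(i < n) (i.+1 < m) <= minn n m.-1)%N.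
    by move=> /leq_trans; apply; exact: geq_minr.
  elim: n => [|n IH]; first by rewrite big_ord0.
  rewrite big_ord_recr/=; case: (ltnP n.+1 m) IH => /=; lia.
rewrite ler_pdivlMr ?mulr_gt0// -(ler_pM2l N0).
have -> : N%:R * ((\sum_(i < n) occupancy q i.+1 j) * (mu j * gamma j)) =
    mu j * \sum_(i < n) (N%:R * gamma j * occupancy q i.+1 j).
  by rewrite -mulr_sumr; ring.
rewrite /excess /mu_avg mulVKf ?gt_eqF//.
under eq_bigr do rewrite (occupancyE gamma_gt0 N_adm).
rewrite exchange_big/= mulr_sumr [leRHS](bigID (fun r => tag r == j))/=.
rewrite -[leLHS]addr0; apply: lerD; last first.
  by apply: sumr_ge0 => r _; rewrite mulr_ge0// ltW.
apply: ler_sum => r /eqP ->; rewrite ler_wpM2l ?(ltW mj)//.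
by rewrite -natr_sum ler_nat.
Qed.

Lemma norm1_occupancy N (q : config gamma N) : admissible gamma N ->
  (norm1 (fun i j => occupancy q i j - xs i j)%R <=
   (dist_cst mu gamma * (`|udev (occupancy q 0)| + bdev (occupancy q 0) +
      Ecap (occupancy q 0) + excess mu q))%:E)%E.
Proof.
move=> N_adm; have occ i k := occupancy_itv gamma_gt0 N_adm q i k.
have Y0 := excess_ge0 mu_gt0 capacity N_adm q.
have gsum := gamma_sum.
have dist k := dist_fixed_state mu_gt0 gamma_gt0 gamma_sum capacity J_critical (occ 0%N) k.
have step j n : \sum_(i < n) `|occupancy q i j - xs i j| <=
    dist_cst mu gamma * (`|udev (occupancy q 0)| + bdev (occupancy q 0) +
      Ecap (occupancy q 0) + excess mu q).
  apply: (@le_trans _ _ (\sum_(i < n.+1) `|occupancy q i j - xs i j|)).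
    by rewrite big_ord_recr/= lerDl.
  rewrite big_ord_recl/= mulrDr; apply: lerD; first exact: dist.
  under eq_bigr => i _.
    rewrite /= subr0 ger0_norm; last by have /andP[] := occ i.+1 j.
    over.
  apply: le_trans (occupancy_tail q j n N_adm) _.
  rewrite mulrC ler_wpM2r// /dist_cst (bigD1 j)//= -addrA addrCA lerDl.
  rewrite addr_ge0 ?invr_ge0 ?(ltW (gamma_gt0 _))// sumr_ge0// => k _.
  by rewrite addr_ge0 ?invr_ge0 ?mulr_ge0 ?(ltW (gamma_gt0 _)) ?(ltW (mu_gt0 _)).
apply: norm1_le => //.
by apply: le_trans (step (Ordinal M_gt0) 0%N); rewrite big_ord0.
Qed.

Lemma occupancy_in_space N (q : config gamma N) : admissible gamma N -> state_space (occupancy q).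
Proof.
move=> N_adm; have N0 : 0 < N%:R :> R by rewrite ltr0n; exact: N_adm.1.
have occ i k := occupancy_itv gamma_gt0 N_adm q i k.
split=> [i j|].
  have /andP[x0 _] := occ i.+1 j; have /andP[_ x1] := occ i j.
  split=> //; rewrite x0/= -(ler_pM2l (mulr_gt0 N0 (gamma_gt0 j))).
  rewrite !(occupancyE gamma_gt0 N_adm); apply: ler_sum => r _.
  by rewrite ler_nat; case: (ltnP i.+1 (q r)) => // /ltnW ->.
have Y0 := excess_ge0 mu_gt0 capacity N_adm q.
have := mu_gt0; have := gamma_gt0 => gP muP.
have inv0 k : 0 <= (mu k * gamma k)^-1 by rewrite invr_ge0 mulr_ge0// ltW.
apply: (@le_lt_trans _ _ (1 + excess mu q * \sum_k (mu k * gamma k)^-1)%:E); last exact: ltry.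
apply: norm1_le => [|j n]; first by rewrite addr_ge0// mulr_ge0// sumr_ge0.
apply: (@le_trans _ _ (\sum_(i < n.+1) `|occupancy q i j|)).
  by rewrite big_ord_recr/= lerDl.
rewrite big_ord_recl/=; apply: lerD; first by have /andP[x0 x1] := occ 0%N j; rewrite ger0_norm.
under eq_bigr => i _.
  rewrite /= ger0_norm; last by have /andP[] := occ i.+1 j.
  over.
apply: le_trans (occupancy_tail q j n N_adm) _.
by rewrite ler_wpM2l// (bigD1 j)//= lerDl sumr_ge0.
Qed.

Lemma config_dissipation_small (e : R) : 0 < e -> exists2 d, 0 < d &
  forall N (q : config gamma N), admissible gamma N -> config_dissipation mu lambda J q < d ->
  (norm1 (fun i j => occupancy q i j - xs i j)%R < e%:E)%E.
Proof.
move=> e0; have muJ := mu_gt0 J; have l1 := lambda_lt1.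
have um : 0 < umax by exact: busy_dev_max_gt0.
have ep : 0 < eps mu gamma lambda J by exact: eps_gt0.
pose C := dist_cst mu gamma.
have C0 : 0 <= C := dist_cst_ge0 mu_gt0 gamma_gt0.
(* Each of the four terms of [norm1_occupancy] will be at most [d1]; [C + 1] keeps the final
   inequality strict. *)
pose d1 := e / (4 * (C + 1)).
have d10 : 0 < d1 by rewrite divr_gt0// mulr_gt0// ltr_wpDl.
have d1e : C * (4 * d1) < e.
  have -> : e = (C + 1) * (4 * d1) by rewrite /d1; field; rewrite gt_eqF// ltr_wpDl.
  have : 0 < 4 * d1 by exact: mulr_gt0.
  lra.
have c1 : 0 < mu J / (4 * umax) by rewrite divr_gt0// mulr_gt0.
have c2 : 0 < eps mu gamma lambda J * (1 - lambda) by rewrite mulr_gt0// subr_gt0.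
exists (Num.min (Num.min (mu J / (4 * umax) * d1 ^+ 2) (d1 ^+ 2))
                (Num.min d1 (eps mu gamma lambda J * (1 - lambda) * d1))).
  by rewrite !lt_min (mulr_gt0 c1 (exprn_gt0 2 d10)) (exprn_gt0 2 d10) d10 mulr_gt0.
move=> N q N_adm; rewrite !lt_min => /andP[/andP[W1 W2] /andP[W3 W4]].
apply: le_lt_trans (norm1_occupancy q N_adm) _; rewrite lte_fin.
have x01 k := occupancy_itv gamma_gt0 N_adm q 0 k.
have /andP[b0 _] := idle_below_itv gamma_gt0 gamma_sum J x01.
have /andP[E0 _] := busy_above_itv mu_gt0 gamma_gt0 capacity J x01.
have Y0 := mulr_ge0 (ltW c2) (excess_ge0 mu_gt0 capacity N_adm q).
have u0 := mulr_ge0 (ltW c1) (sqr_ge0 (udev (occupancy q 0))).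
have bb0 := sqr_ge0 (bdev (occupancy q 0)).
move: W1 W2 W3 W4; rewrite /config_dissipation => W1 W2 W3 W4.
have u_le : `|udev (occupancy q 0)| <= d1.
  rewrite -ler_sqr ?nnegrE ?(ltW d10)// real_normK ?num_real//.
  by rewrite -(ler_pM2l c1); lra.
have b_le : bdev (occupancy q 0) <= d1.
  by rewrite -ler_sqr ?nnegrE ?(ltW d10)//; lra.
have E_le : Ecap (occupancy q 0) <= d1 by lra.
have Y_le : excess mu q <= d1 by rewrite -(ler_pM2l c2); lra.
by apply: le_lt_trans d1e; rewrite -/C ler_wpM2l//; lra.
Qed.

Lemma stationary_cvg (Pi : forall N, probability (config gamma N) R) :
  (forall N, admissible gamma N ->
     is_stationary (@sajsq_generator R M mu gamma lambda N) (Pi N)) ->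
  occupancy_cvg_weakly Pi xs.
Proof.
move=> Pi_st f fc [C fC]; have xs_in := fixed_state_in_space lambda mu_gt0 gamma_gt0.
apply/cvgrPdist_le => e e0; rewrite near_withinE.
have e20 : 0 < e / 2 by rewrite divr_gt0.
have [d d0 fd] := fc _ xs_in _ e20.
have [eta eta0 small] := config_dissipation_small d0.
have C0 : 0 <= C by apply: le_trans (fC _ xs_in).
set K := noise_cst mu gamma lambda J.
have K0 : 0 <= K.
  have kw0 : 0 < idle_weight mu gamma lambda J by exact: idle_weight_gt0.
  have um : 0 < umax by exact: busy_dev_max_gt0.
  have l0 := lambda_gt0; apply: mulr_ge0; first by rewrite addr_ge0// ltW.
  by apply: addr_ge0; [rewrite invr_ge0 mulr_ge0// ltW|exact: ltW].
near=> N => N_adm; have N0 : 0 < N%:R :> R by rewrite ltr0n; exact: N_adm.1.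
pose G := @config_dissipation R M mu gamma lambda J N.
pose A : set (config gamma N) := [set q | eta <= G q].
have PA : fine (Pi N A) <= K / N%:R / eta.
  apply: (foster_bound mu_gt0 capacity lambda_gt0 M_gt0 N_adm (Pi_st N N_adm)
    (F := config_lyapunov mu lambda J (N := N))) => //.
  - by rewrite divr_ge0// ltW.
  - by move=> q; exact: (config_lyapunov_ge0 mu_gt0 gamma_gt0 lambda_gt0 J_critical N_adm q).
  - by move=> q; exact: config_dissipation_ge0.
  - by move=> q; exact: config_drift.
have PA2 : 2 * C * fine (Pi N A) <= e / 2.
  apply: (@le_trans _ _ (2 * C * (K / N%:R / eta))); first by rewrite ler_wpM2l// mulr_ge0.
  (* Half of [e] is kept for the oscillation of f near the fixed state; this makes 2 C K / (N eta),
     the contribution of the exceptional event [A], at most the other half. *)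
  have large : 4 * C * K / (eta * e) <= N%:R by near: N; exact: nbhs_infty_ger.
  rewrite ler_pdivrMr ?mulr_gt0// in large.
  have -> : 2 * C * (K / N%:R / eta) = 4 * C * K / (2 * (N%:R * eta)) by field; rewrite !gt_eqF.
  by rewrite ler_pdivrMr ?mulr_gt0//; lra.
have bI (a b : R) : bmeas (fun q : config gamma N => a + b * \1_A q).
  by apply: bmeasD; [exact: bmeas_cst|apply: bmeasM; [exact: bmeas_cst|exact: bmeas_indic]].
have II a b : \int[Pi N]_q (a + b * \1_A q) = a + b * fine (Pi N A).
  have bi : bmeas (\1_A : config gamma N -> R) by exact: bmeas_indic.
  rewrite bmeas_RintegralD; [|exact: bmeas_cst|by apply: bmeasM => //; exact: bmeas_cst].
  by rewrite prob_Rintegral_cst bmeas_RintegralZ// prob_Rintegral_indic.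
have bf : bmeas (fun q : config gamma N => f (occupancy q)).
  by split=> //; exists C => q; apply: fC; exact: occupancy_in_space.
have dist q : `|f (occupancy q) - f xs| <= e / 2 + 2 * C * \1_A q.
  have [qA|qA] := leP eta (G q).
    rewrite indicE mem_set// mulr1; apply: (@le_trans _ _ (2 * C)); last by rewrite lerDr ltW.
    rewrite mulr_natl mulr2n; apply: le_trans (ler_normB _ _) _.
    by apply: lerD; apply: fC => //; exact: occupancy_in_space.
  rewrite indicE memNset ?mulr0 ?addr0; last by rewrite /A /= leNgt qA.
  by apply/ltW/fd; [exact: occupancy_in_space|exact: small].
rewrite distrC ler_distl; apply/andP; split.
  apply: (@le_trans _ _ (\int[Pi N]_q (f xs - e / 2 + (- (2 * C)) * \1_A q))).
    by rewrite II; lra.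
  apply: bmeas_le_Rintegral => // q; have := dist q; rewrite ler_distl => /andP[+ _]; lra.
apply: (@le_trans _ _ (\int[Pi N]_q (f xs + e / 2 + (2 * C) * \1_A q))); last by rewrite II; lra.
apply: bmeas_le_Rintegral => // q; have := dist q; rewrite ler_distl => /andP[_]; lra.
Unshelve. all: by end_near. Qed.

End stationary_concentration.

Theorem theorem11 (R : realType) (M : nat) (mu gamma : 'I_M -> R) (lambda : R)
  (M_gt0 : (0 < M)%N)
  (mu_decr : forall j k : 'I_M, (j < k)%N -> mu k < mu j)
  (mu_gt0 : forall j, 0 < mu j)
  (gamma_itv : forall j, 0 < gamma j <= 1)
  (gamma_sum : \sum_(j < M) gamma j = 1)
  (capacity : \sum_(j < M) gamma j * mu j = 1)
  (lambda_gt0 : 0 < lambda) (lambda_lt1 : lambda < 1) :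
  exists xs : state R M,
    [/\ (* (i) *)
        [/\ is_fixed_point mu gamma lambda xs,
            forall s, is_fixed_point mu gamma lambda s -> s = xs,
            forall x, fluid_solution mu gamma lambda x -> x 0 = xs ->
              forall t, 0 <= t -> x t = xs,
            forall j : 'I_M, xs 0%N j =
              Num.min 1 (Num.max (lambda - \sum_(k < M | (k < j)%N) mu k * gamma k) 0
                         / (mu j * gamma j))
          & forall i j, xs i.+1 j = 0],
        (* (ii) *)
        forall x, fluid_solution mu gamma lambda x ->
          forall i j, x t i j @[t --> +oo%R] --> xs i j
      & (* (iii) *)
        forall Pi : forall N : nat, probability (config gamma N) R,
          (forall N, admissible gamma N ->
             is_stationary (@sajsq_generator R M mu gamma lambda N) (Pi N)) ->
          occupancy_cvg_weakly Pi xs].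
Proof.
have gamma_gt0 j : 0 < gamma j by have /andP[] := gamma_itv j.
have [J J_critical] := critical_type capacity lambda_gt0 lambda_lt1.
have fixed := fixed_state_is_fixed_point mu_gt0 gamma_gt0 lambda_gt0 J_critical.
have cvg := fluid_cvg mu_decr mu_gt0 gamma_gt0 gamma_sum capacity lambda_gt0 lambda_lt1 J_critical.
exists (fixed_state mu gamma lambda); split.
- split=> //.
  + move=> s [_ s_sol]; apply/funext => i; apply/funext => j.
    exact: cvg_unique (cvg_cst (s i j)) (cvg _ s_sol i j).
  + move=> x x_sol x0 t t0.
    exact: (fluid_from_fixed_state mu_decr mu_gt0 gamma_gt0 gamma_sum capacity
      lambda_gt0 lambda_lt1 J_critical x_sol x0 t0).
- by move=> x x_sol i j; exact: cvg.
- move=> Pi Pi_st; exact: (stationary_cvg mu_decr mu_gt0 gamma_gt0 gamma_sum capacity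
    lambda_gt0 lambda_lt1 M_gt0 J_critical Pi_st).
Qed.
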